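(* Let $\Sigma$ be a two-dimensional surface equipped with a $C^3$-smooth Riemannian metric, and let $\gamma\subset\Sigma$ be a $C^3$-smooth curve with positive geodesic curvature $\kappa$. For every $A\in\gamma$ let $s_A$ denote the corresponding natural length parameter value. Then $$L(A,B)=\frac{\kappa^2(A)}{12}|s_A-s_B|^3(1+o(1)),$$ uniformly, as $s_A-s_B\to0$ so that $A$ and $B$ remain in a compact subarc in $\gamma$. This asymptotics is also uniform in the metric running through a closed bounded subset in the space of $C^3$-smooth Riemannian metrics.
   Context: For $A,B\in\gamma$ close enough let $C_{AB}$ be the unique nearby intersection point of the geodesics tangent to $\gamma$ at $A$ and at $B$, let $\lambda(A,B)$ be the length of the arc $AB$ of $\gamma$, let $|XY|$ denote the length of the small geodesic segment joining $X$ and $Y$, and set $$L(A,B):=|AC_{AB}|+|BC_{AB}|-\lambda(A,B).$$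
   Formalization: ''Closed bounded subset'' of metrics is replaced by: C^3-bounded on compacts, with uniform positive lower bounds on the metric (on compacts) and on κ (on compact subarcs). As worded it fails: for the unit circle and the metrics Euclid/n, the asymptotics is not uniform in n. *)

(* Defs.v *)
From Stdlib Require Import Reals.
From Coquelicot Require Import Coquelicot.
Open Scope R_scope.

(* The two coordinate indices are [false] (x) and [true] (y). *)
Definition proj (j : bool) (z : R * R) : R := if j then snd z else fst z.

Definition sum2 (f : bool -> R) : R := f false + f true.

Definition partial (j : bool) (f : R -> R -> R) (x y : R) : R :=
  if j then Derive (fun v => f x v) y else Derive (fun u => f u y) x.

(* A two-dimensional manifold is a set with an atlas of bijections [coord i]
   from [dom i] onto open subsets of the plane, inverse [param i]; the topology
   is the one generated by the charts.  Both maps are total functions whose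
   values outside their domains are irrelevant.  Transition maps of class C^4
   are the least regularity for which C^3 metrics make sense. *)
Record atlas := {
  pt :> Type;
  chart : Type;
  dom : chart -> pt -> Prop;
  coord : chart -> pt -> R * R;
  param : chart -> R * R -> pt;
  chart_at : pt -> chart;
  chart_at_dom : forall p, dom (chart_at p) p;
  paramK : forall i p, dom i p -> param i (coord i p) = p;
  overlap_open : forall i j,
    open (fun z : R * R => exists p, dom i p /\ dom j p /\ coord i p = z);
  transition_C4 : forall i j p k, dom i p -> dom j p ->
    ex_diff_n (fun x y => proj k (coord j (param i (x, y)))) 4
      (fst (coord i p)) (snd (coord i p))
}.

Arguments dom {a} _ _.
Arguments coord {a} _ _.
Arguments param {a} _ _.
Arguments chart_at {a} _.

Definition open_set (S : atlas) (U : S -> Prop) : Prop :=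
  forall i : chart S,
    open (fun z : R * R => exists p, dom i p /\ U p /\ coord i p = z).

Record surface := {
  atl :> atlas;
  hausdorff : forall p q : atl, p <> q ->
    exists U V : atl -> Prop, open_set atl U /\ open_set atl V /\
      U p /\ V q /\ forall x, ~ (U x /\ V x)
}.

Definition transition {S : surface} (i j : chart S) (k : bool) (x y : R) : R :=
  proj k (coord j (param i (x, y))).

Definition in_image {S : surface} (i : chart S) (z : R * R) : Prop :=
  exists p : S, dom i p /\ coord i p = z.

Definition quad (g : bool -> bool -> R) (v w : bool -> R) : R :=
  sum2 (fun j => sum2 (fun k => g j k * v j * w k)).

(* Riemannian metrics of class C^3, given by their components in every chart. *)
Record metric (S : surface) := {
  gc : chart S -> bool -> bool -> R -> R -> R;
  gc_C3 : forall (i : chart S) x y j k, in_image i (x, y) ->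
    ex_diff_n (gc i j k) 3 x y;
  gc_sym : forall (i : chart S) x y j k, in_image i (x, y) ->
    gc i j k x y = gc i k j x y;
  gc_pos : forall (i : chart S) x y (v : bool -> R), in_image i (x, y) ->
    (exists j, v j <> 0) -> 0 < quad (fun j k => gc i j k x y) v v;
  gc_compat : forall (i i' : chart S) (p : S) j k, dom i p -> dom i' p ->
    let x := fst (coord i p) in let y := snd (coord i p) in
    let x' := fst (coord i' p) in let y' := snd (coord i' p) in
    gc i j k x y =
      quad (fun l m => gc i' l m x' y')
        (fun l => partial j (transition i i' l) x y)
        (fun m => partial k (transition i i' m) x y)
}.

Arguments gc {S} _ _ _ _ _ _.

Section Geometry.

Context {S : surface} (g : metric S).

Definition gdet (i : chart S) (x y : R) : R :=
  gc g i false false x y * gc g i true true x y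
  - gc g i false true x y * gc g i true false x y.

Definition ginv (i : chart S) (j k : bool) (x y : R) : R :=
  (if Bool.eqb j k then gc g i (negb j) (negb k) x y else - gc g i j k x y)
  / gdet i x y.

(* [christoffel i k a b] is the symbol with upper index k, lower indices a, b *)
Definition christoffel (i : chart S) (k a b : bool) (x y : R) : R :=
  / 2 * sum2 (fun l => ginv i k l x y *
    (partial a (gc g i b l) x y + partial b (gc g i a l) x y
     - partial l (gc g i a b) x y)).

Definition curve_coord (i : chart S) (c : R -> S) (j : bool) (t : R) : R :=
  proj j (coord i (c t)).

Definition velocity (i : chart S) (c : R -> S) (j : bool) (t : R) : R :=
  Derive (curve_coord i c j) t.

(* class C^n at t; used for all t in an open interval *)
Definition curve_Cn (n : nat) (c : R -> S) (t : R) : Prop :=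
  forall i : chart S, dom i (c t) ->
    locally t (fun tau => dom i (c tau)) /\
    forall (j : bool) (k : nat), (k <= n)%nat ->
      ex_derive_n (curve_coord i c j) k t /\
      continuous (Derive_n (curve_coord i c j) k) t.

Definition regular (c : R -> S) (t : R) : Prop :=
  forall i : chart S, dom i (c t) -> exists j, velocity i c j t <> 0.

(* norm of a vector with components V at the point p, in the chart i *)
Definition chart_norm (i : chart S) (p : S) (V : bool -> R) : R :=
  sqrt (quad (fun j k => gc g i j k (fst (coord i p)) (snd (coord i p))) V V).

Definition chart_speed (i : chart S) (c : R -> S) (t : R) : R :=
  chart_norm i (c t) (fun j => velocity i c j t).

Definition speed (c : R -> S) (t : R) : R := chart_speed (chart_at (c t)) c t.

Definition arc_length (c : R -> S) (a b : R) : R := Rabs (RInt (speed c) a b).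

(* covariant derivative, with respect to the parameter of c, of the vector
   field V along c, in the chart i *)
Definition cov_deriv (i : chart S) (c : R -> S) (V : bool -> R -> R)
    (k : bool) (t : R) : R :=
  Derive (V k) t +
  sum2 (fun l => sum2 (fun m =>
    christoffel i k l m (fst (coord i (c t))) (snd (coord i (c t)))
    * velocity i c l t * V m t)).

(* The norm of the covariant derivative of the unit tangent vector with respect
   to the natural parameter s, d/ds being d/dt divided by the speed. *)
Definition geod_curvature (c : R -> S) (t : R) : R :=
  let i := chart_at (c t) in
  let T := fun j tau => velocity i c j tau / chart_speed i c tau in
  chart_norm i (c t) (fun k => cov_deriv i c T k t) / chart_speed i c t.

Definition geodesic (c : R -> S) (r : R) : Prop :=
  forall t, - r < t < r -> curve_Cn 2 c t /\
    forall i : chart S, dom i (c t) ->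
      forall k, cov_deriv i c (velocity i c) k t = 0.

(* c is the geodesic tangent to gam at gam a, with natural parameter, on (-r,r) *)
Definition tangent_geodesic (gam : R -> S) (a r : R) (c : R -> S) : Prop :=
  geodesic c r /\ c 0 = gam a /\
  forall i : chart S, dom i (gam a) ->
    forall k, velocity i c k 0 = velocity i gam k a / speed gam a.

(* L(A,B) for A = gam a, B = gam b, C_AB = cA u = cB v *)
Definition Lfun (gam cA cB : R -> S) (a b u v : R) : R :=
  arc_length cA 0 u + arc_length cB 0 v - arc_length gam a b.

Definition main_term (gam : R -> S) (a b : R) : R :=
  (geod_curvature gam a) ^ 2 / 12 * (arc_length gam a b) ^ 3.

End Geometry.

Definition nearby_intersection {S : surface} (cA cB : R -> S) (r : R)
    (w : R * R) : Prop :=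
  Rabs (fst w) < r /\ Rabs (snd w) < r /\ cA (fst w) = cB (snd w).

(* Points of gam are identified with their parameters, so that
   |s_A - s_B| = lambda(A,B) = arc_length g gam a b.  The radius r says what
   "nearby" means, and all sufficiently small radii are allowed: in particular
   those for which the tangent geodesics exist on (-r,r). *)
Definition uniform_asymptotics {S : surface} (M : metric S -> Prop)
    (gam : R -> S) (p q : R) : Prop :=
  exists r0, 0 < r0 /\ forall r, 0 < r <= r0 ->
  (exists delta, 0 < delta /\
    forall g, M g -> forall a b, p <= a <= q -> p <= b <= q ->
      0 < arc_length g gam a b < delta ->
      forall cA cB, tangent_geodesic g gam a r cA ->
        tangent_geodesic g gam b r cB ->
        exists! w, nearby_intersection cA cB r w) /\
  (forall eps, 0 < eps -> exists delta, 0 < delta /\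
    forall g, M g -> forall a b, p <= a <= q -> p <= b <= q ->
      0 < arc_length g gam a b < delta ->
      forall cA cB, tangent_geodesic g gam a r cA ->
        tangent_geodesic g gam b r cB ->
        forall u v, nearby_intersection cA cB r (u, v) ->
        Rabs (Lfun g gam cA cB a b u v - main_term g gam a b)
          <= eps * main_term g gam a b).

Definition rectangle_in {S : surface} (i : chart S) (x1 x2 y1 y2 : R) : Prop :=
  forall x y, x1 <= x <= x2 -> y1 <= y <= y2 -> in_image i (x, y).

(* boundedness in the C^3 topology (uniform convergence of the partial
   derivatives of order at most 3 on compact subsets of charts) *)
Definition C3_bounded {S : surface} (M : metric S -> Prop) : Prop :=
  forall (i : chart S) x1 x2 y1 y2, rectangle_in i x1 x2 y1 y2 ->
  exists K, forall g, M g ->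
    forall x y j k m n, x1 <= x <= x2 -> y1 <= y <= y2 -> (m + n <= 3)%nat ->
    Rabs (partial_derive m n (gc g i j k) x y) <= K.

(* M stays away from the boundary of the open set of the Riemannian metrics in
   which gam has positive geodesic curvature. Among symmetric tensor fields,
   this boundary is reached by degenerating the metric or the curvature. *)
Definition away_from_boundary {S : surface} (M : metric S -> Prop)
    (gam : R -> S) (alpha beta : Rbar) : Prop :=
  (forall (i : chart S) x1 x2 y1 y2, rectangle_in i x1 x2 y1 y2 ->
    exists c, 0 < c /\ forall g, M g ->
      forall x y, x1 <= x <= x2 -> y1 <= y <= y2 ->
      forall v : bool -> R,
        c * ((v false) ^ 2 + (v true) ^ 2)
          <= quad (fun j k => gc g i j k x y) v v) /\
  (forall p q : R, Rbar_lt alpha p -> p <= q -> Rbar_lt q beta ->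
    exists c, 0 < c /\ forall g, M g ->
      forall t, p <= t <= q -> c <= geod_curvature g gam t).

(* Main.v *)
Require Import Defs.
From Stdlib Require Import Reals Lra Lia Psatz ClassicalEpsilon.
From Coquelicot Require Import Coquelicot.
Open Scope R_scope.

(** Work in a chart and follow everything with the parameter [t] of [gam]: let
  [sigma] be its speed, [T] its unit tangent, [sigma W] the covariant derivative
  of [T], so that [kappa^2 = g(W,W)], and [p = g(T,.)].  Let [y] be a geodesic
  tangent to [gam] at [t0], run so that it has the same speed, [V] its unit
  tangent, [D = y - gam] and [tau = t - t0].  The geodesic equation gives
  [V - T = - sigma W tau + O(tau^2)] and [D = - sigma^2 W tau^2 / 2 + O(tau^3)].
  The component [p.D] is known to one more order: [g_y(V,V) = 1 = g_gam(T,T)]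
  expresses [p.(V - T)] by [g(V-T,V-T)] and the derivative of [g] along [D], the
  latter cancels against the derivative of [p], and
  [p.D = - sigma^3 kappa^2 tau^3 / 3 + O(tau^4)].

  If the geodesics tangent at [a] and [b = a + d] meet at their parameters [m]
  and [m'], then [L = int_{m'}^m sigma].  Comparing components along [W] yields
  [m, m' = (a + b) / 2 + O(d^2)], and comparing components along [T] yields
  [L = sigma^3 kappa^2 / 3 ((d/2)^3 + (d/2)^3) + O(d^4) = kappa^2 s^3 / 12 + O(s^4)].
  The constants only depend on [C^2] bounds for the metric, on its ellipticity and
  on [C^3] bounds for [gam].  A second intersection point is excluded because two
  short geodesics with the same endpoints coincide. *)

(** * Orders of magnitude *)

(** The obstacle is the order of [p.D]. An O(tau^4) expansion of the whole vector [D] would need a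
    Lipschitz derivative of the acceleration, hence four derivatives of [gam]; a C^3 curve only
    makes the acceleration Lipschitz. The tangential component escapes: the unit-length identities
    make [p.(V - T)] quadratic in [V - T] up to metric terms, so the first-order expansion of
    [V - T] is enough. Running the geodesics with the speed of [gam] turns [D'] into [sigma (V - T)]
    and makes all lengths integrals of one function: the two geodesic arcs measure [int_a^m sigma]
    and [int_m'^b sigma], which explains the formula for [L]. Uniformity comes from the choice of
    the variable: [A] is a type of whole configurations (metric, curve, geodesics, parameters), [P]
    imposes one common bound on them and [d] is the small parameter, so that the constant in the O
    cannot depend on any of them. *)

Definition bigO {A : Type} (P : A -> Prop) (d : A -> R) (n : nat) (f : A -> R) :=
  exists K, forall x, P x -> Rabs (f x) <= K * d x ^ n.

Section BigO.

Context {A : Type} {P : A -> Prop} {d : A -> R}.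
Hypothesis d01 : forall x, P x -> 0 <= d x <= 1.

Lemma bigO_ext n f g :
  (forall x, P x -> f x = g x) -> bigO P d n f -> bigO P d n g.
Proof.
intros e [K H]; exists K; intros x Px; rewrite <- (e x Px); auto.
Qed.

Lemma bigO_plus n f g :
  bigO P d n f -> bigO P d n g -> bigO P d n (fun x => f x + g x).
Proof.
intros [K H] [L J]; exists (K + L); intros x Px.
generalize (H x Px) (J x Px) (Rabs_triang (f x) (g x)); lra.
Qed.

Lemma bigO_opp n f : bigO P d n f -> bigO P d n (fun x => - f x).
Proof.
intros [K H]; exists K; intros x Px; rewrite Rabs_Ropp; auto.
Qed.

Lemma bigO_minus n f g :
  bigO P d n f -> bigO P d n g -> bigO P d n (fun x => f x - g x).
Proof.
intros Hf Hg; apply (bigO_plus n f (fun x => - g x)); auto.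
now apply bigO_opp.
Qed.

Lemma bigO_mult n m f g :
  bigO P d n f -> bigO P d m g -> bigO P d (n + m) (fun x => f x * g x).
Proof.
intros [K H] [L J]; exists (K * L); intros x Px.
rewrite Rabs_mult, pow_add.
replace (K * L * (d x ^ n * d x ^ m)) with ((K * d x ^ n) * (L * d x ^ m)) by ring.
apply Rmult_le_compat; auto using Rabs_pos.
Qed.

Lemma bigO_weaken n m f : (m <= n)%nat -> bigO P d n f -> bigO P d m f.
Proof.
intros mn [K H]; exists (Rabs K); intros x Px.
apply Rle_trans with (1 := H x Px).
destruct (d01 x Px) as [d0 d1].
(* [K] may be negative, and lowering the exponent enlarges the bound only if the constant is
   nonnegative. *)
apply Rle_trans with (Rabs K * d x ^ n).
  apply Rmult_le_compat_r; [now apply pow_le | apply RRle_abs].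
apply Rmult_le_compat_l; [apply Rabs_pos |].
replace n with (m + (n - m))%nat by lia; rewrite pow_add.
rewrite <- (Rmult_1_r (d x ^ m)) at 2.
apply Rmult_le_compat_l; [now apply pow_le |].
rewrite <- (pow1 (n - m)); apply pow_incr; lra.
Qed.

Lemma bigO_const c : bigO P d 0 (fun _ => c).
Proof. exists (Rabs c); intros x _; simpl; lra. Qed.

Lemma bigO_sum2 n f :
  (forall j, bigO P d n (f j)) -> bigO P d n (fun x => sum2 (fun j => f j x)).
Proof. intros H; unfold sum2; apply bigO_plus; apply H. Qed.

Lemma bigO_quad r n m q g v w :
  (forall j k, bigO P d r (fun x => g x j k)) ->
  (forall j, bigO P d n (fun x => v x j)) ->
  (forall j, bigO P d m (fun x => w x j)) ->
  (q <= r + n + m)%nat ->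
  bigO P d q (fun x => quad (g x) (v x) (w x)).
Proof.
intros Hg Hv Hw le; apply (bigO_weaken (r + n + m)); auto.
unfold quad.
apply (bigO_sum2 (r + n + m) (fun j x => sum2 (fun k => g x j k * v x j * w x k))); intros j.
apply (bigO_sum2 (r + n + m) (fun k x => g x j k * v x j * w x k)); intros k.
apply (bigO_mult (r + n) m (fun x => g x j k * v x j)); auto.
now apply bigO_mult.
Qed.

Lemma bigO_bound n f : bigO P d n f ->
  exists K, 0 < K /\ forall x, P x -> Rabs (f x) <= K * d x ^ n.
Proof.
intros [K H]; exists (Rabs K + 1); split; [generalize (Rabs_pos K); lra |].
intros x Px; apply Rle_trans with (1 := H x Px).
apply Rmult_le_compat_r; [apply pow_le; now apply d01 |].
generalize (RRle_abs K); lra.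
Qed.

End BigO.

(** Transports estimates between kinds of configurations: those for one geodesic are reused for
    pairs, with [h] extracting the smaller configuration and [c] comparing the small parameters. *)
Lemma bigO_comp {A B : Type} (P : A -> Prop) (d : A -> R) (Q : B -> Prop) (e : B -> R)
    (h : B -> A) (c : R) n f :
  (forall x, Q x -> P (h x) /\ 0 <= d (h x) <= c * e x) ->
  bigO P d n f -> bigO Q e n (fun x => f (h x)).
Proof.
intros H [K HK]; exists (Rabs K * c ^ n); intros x Qx.
destruct (H x Qx) as [Px dx].
apply Rle_trans with (1 := HK _ Px).
rewrite Rmult_assoc, <- Rpow_mult_distr.
apply Rle_trans with (Rabs K * d (h x) ^ n).
  apply Rmult_le_compat_r; [now apply pow_le | apply RRle_abs].
apply Rmult_le_compat_l; [apply Rabs_pos | now apply pow_incr].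
Qed.


(** * Mean value estimates and derivatives of bilinear expressions *)

Lemma MVT_is_derive (f df : R -> R) (a b : R) :
  (forall x, Rmin a b <= x <= Rmax a b -> is_derive f x (df x)) ->
  exists c, Rmin a b <= c <= Rmax a b /\ f b - f a = df c * (b - a).
Proof.
intros H; apply MVT_gen.
- intros x Hx; apply H; lra.
- intros x Hx; apply derivable_continuous_pt.
  exists (df x); apply is_derive_Reals; auto.
Qed.

Lemma between_Rabs (a b c : R) : Rmin a b <= c <= Rmax a b -> Rabs (c - a) <= Rabs (b - a).
Proof.
unfold Rmin, Rmax; destruct (Rle_dec a b); intros H; unfold Rabs;
repeat destruct Rcase_abs; lra.
Qed.

Lemma between_in (lo hi a b c : R) : lo <= a <= hi -> lo <= b <= hi ->
  Rmin a b <= c <= Rmax a b -> lo <= c <= hi.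
Proof.
unfold Rmin, Rmax; destruct (Rle_dec a b); lra.
Qed.

Lemma MVT_Lipschitz (f df : R -> R) (lo hi K : R) :
  (forall x, lo <= x <= hi -> is_derive f x (df x)) ->
  (forall x, lo <= x <= hi -> Rabs (df x) <= K) ->
  forall x y, lo <= x <= hi -> lo <= y <= hi -> Rabs (f y - f x) <= K * Rabs (y - x).
Proof.
intros Hd Hb x y Hx Hy.
destruct (MVT_is_derive f df x y) as [c [Hc ->]].
  intros z Hz; apply Hd, (between_in _ _ x y); auto.
rewrite Rabs_mult; apply Rmult_le_compat_r; [apply Rabs_pos |].
apply Hb, (between_in _ _ x y); auto.
Qed.

Lemma is_derive_eq (f : R -> R) (t a b : R) : is_derive f t a -> a = b -> is_derive f t b.
Proof. now intros H <-. Qed.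

Lemma is_derive_mul (f h : R -> R) (t a b : R) : is_derive f t a -> is_derive h t b ->
  is_derive (fun s => f s * h s) t (a * h t + f t * b).
Proof. intros Hf Hh; apply (is_derive_mult f h); auto; intros; apply Rmult_comm. Qed.

Lemma is_derive_sum2 (f : bool -> R -> R) (f' : bool -> R) (t : R) :
  (forall k, is_derive (f k) t (f' k)) -> is_derive (fun s => sum2 (fun k => f k s)) t (sum2 f').
Proof. intros H; apply (is_derive_plus (f false) (f true)); apply H. Qed.

Lemma is_derive_quad (g : R -> bool -> bool -> R) (v w : bool -> R -> R) g' v' w' (t : R) :
  (forall j k, is_derive (fun s => g s j k) t (g' j k)) ->
  (forall k, is_derive (v k) t (v' k)) -> (forall k, is_derive (w k) t (w' k)) ->
  is_derive (fun s => quad (g s) (fun k => v k s) (fun k => w k s)) t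
    (quad g' (fun k => v k t) (fun k => w k t) + quad (g t) v' (fun k => w k t)
     + quad (g t) (fun k => v k t) w').
Proof.
intros Hg Hv Hw; unfold quad at 1; eapply is_derive_eq.
- apply (is_derive_sum2 (fun j s => sum2 _)); intros j.
  apply (is_derive_sum2 (fun k s => _ * _)); intros k.
  apply is_derive_mul; [apply is_derive_mul | apply Hw]; [apply Hg | apply Hv].
- unfold quad, sum2; ring.
Qed.

(** * A geodesic tangent to a curve *)

(* Components in a chart, along the curve: [spd * acc] is the covariant
   derivative of the unit tangent [utan], and [met], [dmet], [chr] are the metric,
   its partial derivatives and the Christoffel symbols at the points of the curve. *)
Record arc_data := {
  cpos : bool -> R -> R;
  utan : bool -> R -> R;
  acc : bool -> R -> R;
  spd : R -> R;
  met : R -> bool -> bool -> R;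
  dmet : bool -> R -> bool -> bool -> R;
  chr : bool -> R -> bool -> bool -> R
}.

(** The covector [p] of the overview. For it the equation of motion involves half the derivative of
    the metric instead of Christoffel symbols, see [cotan_der]; this is what cancels against the
    expansion of the metric along [D]. *)
Definition cotan (a : arc_data) (k : bool) (t : R) : R :=
  sum2 (fun l => met a t k l * utan a l t).

Definition vec (f : bool -> R -> R) (t : R) : bool -> R := fun k => f k t.

Definition pair (p v : bool -> R) : R := sum2 (fun k => p k * v k).

(** An interface: the asymptotic calculus below sees neither charts nor manifolds, only these facts
    with their single constant [K]. Of [acc] only a Lipschitz bound is asked, which is what a C^3
    curve provides. *)
Record arc_ok (K lo hi : R) (a : arc_data) : Prop := {
  spd_pos : forall t, lo <= t <= hi -> / K <= spd a t;
  spd_bd : forall t, lo <= t <= hi -> Rabs (spd a t) <= K;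
  tan_bd : forall k t, lo <= t <= hi -> Rabs (utan a k t) <= K;
  acc_bd : forall k t, lo <= t <= hi -> Rabs (acc a k t) <= K;
  met_bd : forall j k t, lo <= t <= hi -> Rabs (met a t j k) <= K;
  dmet_bd : forall l j k t, lo <= t <= hi -> Rabs (dmet a l t j k) <= K;
  chr_bd : forall l j k t, lo <= t <= hi -> Rabs (chr a l t j k) <= K;
  spd_lip : forall t t', lo <= t <= hi -> lo <= t' <= hi ->
    Rabs (spd a t' - spd a t) <= K * Rabs (t' - t);
  acc_lip : forall k t t', lo <= t <= hi -> lo <= t' <= hi ->
    Rabs (acc a k t' - acc a k t) <= K * Rabs (t' - t);
  met_lip : forall j k t t', lo <= t <= hi -> lo <= t' <= hi ->
    Rabs (met a t' j k - met a t j k) <= K * Rabs (t' - t);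
  pos_der : forall k t, lo <= t <= hi -> is_derive (cpos a k) t (spd a t * utan a k t);
  tan_der : forall k t, lo <= t <= hi -> is_derive (utan a k) t
    (spd a t * (acc a k t - quad (chr a k t) (vec (utan a) t) (vec (utan a) t)));
  cotan_der : forall k t, lo <= t <= hi -> is_derive (cotan a k) t
    (spd a t * (sum2 (fun l => met a t k l * acc a l t)
       + / 2 * quad (dmet a k t) (vec (utan a) t) (vec (utan a) t)));
  met_sym : forall j k t, lo <= t <= hi -> met a t j k = met a t k j;
  tan_unit : forall t, lo <= t <= hi -> quad (met a t) (vec (utan a) t) (vec (utan a) t) = 1;
  tan_acc : forall t, lo <= t <= hi -> quad (met a t) (vec (utan a) t) (vec (acc a) t) = 0
}.

Definition curv2 (a : arc_data) (t : R) : R :=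
  quad (met a t) (vec (acc a) t) (vec (acc a) t).

(* The geodesic is parametrized like the curve, with [gtan] its unit tangent. *)
Record geo_data := {
  gpos : bool -> R -> R;
  gtan : bool -> R -> R;
  gmet : R -> bool -> bool -> R;
  gchr : bool -> R -> bool -> bool -> R
}.

Definition dif (a : arc_data) (y : geo_data) (k : bool) (t : R) : R := gpos y k t - cpos a k t.

Definition udif (a : arc_data) (y : geo_data) (k : bool) (t : R) : R := gtan y k t - utan a k t.

Definition norm1 (v : bool -> R) : R := Rabs (v false) + Rabs (v true).

(** The derivative of [gpos] contains [spd a], the speed of the curve. The last two fields compare
    the curve and the geodesic at the same parameter; they are the only regularity of the metric
    that the comparison uses. *)
Record geo_ok (K lo hi t0 : R) (a : arc_data) (y : geo_data) : Prop := {
  gpos_der : forall k t, lo <= t <= hi -> is_derive (gpos y k) t (spd a t * gtan y k t);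
  gtan_der : forall k t, lo <= t <= hi -> is_derive (gtan y k) t
    (spd a t * - quad (gchr y k t) (vec (gtan y) t) (vec (gtan y) t));
  gpos_init : forall k, gpos y k t0 = cpos a k t0;
  gtan_init : forall k, gtan y k t0 = utan a k t0;
  gtan_bd : forall k t, lo <= t <= hi -> Rabs (gtan y k t) <= K;
  gchr_bd : forall l j k t, lo <= t <= hi -> Rabs (gchr y l t j k) <= K;
  gtan_unit : forall t, lo <= t <= hi -> quad (gmet y t) (vec (gtan y) t) (vec (gtan y) t) = 1;
  gchr_lip : forall l j k t, lo <= t <= hi ->
    Rabs (gchr y l t j k - chr a l t j k) <= K * norm1 (vec (dif a y) t);
  gmet_taylor : forall j k t, lo <= t <= hi ->
    Rabs (gmet y t j k - met a t j k - pair (fun l => dmet a l t j k) (vec (dif a y) t))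
      <= K * norm1 (vec (dif a y) t) ^ 2
}.

Record sg := { sarc : arc_data; sgeo : geo_data; st0 : R; slo : R; shi : R; st : R }.

Section SingleGeodesic.

Variable K : R.

(** Moving the evaluation parameter keeps a configuration admissible, so that an O estimate can also
    be applied at an unknown mean value point. *)
Definition sg_at (w : sg) (t : R) : sg :=
  {| sarc := sarc w; sgeo := sgeo w; st0 := st0 w; slo := slo w; shi := shi w; st := t |}.

Record sg_ok (w : sg) : Prop := {
  sg_t0 : slo w <= st0 w <= shi w;
  sg_t : slo w <= st w <= shi w;
  sg_len : shi w - slo w <= 1;
  sg_arc : arc_ok K (slo w) (shi w) (sarc w);
  sg_geo : geo_ok K (slo w) (shi w) (st0 w) (sarc w) (sgeo w)
}.

Definition lag (w : sg) : R := Rabs (st w - st0 w).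

Notation "'O' n f" := (bigO sg_ok lag n f) (at level 10, n at level 9, f at level 9).

Lemma lag01 w : sg_ok w -> 0 <= lag w <= 1.
Proof.
intros []; unfold lag; split; [apply Rabs_pos |].
unfold Rabs; destruct Rcase_abs; lra.
Qed.

Lemma sg_at_ok w t : sg_ok w -> slo w <= t <= shi w -> sg_ok (sg_at w t).
Proof. intros [] H; split; auto. Qed.

(** Integration from the tangency point gains one order. The two equations with [sg_at] say that [F]
    and [DF] do not depend on [w] through its evaluation parameter. *)
Lemma bigO_int n (F DF : sg -> R -> R) :
  (forall w t, sg_ok w -> slo w <= t <= shi w -> is_derive (F w) t (DF w t)) ->
  (forall w, sg_ok w -> F w (st0 w) = 0) ->
  (forall w t, F (sg_at w t) = F w) -> (forall w t, DF (sg_at w t) = DF w) ->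
  O n (fun w => DF w (st w)) -> O (S n) (fun w => F w (st w)).
Proof.
intros Hd H0 HF HDF HO.
destruct (bigO_bound lag01 _ _ HO) as [C [C0 HC]].
exists C; intros w Pw.
destruct (MVT_is_derive (F w) (DF w) (st0 w) (st w)) as [c [Hc E]].
  intros t Ht; apply Hd; auto; apply (between_in _ _ (st0 w) (st w)); apply Pw || auto.
rewrite (H0 w Pw), Rminus_0_r in E; rewrite E, Rabs_mult.
assert (Hc' : slo w <= c <= shi w) by (apply (between_in _ _ (st0 w) (st w)); apply Pw || auto).
generalize (HC (sg_at w c) (sg_at_ok w c Pw Hc')); rewrite HDF; simpl; intros B.
change (Rabs (st w - st0 w)) with (lag w).
rewrite (Rmult_comm (lag w)), <- Rmult_assoc.
apply Rmult_le_compat_r; [apply Rabs_pos |].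
apply Rle_trans with (1 := B), Rmult_le_compat_l; [lra |].
apply pow_incr; split; [apply Rabs_pos |]; now apply between_Rabs.
Qed.

Definition D k (w : sg) := dif (sarc w) (sgeo w) k (st w).
Definition U k (w : sg) := udif (sarc w) (sgeo w) k (st w).

Ltac Obd H := exists K; intros w Pw; simpl; rewrite Rmult_1_r;
  eapply H; [apply Pw | apply Pw].

Lemma O_spd : O 0 (fun w => spd (sarc w) (st w)). Proof. Obd spd_bd. Qed.
Lemma O_tan k : O 0 (fun w => utan (sarc w) k (st w)). Proof. Obd tan_bd. Qed.
Lemma O_acc k : O 0 (fun w => acc (sarc w) k (st w)). Proof. Obd acc_bd. Qed.
Lemma O_met j k : O 0 (fun w => met (sarc w) (st w) j k). Proof. Obd met_bd. Qed.
Lemma O_dmet l j k : O 0 (fun w => dmet (sarc w) l (st w) j k). Proof. Obd dmet_bd. Qed.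
Lemma O_chr l j k : O 0 (fun w => chr (sarc w) l (st w) j k). Proof. Obd chr_bd. Qed.
Lemma O_gtan k : O 0 (fun w => gtan (sgeo w) k (st w)). Proof. Obd gtan_bd. Qed.
Lemma O_gchr l j k : O 0 (fun w => gchr (sgeo w) l (st w) j k). Proof. Obd gchr_bd. Qed.

Lemma O_spd0 : O 0 (fun w => spd (sarc w) (st0 w)). Proof. Obd spd_bd. Qed.
Lemma O_acc0 k : O 0 (fun w => acc (sarc w) k (st0 w)). Proof. Obd acc_bd. Qed.
Lemma O_met0 j k : O 0 (fun w => met (sarc w) (st0 w) j k). Proof. Obd met_bd. Qed.

Ltac Olip H := exists K; intros w Pw; simpl; rewrite Rmult_1_r;
  eapply H; [apply Pw | apply Pw | apply Pw].

Lemma O_spd1 : O 1 (fun w => spd (sarc w) (st w) - spd (sarc w) (st0 w)).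
Proof. Olip spd_lip. Qed.
Lemma O_acc1 k : O 1 (fun w => acc (sarc w) k (st w) - acc (sarc w) k (st0 w)).
Proof. Olip acc_lip. Qed.
Lemma O_met1 j k : O 1 (fun w => met (sarc w) (st w) j k - met (sarc w) (st0 w) j k).
Proof. Olip met_lip. Qed.

Lemma O_tau : O 1 (fun w => st w - st0 w).
Proof. exists 1; intros w _; unfold lag; simpl; lra. Qed.


Lemma dif_der w k t : sg_ok w -> slo w <= t <= shi w ->
  is_derive (dif (sarc w) (sgeo w) k) t (spd (sarc w) t * udif (sarc w) (sgeo w) k t).
Proof.
intros Pw Ht; unfold udif; rewrite Rmult_minus_distr_l.
apply (is_derive_minus (gpos (sgeo w) k) (cpos (sarc w) k)).
- eapply gpos_der; [apply Pw | auto].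
- eapply pos_der; [apply Pw | auto].
Qed.

Definition udif' (w : sg) (k : bool) (t : R) : R :=
  spd (sarc w) t * (quad (chr (sarc w) k t) (vec (utan (sarc w)) t) (vec (utan (sarc w)) t)
   - quad (gchr (sgeo w) k t) (vec (gtan (sgeo w)) t) (vec (gtan (sgeo w)) t)
   - acc (sarc w) k t).

Lemma udif_der w k t : sg_ok w -> slo w <= t <= shi w ->
  is_derive (udif (sarc w) (sgeo w) k) t (udif' w k t).
Proof.
intros Pw Ht; unfold udif'.
match goal with |- is_derive _ _ (?s * (?a - ?b - ?c)) =>
  replace (s * (a - b - c)) with (s * - b - s * (c - a)) by ring end.
apply (is_derive_minus (gtan (sgeo w) k) (utan (sarc w) k)).
- eapply gtan_der; [apply Pw | auto].
- eapply tan_der; [apply Pw | auto].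
Qed.

Lemma O_U1 k : O 1 (U k).
Proof.
apply (bigO_int 0 (fun w => udif (sarc w) (sgeo w) k) (fun w => udif' w k)).
- intros w t; apply udif_der.
- intros w Pw; unfold udif; rewrite (gtan_init _ _ _ _ _ _ (sg_geo w Pw)); ring.
- reflexivity.
- reflexivity.
- apply (bigO_mult 0 0 _ _ O_spd).
  apply bigO_minus; [apply bigO_minus | apply O_acc].
  + apply (bigO_quad lag01 0 0 0); [intros | intros | intros | auto]; [apply O_chr | apply O_tan | apply O_tan].
  + apply (bigO_quad lag01 0 0 0); [intros | intros | intros | auto]; [apply O_gchr | apply O_gtan | apply O_gtan].
Qed.

Lemma O_D2 k : O 2 (D k).
Proof.
apply (bigO_int 1 (fun w => dif (sarc w) (sgeo w) k)
  (fun w t => spd (sarc w) t * udif (sarc w) (sgeo w) k t)).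
- intros w t; apply dif_der.
- intros w Pw; unfold dif; rewrite (gpos_init _ _ _ _ _ _ (sg_geo w Pw)); ring.
- reflexivity.
- reflexivity.
- apply (bigO_mult 0 1 _ _ O_spd (O_U1 k)).
Qed.

Lemma O_norm1D : O 2 (fun w => norm1 (fun k => D k w)).
Proof.
destruct (O_D2 false) as [K1 H1]; destruct (O_D2 true) as [K2 H2].
exists (K1 + K2); intros w Pw.
specialize (H1 w Pw); specialize (H2 w Pw); unfold norm1.
rewrite Rabs_pos_eq; [lra |].
generalize (Rabs_pos (D false w)) (Rabs_pos (D true w)); lra.
Qed.

Lemma O_gchr2 l j k : O 2 (fun w => gchr (sgeo w) l (st w) j k - chr (sarc w) l (st w) j k).
Proof.
destruct (bigO_mult 0 2 _ _ (bigO_const K) O_norm1D) as [C H].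
exists C; intros w Pw; refine (Rle_trans _ _ _ _ (H w Pw)).
refine (Rle_trans _ _ _ _ (RRle_abs _)).
eapply gchr_lip; [apply Pw | apply Pw].
Qed.

Definition rmet (w : sg) (j k : bool) : R :=
  gmet (sgeo w) (st w) j k - met (sarc w) (st w) j k
  - pair (fun l => dmet (sarc w) l (st w) j k) (fun l => D l w).

(** The Taylor remainder is quadratic in [D], and [D] is itself of order 2. *)
Lemma O_rmet j k : O 4 (fun w => rmet w j k).
Proof.
destruct (bigO_mult 0 4 _ _ (bigO_const K) (bigO_mult 2 2 _ _ O_norm1D O_norm1D)) as [C H].
exists C; intros w Pw; refine (Rle_trans _ _ _ _ (H w Pw)).
refine (Rle_trans _ _ _ _ (RRle_abs _)).
refine (Rle_trans _ _ _ (gmet_taylor _ _ _ _ _ _ (sg_geo w Pw) j k _ (sg_t w Pw)) _).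
apply Req_le; simpl; unfold vec, D; ring.
Qed.

Definition sg0 (w : sg) := spd (sarc w) (st0 w).
Definition W0 k (w : sg) := acc (sarc w) k (st0 w).
Definition tau (w : sg) := st w - st0 w.

Definition U2 k w := U k w + sg0 w * W0 k w * tau w.

Lemma O_U2 k : O 2 (U2 k).
Proof.
apply (bigO_int 1 (fun w t => udif (sarc w) (sgeo w) k t + sg0 w * W0 k w * (t - st0 w))
  (fun w t => udif' w k t + sg0 w * W0 k w)).
- intros w t Pw Ht.
  apply (is_derive_plus (udif (sarc w) (sgeo w) k) (fun t => sg0 w * W0 k w * (t - st0 w))); [now apply udif_der |].
  auto_derive; auto; ring.
- intros w Pw; unfold udif; rewrite (gtan_init _ _ _ _ _ _ (sg_geo w Pw)); ring.
- reflexivity.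
- reflexivity.
(* Each summand contains a difference of order at least 1: of speeds, of accelerations, of
   Christoffel symbols or of unit tangents. *)
- apply (bigO_ext _ (fun w =>
     - ((spd (sarc w) (st w) - spd (sarc w) (st0 w)) * W0 k w)
     - spd (sarc w) (st w) * (acc (sarc w) k (st w) - acc (sarc w) k (st0 w))
     - spd (sarc w) (st w) *
       (quad (fun i j => gchr (sgeo w) k (st w) i j - chr (sarc w) k (st w) i j)
           (vec (gtan (sgeo w)) (st w)) (vec (gtan (sgeo w)) (st w))
        + quad (chr (sarc w) k (st w)) (fun j => U j w) (vec (gtan (sgeo w)) (st w))
        + quad (chr (sarc w) k (st w)) (vec (utan (sarc w)) (st w)) (fun j => U j w)))).
    intros w _; unfold quad, sum2, vec, U, udif, udif', sg0, W0, quad, sum2, vec; ring.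
  apply bigO_minus; [apply bigO_minus |].
  + apply bigO_opp. apply (bigO_mult 1 0); [apply O_spd1 | apply O_acc0].
  + apply (bigO_mult 0 1 _ _ O_spd (O_acc1 k)).
  + apply (bigO_mult 0 1 _ _ O_spd); apply bigO_plus; [apply bigO_plus |].
    * apply (bigO_quad lag01 2 0 0); [intros | intros | intros | lia];
        [apply O_gchr2 | apply O_gtan | apply O_gtan].
    * apply (bigO_quad lag01 0 1 0); [intros | intros | intros | auto]; [apply O_chr | apply O_U1 | apply O_gtan].
    * apply (bigO_quad lag01 0 0 1); [intros | intros | intros | auto]; [apply O_chr | apply O_tan | apply O_U1].
Qed.

Definition D3 k w := D k w + / 2 * (sg0 w * sg0 w * W0 k w * tau w ^ 2).

Lemma O_D3 k : O 3 (D3 k).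
Proof.
apply (bigO_int 2 (fun w t => dif (sarc w) (sgeo w) k t
     + / 2 * (sg0 w * sg0 w * W0 k w * (t - st0 w) ^ 2))
  (fun w t => spd (sarc w) t * udif (sarc w) (sgeo w) k t
     + sg0 w * sg0 w * W0 k w * (t - st0 w))).
- intros w t Pw Ht.
  apply (is_derive_plus (dif (sarc w) (sgeo w) k) (fun t => / 2 * (sg0 w * sg0 w * W0 k w * (t - st0 w) ^ 2))); [now apply dif_der |].
  auto_derive; auto; field.
- intros w Pw; unfold dif; rewrite (gpos_init _ _ _ _ _ _ (sg_geo w Pw)); ring.
- reflexivity.
- reflexivity.
(* Substituting [U = U2 - sg0 * W0 * tau] leaves [U2] and the variation of the speed. *)
- apply (bigO_ext _ (fun w => spd (sarc w) (st w) * U2 k w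
     - (spd (sarc w) (st w) - spd (sarc w) (st0 w)) * (sg0 w * (W0 k w * tau w)))).
    intros w _; unfold U2, U, sg0, tau; ring.
  apply bigO_minus.
  + apply (bigO_mult 0 2 _ _ O_spd (O_U2 k)).
  + refine (bigO_mult 1 1 _ _ O_spd1 _).
    refine (bigO_mult 0 1 _ _ O_spd0 _).
    refine (bigO_mult 0 1 _ _ (O_acc0 k) O_tau).
Qed.

Definition F4 (w : sg) (t : R) : R :=
  pair (vec (cotan (sarc w)) t) (vec (dif (sarc w) (sgeo w)) t)
  + / 3 * (curv2 (sarc w) (st0 w) * sg0 w ^ 3 * (t - st0 w) ^ 3).

Definition F4' (w : sg) (t : R) : R :=
  sum2 (fun k =>
    (spd (sarc w) t * (sum2 (fun l => met (sarc w) t k l * acc (sarc w) l t)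
       + / 2 * quad (dmet (sarc w) k t) (vec (utan (sarc w)) t) (vec (utan (sarc w)) t)))
      * dif (sarc w) (sgeo w) k t
    + cotan (sarc w) k t * (spd (sarc w) t * udif (sarc w) (sgeo w) k t))
  + curv2 (sarc w) (st0 w) * sg0 w ^ 3 * (t - st0 w) ^ 2.

Lemma F4_der w t : sg_ok w -> slo w <= t <= shi w -> is_derive (F4 w) t (F4' w t).
Proof.
intros Pw Ht; apply (is_derive_plus (fun t => pair _ _)); [| auto_derive; auto; field].
apply (is_derive_sum2 (fun k t => _ * _)); intros k; apply is_derive_mul; [| now apply dif_der].
eapply cotan_der; [apply Pw | auto].
Qed.

(* Subtract the two unit-length identities and expand the metric at the curve. *)
Lemma cotan_udif w : sg_ok w ->
  pair (vec (cotan (sarc w)) (st w)) (fun k => U k w) =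
  - / 2 * (quad (met (sarc w) (st w)) (fun k => U k w) (fun k => U k w)
   + quad (fun i j => pair (fun l => dmet (sarc w) l (st w) i j) (fun l => D l w))
       (vec (gtan (sgeo w)) (st w)) (vec (gtan (sgeo w)) (st w))
   + quad (rmet w) (vec (gtan (sgeo w)) (st w)) (vec (gtan (sgeo w)) (st w))).
Proof.
intros Pw.
generalize (gtan_unit _ _ _ _ _ _ (sg_geo w Pw) _ (sg_t w Pw))
  (tan_unit _ _ _ _ (sg_arc w Pw) _ (sg_t w Pw))
  (met_sym _ _ _ _ (sg_arc w Pw) true false _ (sg_t w Pw)).
unfold pair, rmet, cotan, quad, sum2, vec, pair, sum2, U, udif.
intros E1 E2 E3; rewrite E3 in E2 |- *; lra.
Qed.

(** The derivative of [p.D] has leading term [- sigma^3 kappa^2 tau^2]: one half comes from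
    [g(W, D)], the other from [- g(U, U) / 2]. Integrating [tau^2] produces the factor 1/3 in
    [F4]. *)
Lemma O_F4 : O 4 (fun w => F4 w (st w)).
Proof.
apply (bigO_int 3 F4 F4').
- intros w t; apply F4_der.
- intros w Pw; unfold F4, pair, sum2, vec, dif.
  rewrite !(gpos_init _ _ _ _ _ _ (sg_geo w Pw)); ring.
- reflexivity.
- reflexivity.
- set (dD := fun w i j => pair (fun l => dmet (sarc w) l (st w) i j) (fun l => D l w)).
  set (W := fun w => vec (acc (sarc w)) (st w)).
  set (w0 := fun w k => W0 k w).
  set (m := fun w => met (sarc w) (st w)).
  set (V := fun w => vec (gtan (sgeo w)) (st w)).
  set (T := fun w => vec (utan (sarc w)) (st w)).
  assert (OdD : forall i j, O 2 (fun w => dD w i j)).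
    intros i j; apply (bigO_sum2 2 (fun k x => _ * _)); intros k.
    apply (bigO_mult 0 2 _ _ (O_dmet _ _ _) (O_D2 k)).
  (* [D] and [U] are replaced by their expansions and the coefficients frozen at [st0]; in each
     summand the orders of the factors add up to at least 3. The terms with [dD] are what remains of
     the derivative of the metric along [D] after it met the derivative of [p]: a difference between
     values on [V] and on [T]. *)
  apply (bigO_ext _ (fun w => spd (sarc w) (st w) *
     (quad (m w) (fun k => D3 k w) (W w)
      - / 2 * quad (m w) (fun k => U2 k w) (fun k => U k w)
      + / 2 * (sg0 w * tau w * quad (m w) (w0 w) (fun k => U2 k w))
      - / 2 * (sg0 w * tau w * (sg0 w * tau w *
         (quad (m w) (w0 w) (fun k => W w k - w0 w k) +
          2 * quad (fun i j => m w i j - met (sarc w) (st0 w) i j) (w0 w) (w0 w))))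
      - / 2 * (quad (dD w) (fun k => U k w) (V w) + quad (dD w) (T w) (fun k => U k w))
      - / 2 * quad (rmet w) (V w) (V w))
     - (spd (sarc w) (st w) - spd (sarc w) (st0 w)) *
        (sg0 w * tau w * (sg0 w * tau w * quad (met (sarc w) (st0 w)) (w0 w) (w0 w))))).
  { intros w Pw.
    generalize (cotan_udif w Pw).
    unfold F4', curv2; fold (sg0 w).
    (* The identity [cotan_udif] enters with weight [spd]; what is left is an identity of
       polynomials. *)
    assert (E : forall A B C : R, A = C - spd (sarc w) (st w) * B -> B = 0 -> A = C).
      intros A B C -> ->; ring.
    intros E0; apply Rminus_diag_eq in E0; revert E0; apply E.
    generalize (met_sym _ _ _ _ (sg_arc w Pw) true false _ (sg_t w Pw)).
    unfold rmet, dD, m, W, w0, V, T, D3, U2, pair, quad, sum2, vec, U, udif, D, tau, sg0, W0, pair, sum2.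
    intros ->; field. }
  apply bigO_minus; [refine (bigO_mult 0 3 _ _ O_spd _) |].
  + assert (half : forall n f, O n f -> O n (fun w => / 2 * f w)).
      intros n f Of; apply (bigO_mult 0 n _ _ (bigO_const (/ 2)) Of).
    assert (st1 : forall n f, O n f -> O (S n) (fun w => sg0 w * tau w * f w)).
      intros n f Of; apply (bigO_mult 1 n (fun w => _ * _)); auto.
      apply (bigO_mult 0 1 _ _ O_spd0 O_tau).
    repeat match goal with |- bigO _ _ 3 (fun w => _ - _) => apply bigO_minus
       | |- bigO _ _ 3 (fun w => _ + _) => apply bigO_plus
       | |- bigO _ _ 3 (fun w => / 2 * _) => apply half end.
    * apply (bigO_quad lag01 0 3 0); [intros | intros | intros | auto]; [apply O_met | apply O_D3 | apply O_acc].
    * apply (bigO_quad lag01 0 2 1); [intros | intros | intros | auto]; [apply O_met | apply O_U2 | apply O_U1].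
    * apply (st1 2%nat).
      apply (bigO_quad lag01 0 0 2); [intros | intros | intros | auto]; [apply O_met | apply O_acc0 | apply O_U2].
    * apply (st1 2%nat (fun w => _ * _)), (st1 1%nat), bigO_plus.
      -- apply (bigO_quad lag01 0 0 1); [intros | intros | intros | auto]; [apply O_met | apply O_acc0 | apply O_acc1].
      -- apply (bigO_mult 0 1 _ _ (bigO_const 2)).
         apply (bigO_quad lag01 1 0 0); [intros | intros | intros | lia];
           [apply O_met1 | apply O_acc0 | apply O_acc0].
    * apply (bigO_quad lag01 2 1 0); [intros | intros | intros | lia];
        [apply OdD | apply O_U1 | apply O_gtan].
    * apply (bigO_quad lag01 2 0 1); [intros | intros | intros | lia];
        [apply OdD | apply O_tan | apply O_U1].
    * apply (bigO_quad lag01 4 0 0); [intros | intros | intros | lia];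
        [apply O_rmet | apply O_gtan | apply O_gtan].
  + refine (bigO_mult 1 2 _ _ O_spd1 _).
    refine (bigO_mult 1 1 _ _ _ _); [apply (bigO_mult 0 1 _ _ O_spd0 O_tau) |].
    refine (bigO_mult 1 0 _ _ _ _); [apply (bigO_mult 0 1 _ _ O_spd0 O_tau) |].
    apply (bigO_quad lag01 0 0 0); [intros | intros | intros | auto]; [apply O_met0 | apply O_acc0 | apply O_acc0].
Qed.

End SingleGeodesic.

(** * Two tangent geodesics *)

Record duo := { darc : arc_data; dA : geo_data; dB : geo_data; da : R; db : R; len : R -> R }.

Definition gap (w : duo) : R := db w - da w.
(** The interval exceeds the arc by one [gap] on each side, which leaves room for the intermediate
    value argument that looks for the parameter on the first geodesic. Its length is three gaps,
    whence the bound [/ 3] in [duo_gap] and the length at most 1 in [sg_len]. *)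
Definition dlo (w : duo) : R := da w - gap w.
Definition dhi (w : duo) : R := db w + gap w.

Section TwoGeodesics.

Variable K : R.
Hypothesis K0 : 0 < K.

Record duo_ok (w : duo) : Prop := {
  duo_gap : 0 < gap w <= / 3;
  duo_arc : arc_ok K (dlo w) (dhi w) (darc w);
  duo_A : geo_ok K (dlo w) (dhi w) (da w) (darc w) (dA w);
  duo_B : geo_ok K (dlo w) (dhi w) (db w) (darc w) (dB w);
  duo_curv : / K <= curv2 (darc w) (da w);
  duo_len : forall t, dlo w <= t <= dhi w -> is_derive (len w) t (spd (darc w) t)
}.

Definition inI (w : duo) (t : R) : Prop := dlo w <= t <= dhi w.

(* A parameter on each of the two geodesics. *)
Definition tm : Type := duo * (R * R).
Definition tmA (x : tm) : R := fst (snd x).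
Definition tmB (x : tm) : R := snd (snd x).
Definition tgap (x : tm) : R := gap (fst x).
Definition tm_ok (x : tm) : Prop := duo_ok (fst x) /\ inI (fst x) (tmA x) /\ inI (fst x) (tmB x).

Lemma tgap01 x : tm_ok x -> 0 <= tgap x <= 1.
Proof. intros [[]]; unfold tgap; lra. Qed.

Definition sgA (x : tm) : sg := {| sarc := darc (fst x); sgeo := dA (fst x);
  st0 := da (fst x); slo := dlo (fst x); shi := dhi (fst x); st := tmA x |}.
Definition sgB (x : tm) : sg := {| sarc := darc (fst x); sgeo := dB (fst x);
  st0 := db (fst x); slo := dlo (fst x); shi := dhi (fst x); st := tmB x |}.

Notation "'O' n f" := (bigO tm_ok tgap n f) (at level 10, n at level 9, f at level 9).

Lemma inI_da w : duo_ok w -> inI w (da w).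
Proof. intros []; unfold inI, dlo, dhi, gap in *; lra. Qed.
Lemma inI_db w : duo_ok w -> inI w (db w).
Proof. intros []; unfold inI, dlo, dhi, gap in *; lra. Qed.

Lemma O_sgA n f : bigO (sg_ok K) lag n f -> O n (fun x => f (sgA x)).
Proof.
(* On the extended interval a parameter is at most two gaps away from either tangency point. *)
apply (bigO_comp _ _ _ _ sgA 2); intros x [Pw [Hm Hm']].
generalize (inI_da _ Pw); unfold inI in *; intros Ha.
destruct Pw; unfold lag, tgap; simpl; split.
  split; simpl; auto; unfold dlo, dhi, gap in *; lra.
split; [apply Rabs_pos |].
unfold dlo, dhi, gap in *; apply Rabs_le; lra.
Qed.

Lemma O_sgB n f : bigO (sg_ok K) lag n f -> O n (fun x => f (sgB x)).
Proof.
apply (bigO_comp _ _ _ _ sgB 2); intros x [Pw [Hm Hm']].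
generalize (inI_db _ Pw); unfold inI in *; intros Ha.
destruct Pw; unfold lag, tgap; simpl; split.
  split; simpl; auto; unfold dlo, dhi, gap in *; lra.
split; [apply Rabs_pos |].
unfold dlo, dhi, gap in *; apply Rabs_le; lra.
Qed.

Definition at_a (x : tm) : tm := (fst x, (da (fst x), da (fst x))).
Definition at_b (x : tm) : tm := (fst x, (db (fst x), db (fst x))).
Definition swp (x : tm) : tm := (fst x, (tmB x, tmA x)).

(** An estimate obtained for the parameter [tmA] is read at [da], at [db] or at [tmB] by moving
    within the same [duo]. *)
Lemma O_reloc (h : tm -> tm) n f :
  (forall x, tm_ok x -> tm_ok (h x) /\ fst (h x) = fst x) ->
  O n f -> O n (fun x => f (h x)).
Proof.
intros H; apply (bigO_comp _ _ _ _ h 1); intros x Px.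
destruct (H x Px) as [H1 H2]; split; auto.
generalize (tgap01 _ Px); unfold tgap; rewrite H2; lra.
Qed.

Lemma at_a_ok x : tm_ok x -> tm_ok (at_a x) /\ fst (at_a x) = fst x.
Proof.
intros [H1 H2]; split; auto; split; auto; split; now apply inI_da.
Qed.
Lemma at_b_ok x : tm_ok x -> tm_ok (at_b x) /\ fst (at_b x) = fst x.
Proof.
intros [H1 H2]; split; auto; split; auto; split; now apply inI_db.
Qed.
Lemma swp_ok x : tm_ok x -> tm_ok (swp x) /\ fst (swp x) = fst x.
Proof. intros [H1 [H2 H3]]; split; auto; split; auto; split; auto. Qed.

(** An estimate at [tmA] is one on the whole interval, because any parameter there can play the role
    of [tmA]. *)
Lemma Lip_of_O (h h' : bool -> duo -> R -> R) :
  (forall k w t, duo_ok w -> inI w t -> is_derive (h k w) t (h' k w t)) ->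
  (forall k, O 0 (fun x => h' k (fst x) (tmA x))) ->
  exists C, 0 < C /\ forall w k t t', duo_ok w -> inI w t -> inI w t' ->
    Rabs (h k w t' - h k w t) <= C * Rabs (t' - t).
Proof.
intros Hd HO.
destruct (bigO_bound tgap01 _ _ (HO false)) as [C1 [C10 H1]].
destruct (bigO_bound tgap01 _ _ (HO true)) as [C2 [C20 H2]].
exists (C1 + C2); split; [lra |].
intros w k t t' Pw Ht Ht'.
apply (MVT_Lipschitz (h k w) (h' k w) (dlo w) (dhi w)); auto; intros u Hu.
assert (X : tm_ok (w, (u, u))) by (split; auto).
specialize (H1 _ X); specialize (H2 _ X); simpl in H1, H2; rewrite Rmult_1_r in H1, H2.
change (tmA (w, (u, u))) with u in *; destruct k; lra.
Qed.

Lemma Lip_tan : exists C, 0 < C /\ forall w k t t', duo_ok w -> inI w t -> inI w t' ->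
  Rabs (utan (darc w) k t' - utan (darc w) k t) <= C * Rabs (t' - t).
Proof.
apply (Lip_of_O (fun k w => utan (darc w) k) _
  (fun k w t Pw Ht => tan_der _ _ _ _ (duo_arc w Pw) k t Ht)); intros k.
refine (bigO_mult 0 0 _ _ (O_sgA _ _ (O_spd K)) _).
apply bigO_minus; [apply (O_sgA _ _ (O_acc K k)) |].
apply (bigO_quad tgap01 0 0 0); [intros i j | intros j | intros j | lia];
[apply (O_sgA _ _ (O_chr K k i j)) | apply (O_sgA _ _ (O_tan K j)) .. ].
Qed.

Lemma Lip_cotan : exists C, 0 < C /\ forall w k t t', duo_ok w -> inI w t -> inI w t' ->
  Rabs (cotan (darc w) k t' - cotan (darc w) k t) <= C * Rabs (t' - t).
Proof.
apply (Lip_of_O (fun k w => cotan (darc w) k) _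
  (fun k w t Pw Ht => cotan_der _ _ _ _ (duo_arc w Pw) k t Ht)); intros k.
refine (bigO_mult 0 0 _ _ (O_sgA _ _ (O_spd K)) _).
apply bigO_plus.
- apply (bigO_sum2 0 (fun l x => _ * _)); intros l.
  apply (bigO_mult 0 0 _ _ (O_sgA _ _ (O_met K k l)) (O_sgA _ _ (O_acc K l))).
- refine (bigO_mult 0 0 _ _ (bigO_const _) _).
  apply (bigO_quad tgap01 0 0 0); [intros i j | intros j | intros j | lia];
  [apply (O_sgA _ _ (O_dmet K k i j)) | apply (O_sgA _ _ (O_tan K j)) .. ].
Qed.

Lemma O_tgap : O 1 tgap.
Proof. exists 1; intros x Px; rewrite Rabs_pos_eq; [lra | apply (tgap01 x Px)]. Qed.

Lemma O_tmA : O 1 (fun x => tmA x - da (fst x)).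
Proof.
exists 2; intros x [Pw [Hm _]]; unfold inI, dlo, dhi, gap, tgap, tmA in *; unfold gap in *.
apply Rabs_le; lra.
Qed.

Lemma O_tmB : O 1 (fun x => tmB x - db (fst x)).
Proof.
exists 2; intros x [Pw [_ Hm]]; unfold inI, dlo, dhi, gap, tgap, tmB in *; unfold gap in *.
apply Rabs_le; lra.
Qed.

Lemma O_tan1 k : O 1 (fun x => utan (darc (fst x)) k (tmA x) - utan (darc (fst x)) k (da (fst x))).
Proof.
destruct Lip_tan as [C [C0 HC]]; destruct O_tmA as [L HL].
exists (C * L); intros x Px; generalize (HL x Px); destruct Px as [Pw [Hm _]]; intros B.
apply Rle_trans with (1 := HC _ k _ _ Pw (inI_da _ Pw) Hm).
rewrite Rmult_assoc; apply Rmult_le_compat_l; lra.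
Qed.

(** [pa] and [nu] are the covectors [g(T, .)] and [g(W, .)] frozen at the first tangency point: [pa]
    is 1 on [T] and 0 on [W], [nu] is 0 on [T] and [kappa^2] on [W]. As curvature does not vanish,
    they are coordinates on the plane. *)
Definition pa (x : tm) : bool -> R := vec (cotan (darc (fst x))) (da (fst x)).
Definition nu (x : tm) (k : bool) : R :=
  sum2 (fun l => met (darc (fst x)) (da (fst x)) k l * acc (darc (fst x)) l (da (fst x))).

Lemma O_pair n m q p v :
  (forall k, O n (fun x => p x k)) -> (forall k, O m (fun x => v x k)) -> (q <= n + m)%nat ->
  O q (fun x => pair (p x) (v x)).
Proof.
intros Hp Hv le; apply (bigO_weaken tgap01 (n + m)); auto.
apply (bigO_sum2 (n + m) (fun k x => p x k * v x k)); intros k; now apply bigO_mult.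
Qed.

Lemma O_cotanA k : O 0 (fun x => cotan (darc (fst x)) k (tmA x)).
Proof.
apply (bigO_sum2 0 (fun l x => _ * _)); intros l.
apply (bigO_mult 0 0 _ _ (O_sgA _ _ (O_met K k l)) (O_sgA _ _ (O_tan K l))).
Qed.

Lemma O_pa k : O 0 (fun x => pa x k).
Proof. apply (O_reloc at_a 0 _ at_a_ok (O_cotanA k)). Qed.

Lemma O_nu k : O 0 (fun x => nu x k).
Proof.
apply (bigO_sum2 0 (fun l x => _ * _)); intros l.
apply (bigO_mult 0 0 _ _ (O_sgA _ _ (O_met0 K k l)) (O_sgA _ _ (O_acc0 K l))).
Qed.

Definition level (p : bool -> R) (y : bool -> R -> R) (t : R) : R := pair p (vec y t).

Lemma level_der p y y' t : (forall k, is_derive (y k) t (y' k)) ->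
  is_derive (level p y) t (pair p y').
Proof.
intros H; apply (is_derive_sum2 (fun k t => p k * y k t)); intros k.
apply is_derive_scal, H.
Qed.

(** Meeting is one equation in the plane; [sync] is its [pa] component, and [theta x = 0] below is
    its [nu] component. *)
Definition sync (x : tm) : Prop :=
  level (pa x) (gpos (dA (fst x))) (tmA x) = level (pa x) (gpos (dB (fst x))) (tmB x).
Definition tms_ok (x : tm) : Prop := tm_ok x /\ sync x.

Definition ndif (x : tm) : R := tmA x - tmB x.

Lemma pair_flat (g : bool -> bool -> R) v w :
  pair (fun k => sum2 (fun l => g k l * v l)) w = quad g w v.
Proof. unfold pair, quad, sum2; ring. Qed.

Lemma cotan_tan w t : duo_ok w -> inI w t ->
  pair (vec (cotan (darc w)) t) (vec (utan (darc w)) t) = 1.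
Proof.
intros Pw It; refine (eq_trans (pair_flat _ _ _) _).
now apply (tan_unit _ _ _ _ (duo_arc _ Pw)).
Qed.

Lemma pa_tan x : tm_ok x -> pair (pa x) (vec (utan (darc (fst x))) (da (fst x))) = 1.
Proof. intros [Pw _]; apply cotan_tan; auto; now apply inI_da. Qed.

Lemma nu_tan x : tm_ok x -> pair (nu x) (vec (utan (darc (fst x))) (da (fst x))) = 0.
Proof.
intros [Pw _]; refine (eq_trans (pair_flat _ _ _) _).
apply (tan_acc _ _ _ _ (duo_arc _ Pw)); now apply inI_da.
Qed.

Lemma pa_acc x : tm_ok x -> pair (pa x) (vec (acc (darc (fst x))) (da (fst x))) = 0.
Proof.
intros [Pw _]; refine (eq_trans (pair_flat _ _ _) _).
rewrite <- (tan_acc _ _ _ _ (duo_arc _ Pw) _ (inI_da _ Pw)).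
unfold quad, sum2, vec; rewrite (met_sym _ _ _ _ (duo_arc _ Pw) true false _ (inI_da _ Pw)); ring.
Qed.

Lemma nu_acc x : pair (nu x) (vec (acc (darc (fst x))) (da (fst x)))
  = curv2 (darc (fst x)) (da (fst x)).
Proof. unfold curv2, pair, nu, quad, sum2, vec; ring. Qed.

Lemma O_MVT n (h h' : duo -> R -> R) :
  (forall w t, duo_ok w -> inI w t -> is_derive (h w) t (h' w t)) ->
  O n (fun x => h' (fst x) (tmA x)) ->
  exists C, 0 < C /\ forall x, tm_ok x ->
    Rabs (h (fst x) (tmA x) - h (fst x) (tmB x)) <= C * tgap x ^ n * Rabs (ndif x).
Proof.
intros Hd HO; destruct (bigO_bound tgap01 _ _ HO) as [C [C0 HC]].
exists C; split; auto; intros [w [m m']] [Pw [Hm Hm']]; unfold ndif, tmA, tmB in *; simpl in *.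
apply (MVT_Lipschitz (h w) (h' w) (dlo w) (dhi w)); auto.
intros t Ht; apply (HC (w, (t, t))); split; auto.
Qed.

(** [pa] only reads the [duo]; the two zeros are dummy parameters. *)
Definition wpa (w : duo) : bool -> R := pa (w, (0, 0)).

(** In the direction [pa] the curve advances at the rate [spd] at [da] up to order 1, while the
    geodesics are only of order 2 away from it. Equal levels therefore force parameters equal up to
    order 2. *)
Lemma O_ndif : bigO tms_ok tgap 2 ndif.
Proof.
destruct (O_MVT 1 (fun w t => level (wpa w) (cpos (darc w)) t - spd (darc w) (da w) * t)
  (fun w t => pair (wpa w) (fun k => spd (darc w) t * utan (darc w) k t) - spd (darc w) (da w)))
  as [C [C0 HC]].
- intros w t Pw Ht; apply (is_derive_minus (level (wpa w) (cpos (darc w))) (fun t => _ * t)).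
  + apply level_der; intros k; eapply pos_der; [apply (duo_arc w Pw) | auto].
  + auto_derive; auto; ring.
- apply (bigO_ext _ (fun x =>
    spd (darc (fst x)) (tmA x) * pair (pa x)
       (fun k => utan (darc (fst x)) k (tmA x) - utan (darc (fst x)) k (da (fst x)))
    + (spd (darc (fst x)) (tmA x) - spd (darc (fst x)) (da (fst x))))).
    intros x Px; generalize (pa_tan x Px); unfold wpa, pair, sum2, vec, pa, vec; simpl; intros E.
    apply Rminus_diag_uniq.
    match type of E with ?l = 1 =>
      transitivity (spd (darc (fst x)) (tmA x) * (1 - l)); [ring | rewrite E; ring] end.
  apply bigO_plus.
  + refine (bigO_mult 0 1 _ _ (O_sgA _ _ (O_spd K)) _).
    apply (O_pair 0 1); [apply O_pa | apply O_tan1 | auto].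
  + apply (O_sgA _ _ (O_spd1 K)).
- assert (OD : O 2 (fun x => pair (pa x) (fun k => D k (sgA x) - D k (sgB x)))).
    apply (O_pair 0 2); [apply O_pa | intros k; apply bigO_minus | auto];
    [apply (O_sgA _ _ (O_D2 K k)) | apply (O_sgB _ _ (O_D2 K k))].
  destruct (bigO_bound tgap01 _ _ OD) as [E [E0 HE]].
  (* The crude bound [Rabs (ndif x) <= 3 * tgap x] turns the term [C * tgap x * Rabs (ndif x)] into
     one of order 2. The sum is [K * E + 3 * K * C], taken with a spare factor 2. *)
  exists (2 * K * E + 6 * K * C); intros x [Px Sx].
  generalize (HC x Px) (HE x Px); intros H1 H2.
  generalize (tgap01 x Px); intros G.
  assert (Sa : / K <= spd (darc (fst x)) (da (fst x))).
    destruct Px as [Pw _]; eapply spd_pos; [apply (duo_arc _ Pw) | now apply inI_da].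
  assert (B : Rabs (ndif x) <= 3 * tgap x).
    destruct Px as [Pw [I1 I2]]; unfold ndif, inI, dlo, dhi, tgap, gap in *; apply Rabs_le; lra.
  assert (H3 : Rabs (spd (darc (fst x)) (da (fst x)) * ndif x)
     <= C * tgap x * Rabs (ndif x) + E * tgap x ^ 2).
    replace (spd (darc (fst x)) (da (fst x)) * ndif x) with
     (- (level (wpa (fst x)) (cpos (darc (fst x))) (tmA x) - spd (darc (fst x)) (da (fst x)) * tmA x
      - (level (wpa (fst x)) (cpos (darc (fst x))) (tmB x) - spd (darc (fst x)) (da (fst x)) * tmB x))
      - pair (pa x) (fun k : bool => D k (sgA x) - D k (sgB x))).
      eapply Rle_trans; [apply Rabs_triang |]; rewrite !Rabs_Ropp; simpl in *; lra.
    revert Sx; unfold sync, level, ndif, wpa, pa, pair, D, dif, sum2, vec, tmA, tmB; simpl.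
    unfold tmA, tmB; intros Sx; lra.
  assert (H4 : Rabs (ndif x) <= K * Rabs (spd (darc (fst x)) (da (fst x)) * ndif x)).
    rewrite Rabs_mult, <- Rmult_assoc, <- (Rmult_1_l (Rabs (ndif x))) at 1.
    apply Rmult_le_compat_r; [apply Rabs_pos |].
    rewrite Rabs_pos_eq; [| apply Rle_trans with (2 := Sa); left; now apply Rinv_0_lt_compat].
    apply Rle_trans with (K * / K); [right; field; lra | apply Rmult_le_compat_l; lra].
  assert (H5 : Rabs (ndif x) <= K * (C * tgap x * Rabs (ndif x) + E * tgap x ^ 2)).
    apply Rle_trans with (1 := H4), Rmult_le_compat_l; lra.
  assert (H6 : C * tgap x * Rabs (ndif x) <= C * tgap x * (3 * tgap x)).
    apply Rmult_le_compat_l; auto; apply Rmult_le_pos; lra.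
  assert (H7 : K * (C * tgap x * Rabs (ndif x)) <= K * (C * tgap x * (3 * tgap x))).
    apply Rmult_le_compat_l; lra.
  assert (0 <= K * E * tgap x ^ 2).
    apply Rmult_le_pos; [apply Rmult_le_pos; lra | apply pow_le; lra].
  assert (0 <= K * C * tgap x ^ 2).
    apply Rmult_le_pos; [apply Rmult_le_pos; lra | apply pow_le; lra].
  simpl in *; lra.
Qed.


Notation "'Os' n f" := (bigO tms_ok tgap n f) (at level 10, n at level 9, f at level 9).

Lemma O_s n f : O n f -> Os n f.
Proof. intros [C H]; exists C; intros x [Px _]; auto. Qed.

Lemma tgap01s x : tms_ok x -> 0 <= tgap x <= 1.
Proof. intros [Px _]; now apply tgap01. Qed.

Definition sa (x : tm) : R := spd (darc (fst x)) (da (fst x)).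
Definition sb (x : tm) : R := spd (darc (fst x)) (db (fst x)).
Definition ka (x : tm) : R := curv2 (darc (fst x)) (da (fst x)).
Definition kb (x : tm) : R := curv2 (darc (fst x)) (db (fst x)).
Definition Wa (x : tm) : bool -> R := vec (acc (darc (fst x))) (da (fst x)).
Definition Wb (x : tm) : bool -> R := vec (acc (darc (fst x))) (db (fst x)).

Lemma O_sa : O 0 sa. Proof. apply (O_sgA _ _ (O_spd0 K)). Qed.
Lemma O_sb : O 0 sb. Proof. apply (O_sgB _ _ (O_spd0 K)). Qed.
Lemma O_Wa k : O 0 (fun x => Wa x k). Proof. apply (O_sgA _ _ (O_acc0 K k)). Qed.
Lemma O_Wb k : O 0 (fun x => Wb x k). Proof. apply (O_sgB _ _ (O_acc0 K k)). Qed.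

Lemma O_sab : O 1 (fun x => sb x - sa x).
Proof. apply (O_reloc at_b _ _ at_b_ok (O_sgA _ _ (O_spd1 K))). Qed.

Lemma O_Wab k : O 1 (fun x => Wb x k - Wa x k).
Proof. apply (O_reloc at_b _ _ at_b_ok (O_sgA _ _ (O_acc1 K k))). Qed.

Lemma O_metab j k : O 1 (fun x => met (darc (fst x)) (db (fst x)) j k
   - met (darc (fst x)) (da (fst x)) j k).
Proof. apply (O_reloc at_b _ _ at_b_ok (O_sgA _ _ (O_met1 K j k))). Qed.

Lemma O_ka : O 0 ka.
Proof.
apply (bigO_quad tgap01 0 0 0); [intros i j | intros j; apply O_Wa .. | lia].
apply (O_sgA _ _ (O_met0 K i j)).
Qed.

Lemma O_kab : O 1 (fun x => kb x - ka x).
Proof.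
apply (bigO_ext _ (fun x =>
   quad (fun i j => met (darc (fst x)) (db (fst x)) i j - met (darc (fst x)) (da (fst x)) i j)
      (Wb x) (Wb x)
   + quad (met (darc (fst x)) (da (fst x))) (fun k => Wb x k - Wa x k) (Wb x)
   + quad (met (darc (fst x)) (da (fst x))) (Wa x) (fun k => Wb x k - Wa x k))).
  intros x _; unfold ka, kb, curv2, Wa, Wb, quad, sum2; ring.
apply bigO_plus; [apply bigO_plus |].
- apply (bigO_quad tgap01 1 0 0);
  [intros i j; apply O_metab | intros j; apply O_Wb .. | lia].
- apply (bigO_quad tgap01 0 1 0);
  [intros i j; apply (O_sgA _ _ (O_met0 K i j)) | intros j; apply O_Wab | intros j; apply O_Wb | lia].
- apply (bigO_quad tgap01 0 0 1);
  [intros i j; apply (O_sgA _ _ (O_met0 K i j)) | intros j; apply O_Wa | intros j; apply O_Wab | lia].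
Qed.

Definition theta (x : tm) : R :=
  pair (nu x) (fun k => gpos (dA (fst x)) k (tmA x) - gpos (dB (fst x)) k (tmB x)).
Definition mid (x : tm) : R := 2 * tmB x - da (fst x) - db (fst x).

(** [nu] vanishes on [T] at [da], so along the curve its level changes at a rate of order 1, over a
    parameter interval of order 2. *)
Lemma O_nupos : Os 3 (fun x =>
  pair (nu x) (fun k => cpos (darc (fst x)) k (tmA x) - cpos (darc (fst x)) k (tmB x))).
Proof.
destruct (O_MVT 1 (fun w t => level (nu (w, (0, 0))) (cpos (darc w)) t)
  (fun w t => pair (nu (w, (0, 0))) (fun k => spd (darc w) t * utan (darc w) k t)))
  as [C [C0 HC]].
- intros w t Pw Ht.
  apply level_der; intros k; eapply pos_der; [apply (duo_arc w Pw) | auto].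
- apply (bigO_ext _ (fun x =>
    spd (darc (fst x)) (tmA x) * pair (nu x)
       (fun k => utan (darc (fst x)) k (tmA x) - utan (darc (fst x)) k (da (fst x))))).
    intros x Px; generalize (nu_tan x Px); unfold pair, sum2, vec, nu; simpl; intros E.
    apply Rminus_diag_uniq.
    match type of E with ?l = 0 =>
      transitivity (- spd (darc (fst x)) (tmA x) * l); [ring | rewrite E; ring] end.
  refine (bigO_mult 0 1 _ _ (O_sgA _ _ (O_spd K)) _).
  apply (O_pair 0 1); [apply O_nu | apply O_tan1 | auto].
- destruct O_ndif as [E HE].
  exists (C * E); intros x Px; generalize (HE x Px) (tgap01s x Px); intros H G.
  destruct Px as [Px Sx].
  replace (pair (nu x) _) with
    (level (nu x) (cpos (darc (fst x))) (tmA x) - level (nu x) (cpos (darc (fst x))) (tmB x))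
    by (unfold level, pair, sum2, vec; ring).
  apply Rle_trans with (1 := HC x Px).
  apply Rle_trans with (C * tgap x ^ 1 * (E * tgap x ^ 2)); [| right; simpl; ring].
  apply Rmult_le_compat_l; auto; apply Rmult_le_pos; [lra | apply pow_le; lra].
Qed.

(** The normal offsets from the curve are [- sigma^2 kappa^2 / 2] times [(m - a)^2] and
    [(m' - b)^2]. For [m = m'] the difference of the squares factors as [(b - a) (2 m' - a - b)],
    that is [tgap x * mid x]. *)
Lemma O_theta : Os 3 (fun x => theta x + / 2 * (sa x * sa x * ka x) * (tgap x * mid x)).
Proof.
assert (half : forall n f, O n f -> O n (fun w => / 2 * f w)).
  intros n f Of; apply (bigO_mult 0 n _ _ (bigO_const (/ 2)) Of).
apply (bigO_ext _ (fun x =>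
  pair (nu x) (fun k => cpos (darc (fst x)) k (tmA x) - cpos (darc (fst x)) k (tmB x))
  + (pair (nu x) (fun k => D3 k (sgA x)) - pair (nu x) (fun k => D3 k (sgB x))
     + / 2 * (((sb x - sa x) * ((sb x + sa x) * ka x)
                + sb x * (sb x * pair (nu x) (fun k => Wb x k - Wa x k)))
              * ((tmB x - db (fst x)) * (tmB x - db (fst x)))))
  - / 2 * (sa x * sa x * ka x) *
     (ndif x * (tmA x - da (fst x) + (tmB x - db (fst x) + tgap x))))).
  intros x _; unfold ka, sa, sb; rewrite <- nu_acc.
  unfold theta, mid, D3, D, dif, sg0, W0, tau, Wa, Wb, pair, vec, sum2, ndif, tgap, gap, sgA, sgB;
  simpl; unfold tmA, tmB; field.
apply bigO_minus; [apply bigO_plus |].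
- apply O_nupos.
- apply O_s, bigO_plus; [apply bigO_minus | apply half].
  + apply (O_pair 0 3); auto; intros k; [apply O_nu | apply (O_sgA _ _ (O_D3 K k))].
  + apply (O_pair 0 3); auto; intros k; [apply O_nu | apply (O_sgB _ _ (O_D3 K k))].
  + refine (bigO_mult 1 2 _ _ _ (bigO_mult 1 1 _ _ O_tmB O_tmB)).
    apply bigO_plus.
    * apply (bigO_mult 1 0 _ _ O_sab).
      apply (bigO_mult 0 0 (fun x => _ + _)); [apply bigO_plus; [apply O_sb | apply O_sa] | apply O_ka].
    * apply (bigO_mult 0 1 _ _ O_sb), (bigO_mult 0 1 _ _ O_sb).
      apply (O_pair 0 1); auto; intros k; [apply O_nu | apply O_Wab].
- refine (bigO_mult 0 3 _ _ _ _).
  + apply O_s, half, (bigO_mult 0 0 (fun x => _ * _)); [| apply O_ka].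
    apply (bigO_mult 0 0 _ _ O_sa O_sa).
  + refine (bigO_mult 2 1 _ _ O_ndif _); apply O_s.
    apply bigO_plus; [apply O_tmA | apply bigO_plus; [apply O_tmB | apply O_tgap]].
Qed.

Definition tmx_ok (x : tm) : Prop := tms_ok x /\ theta x = 0.
Notation "'Ox' n f" := (bigO tmx_ok tgap n f) (at level 10, n at level 9, f at level 9).

Lemma O_x n f : Os n f -> Ox n f.
Proof. intros [C H]; exists C; intros x [Px _]; auto. Qed.

Lemma tgap01x x : tmx_ok x -> 0 <= tgap x <= 1.
Proof. intros [Px _]; now apply tgap01s. Qed.

Lemma sa_ge x : tm_ok x -> / K <= sa x.
Proof.
intros [Pw _]; unfold sa; eapply spd_pos; [apply (duo_arc _ Pw) | now apply inI_da].
Qed.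

Lemma turn_ge x : tm_ok x -> / K * / K * / K <= sa x * sa x * ka x.
Proof.
intros Px; generalize (sa_ge x Px) (Rinv_0_lt_compat _ K0); intros H1 H2.
assert (H3 : / K <= ka x) by (destruct Px as [Pw _]; apply (duo_curv _ Pw)).
apply Rmult_le_compat; try nra.
Qed.

(** Here positive curvature is essential: [theta] vanishes at a meeting point, and the estimate of
    order 3 is divided by [tgap] and by [sigma^2 kappa^2]. *)
Lemma O_mid : Ox 2 mid.
Proof.
destruct O_theta as [C HC].
exists (2 * (K * K * K) * C); intros x [Px Tx].
generalize (HC x Px); rewrite Tx, Rplus_0_l; intros H.
destruct Px as [Px Sx]; generalize (turn_ge x Px); intros H1.
assert (G : 0 < tgap x) by (destruct Px as [Pw _]; apply (duo_gap _ Pw)).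
generalize (Rinv_0_lt_compat _ K0); intros K'.
rewrite !Rabs_mult in H.
rewrite (Rabs_pos_eq (/ 2)), (Rabs_pos_eq (tgap x)) in H by lra.
rewrite <- !Rabs_mult in H.
rewrite (Rabs_pos_eq (sa x * sa x * ka x)) in H
  by (apply Rle_trans with (2 := H1); apply Rmult_le_pos; [apply Rmult_le_pos |]; lra).
assert (H2 : / K * / K * / K * (tgap x * Rabs (mid x)) <= 2 * C * tgap x ^ 3).
  apply Rle_trans with (sa x * sa x * ka x * (tgap x * Rabs (mid x))); [| lra].
  apply Rmult_le_compat_r; auto; apply Rmult_le_pos; [lra | apply Rabs_pos].
apply Rmult_le_reg_l with (/ K * / K * / K * tgap x).
  repeat apply Rmult_lt_0_compat; auto.
rewrite Rmult_assoc; apply Rle_trans with (1 := H2).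
right; field; lra.
Qed.

Lemma O_midA : Ox 2 (fun x => tmA x - da (fst x) - / 2 * tgap x).
Proof.
apply (bigO_ext _ (fun x => ndif x + / 2 * mid x)).
  intros x _; unfold ndif, mid, tgap, gap; field.
apply bigO_plus; [apply O_x, O_ndif |].
apply (bigO_mult 0 2 _ _ (bigO_const _) O_mid).
Qed.

Lemma O_midB : Ox 2 (fun x => tmB x - db (fst x) + / 2 * tgap x).
Proof.
apply (bigO_ext _ (fun x => / 2 * mid x)).
  intros x _; unfold ndif, mid, tgap, gap; field.
apply (bigO_mult 0 2 _ _ (bigO_const _) O_mid).
Qed.

(** The pairings of [p], [v] with [T], [W] form a triangular matrix with nonzero diagonal. Its
    determinant is the product of those of the two pairs, so [p] and [v] are independent. *)
Lemma pairs_zero (p v T W z : bool -> R) : pair p T = 1 -> pair p W = 0 ->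
  pair v T = 0 -> pair v W <> 0 -> pair p z = 0 -> pair v z = 0 -> forall k, z k = 0.
Proof.
unfold pair, sum2; intros pT pW vT vW pz vz.
assert (d0 : p false * v true - p true * v false <> 0).
  intros d0; apply vW.
  assert (E : (p false * T false + p true * T true) * (v false * W false + v true * W true)
    - (v false * T false + v true * T true) * (p false * W false + p true * W true)
    = (p false * v true - p true * v false) * (T false * W true - T true * W false)) by ring.
  rewrite pT, vT, d0 in E; lra.
intros [|]; apply (Rmult_eq_reg_l _ _ _) with (2 := d0); rewrite Rmult_0_r.
- transitivity (p false * (v false * z false + v true * z true)
     - v false * (p false * z false + p true * z true)); [ring | rewrite vz, pz; ring].
- transitivity (v true * (p false * z false + p true * z true)
     - p true * (v false * z false + v true * z true)); [ring | rewrite vz, pz; ring].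
Qed.

Lemma ka_pos x : tm_ok x -> 0 < ka x.
Proof.
intros [Pw _]; apply Rlt_le_trans with (/ K); [now apply Rinv_0_lt_compat | apply (duo_curv _ Pw)].
Qed.

Lemma tmx_meet x : tmx_ok x ->
  forall k, gpos (dA (fst x)) k (tmA x) = gpos (dB (fst x)) k (tmB x).
Proof.
intros [[Px Sx] Tx] k; apply Rminus_diag_uniq.
apply (pairs_zero (pa x) (nu x) (vec (utan (darc (fst x))) (da (fst x))) (Wa x)
  (fun k => gpos (dA (fst x)) k (tmA x) - gpos (dB (fst x)) k (tmB x))); auto.
- now apply pa_tan.
- now apply pa_acc.
- now apply nu_tan.
- unfold Wa; rewrite nu_acc; generalize (ka_pos x Px); unfold ka; lra.
- revert Sx; unfold sync, level, pair, sum2, vec; lra.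
Qed.

(** Between the two meeting parameters [p(m)] differs from the exact unit conormal by [O(|m - m'|)]
    on tangents; integrated, the error is [O(|m - m'|^2)], and [ndif] is of order 2. *)
Lemma O_short_tan : Ox 4 (fun x =>
  pair (fun k => cotan (darc (fst x)) k (tmA x))
    (fun k => cpos (darc (fst x)) k (tmA x) - cpos (darc (fst x)) k (tmB x))
  - (len (fst x) (tmA x) - len (fst x) (tmB x))).
Proof.
destruct Lip_tan as [C [C0 HC]]; destruct O_ndif as [E HE].
destruct (bigO_bound tgap01 _ _ (O_cotanA false)) as [L1 [L10 HL1]].
destruct (bigO_bound tgap01 _ _ (O_cotanA true)) as [L2 [L20 HL2]].
apply O_x.
exists (K * ((L1 + L2) * C) * (E * E)); intros x Px; generalize (HE x Px) (tgap01s x Px); intros H G.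
destruct Px as [Px _]; specialize (HL1 x Px); specialize (HL2 x Px).
simpl in HL1, HL2; rewrite Rmult_1_r in HL1, HL2.
destruct Px as [Pw [HA HB]]; destruct x as [w [m m']];
unfold tmA, tmB, ndif, tmA, tmB, tgap in *; simpl fst in *; simpl snd in *.
set (p := fun k => cotan (darc w) k m) in *.
destruct (MVT_is_derive (fun t => level p (cpos (darc w)) t - len w t)
  (fun t => pair p (fun k => spd (darc w) t * utan (darc w) k t) - spd (darc w) t) m m')
  as [c [Hc Ec]].
  intros t Ht; assert (It : inI w t) by (apply (between_in _ _ m m'); auto).
  apply (is_derive_minus (level p (cpos (darc w))) (len w)).
  - apply level_der; intros k; eapply pos_der; [apply (duo_arc w Pw) | auto].
  - now apply duo_len.
assert (Ic : inI w c) by (apply (between_in _ _ m m'); auto).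
match goal with |- Rabs ?a <= _ => replace a with
  (spd (darc w) c * pair p (fun k => utan (darc w) k c - utan (darc w) k m) * (m - m')) end.
- rewrite !Rabs_mult.
  assert (Hcm : Rabs (c - m) <= Rabs (m - m')).
    rewrite (Rabs_minus_sym m m'); now apply between_Rabs.
  assert (HT : forall k, Rabs (utan (darc w) k c - utan (darc w) k m) <= C * Rabs (m - m')).
    intros k; apply Rle_trans with (1 := HC w k m c Pw HA Ic).
    apply Rmult_le_compat_l; lra.
  assert (HP : Rabs (pair p (fun k => utan (darc w) k c - utan (darc w) k m))
     <= (L1 + L2) * (C * Rabs (m - m'))).
    unfold pair, sum2; eapply Rle_trans; [apply Rabs_triang |]; rewrite !Rabs_mult.
    rewrite Rmult_plus_distr_r; apply Rplus_le_compat; apply Rmult_le_compat; auto using Rabs_pos.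
  apply Rle_trans with (K * ((L1 + L2) * (C * Rabs (m - m'))) * Rabs (m - m')).
    apply Rmult_le_compat_r; [apply Rabs_pos |].
    apply Rmult_le_compat; auto using Rabs_pos.
    eapply spd_bd; [apply (duo_arc w Pw) | auto].
  replace (K * ((L1 + L2) * (C * Rabs (m - m'))) * Rabs (m - m')) with
    (K * ((L1 + L2) * C) * (Rabs (m - m') * Rabs (m - m'))) by ring.
  replace (K * ((L1 + L2) * C) * (E * E) * gap w ^ 4) with
    (K * ((L1 + L2) * C) * ((E * gap w ^ 2) * (E * gap w ^ 2))) by (simpl; ring).
  apply Rmult_le_compat_l.
    repeat apply Rmult_le_pos; lra.
  apply Rmult_le_compat; auto using Rabs_pos.
- assert (pT : pair p (fun k => utan (darc w) k m) = 1) by apply (cotan_tan w m Pw HA).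
  transitivity (- (level p (cpos (darc w)) m' - len w m' - (level p (cpos (darc w)) m - len w m))).
    rewrite Ec; revert pT; unfold pair, sum2; intros pT.
    apply Rminus_diag_uniq.
    match type of pT with ?l = 1 =>
      transitivity (spd (darc w) c * (m - m') * (1 - l)); [ring | rewrite pT; ring] end.
  unfold level, pair, sum2, vec; ring.
Qed.

(** At a meeting point [gam(m) + D_A(m) = gam(m') + D_B(m')]. Pairing with [p(m)] gives the length
    between [m'] and [m] as a difference of two tangential offsets, each known to order 4 by
    [O_F4]. *)
Lemma O_len : Ox 4 (fun x => len (fst x) (tmA x) - len (fst x) (tmB x)
   - / 12 * (ka x * sa x ^ 3 * tgap x ^ 3)).
Proof.
assert (cst : forall c n f, Ox n f -> Ox n (fun w => c * f w)).
  intros c n f Of; apply (bigO_mult 0 n _ _ (bigO_const c) Of).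
assert (lift : forall n f, O n f -> Ox n f).
  intros n f Of; now apply O_x, O_s.
(* The summands are: the error along the curve; the two remainders [F4]; the change of [p] from [m']
   to [m], where two factors of order 2 meet; the change of [kappa^2 sigma^3] from [a] to [b]; and
   the cubes of [m - a] and [m' - b] compared with those of half the gap up to sign, in factored
   form. *)
apply (bigO_ext _ (fun x =>
  - (pair (fun k => cotan (darc (fst x)) k (tmA x))
    (fun k => cpos (darc (fst x)) k (tmA x) - cpos (darc (fst x)) k (tmB x))
     - (len (fst x) (tmA x) - len (fst x) (tmB x)))
  - F4 (sgA x) (st (sgA x)) + F4 (sgB x) (st (sgB x))
  + pair (fun k => cotan (darc (fst x)) k (tmA x) - cotan (darc (fst x)) k (tmB x))
      (fun k => D k (sgB x))
  - / 3 * ((kb x * (sb x - sa x) * (sb x * sb x + sb x * sa x + sa x * sa x)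
         + (kb x - ka x) * (sa x * (sa x * sa x)))
        * ((tmB x - db (fst x)) * ((tmB x - db (fst x)) * (tmB x - db (fst x)))))
  + / 3 * (ka x * (sa x * (sa x * sa x))
     * ((tmA x - da (fst x) - / 2 * tgap x) *
         ((tmA x - da (fst x)) * (tmA x - da (fst x)) + (tmA x - da (fst x)) * (/ 2 * tgap x)
          + / 2 * tgap x * (/ 2 * tgap x))
       - (tmB x - db (fst x) + / 2 * tgap x) *
         ((tmB x - db (fst x)) * (tmB x - db (fst x)) - (tmB x - db (fst x)) * (/ 2 * tgap x)
          + / 2 * tgap x * (/ 2 * tgap x)))))).
{ intros x Px; generalize (tmx_meet x Px); intros M.
  generalize (M false) (M true); clear M.
  unfold F4, D, dif, sg0, pair, vec, sum2, sgA, sgB, ka, kb, sa, sb; simpl.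
  unfold dif; simpl; intros M1 M2.
  apply Rminus_diag_eq in M1; apply Rminus_diag_eq in M2.
  apply Rminus_diag_uniq.
  match type of M1 with ?a = 0 => match type of M2 with ?b = 0 =>
   transitivity (- cotan (darc (fst x)) false (tmA x) * a - cotan (darc (fst x)) true (tmA x) * b)
  end end; [field | rewrite M1, M2; ring]. }
apply bigO_plus; [apply bigO_minus; [apply bigO_plus; [apply bigO_plus; [apply bigO_minus |] |] |] |].
- apply bigO_opp, O_short_tan.
- apply lift, (O_sgA _ _ (O_F4 K)).
- apply lift, (O_sgB _ _ (O_F4 K)).
- apply (bigO_sum2 4 (fun k x => (cotan _ k _ - cotan _ k _) * D k _)); intros k.
  apply (bigO_mult 2 2 _ _); [| apply lift, (O_sgB _ _ (O_D2 K k))].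
  destruct Lip_cotan as [C [C0 HC]]; destruct O_ndif as [E HE].
  exists (C * E); intros x [Px _]; specialize (HE x Px); destruct Px as [[Pw [HA HB]] _].
  apply Rle_trans with (1 := HC _ k _ _ Pw HB HA).
  rewrite Rmult_assoc; apply Rmult_le_compat_l; [lra | exact HE].
- apply lift, (bigO_mult 0 4 _ _ (bigO_const _)).
  assert (OK : O 0 kb).
    apply (bigO_ext _ (fun x => (kb x - ka x) + ka x)); [intros; ring |].
    apply bigO_plus; [| apply O_ka].
    apply (bigO_weaken tgap01 1 0 _ (le_S _ _ (le_n 0)) O_kab).
  refine (bigO_mult 1 3 _ _ _ _).
  + apply bigO_plus.
    * refine (bigO_mult 1 0 _ _ (bigO_mult 0 1 _ _ OK O_sab) _).
      apply bigO_plus; [apply bigO_plus |]; apply (bigO_mult 0 0); apply O_sa || apply O_sb.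
    * refine (bigO_mult 1 0 _ _ O_kab _).
      apply (bigO_mult 0 0 _ _ O_sa), (bigO_mult 0 0 _ _ O_sa O_sa).
  + apply (bigO_mult 1 2 _ _ O_tmB), (bigO_mult 1 1 _ _ O_tmB O_tmB).
- apply cst.
  assert (Oh : O 1 (fun x => / 2 * tgap x)) by
    apply (bigO_mult 0 1 _ _ (bigO_const _) O_tgap).
  refine (bigO_mult 0 4 _ _ _ _).
  + apply lift, (bigO_mult 0 0 _ _ O_ka), (bigO_mult 0 0 _ _ O_sa),
      (bigO_mult 0 0 _ _ O_sa O_sa).
  + apply bigO_minus.
    * apply (bigO_mult 2 2 _ _ O_midA), lift.
      apply bigO_plus; [apply bigO_plus |].
      -- apply (bigO_mult 1 1 _ _ O_tmA O_tmA).
      -- apply (bigO_mult 1 1 _ _ O_tmA Oh).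
      -- apply (bigO_mult 1 1 _ _ Oh Oh).
    * apply (bigO_mult 2 2 _ _ O_midB), lift.
      apply bigO_plus; [apply bigO_minus |].
      -- apply (bigO_mult 1 1 _ _ O_tmB O_tmB).
      -- apply (bigO_mult 1 1 _ _ O_tmB Oh).
      -- apply (bigO_mult 1 1 _ _ Oh Oh).
Qed.

Definition arclen (x : tm) : R := len (fst x) (db (fst x)) - len (fst x) (da (fst x)).

Lemma O_arclen : O 2 (fun x => arclen x - sa x * tgap x).
Proof.
destruct (O_MVT 1 (fun w t => len w t - spd (darc w) (da w) * t)
  (fun w t => spd (darc w) t - spd (darc w) (da w))) as [C [C0 HC]].
- intros w t Pw Ht; apply (is_derive_minus (len w) (fun t => _ * t)).
  + now apply duo_len.
  + auto_derive; auto; ring.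
- apply (O_sgA _ _ (O_spd1 K)).
- exists C; intros x Px; destruct (at_b_ok x Px) as [[Pw [Ib _]] _].
  destruct (at_a_ok x Px) as [[_ [Ia _]] _]; simpl in Pw.
  generalize (HC (fst x, (db (fst x), da (fst x))) (conj Pw (conj Ib Ia))).
  unfold arclen, sa, tgap, ndif, gap, tmA, tmB; simpl.
  rewrite (Rabs_pos_eq (db (fst x) - da (fst x))) by (generalize (duo_gap _ Pw); unfold gap; lra).
  intros H; eapply Rle_trans; [| eapply Rle_trans; [apply H |]]; right; [f_equal; ring | ring].
Qed.

Lemma O_cubes : O 4 (fun x => ka x * arclen x ^ 3 - ka x * sa x ^ 3 * tgap x ^ 3).
Proof.
assert (O1 : O 1 arclen).
  apply (bigO_ext _ (fun x => (arclen x - sa x * tgap x) + sa x * tgap x)); [intros; ring |].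
  apply bigO_plus; [apply (bigO_weaken tgap01 2); [lia | apply O_arclen] |].
  apply (bigO_mult 0 1 _ _ O_sa O_tgap).
assert (O2 : O 1 (fun x => sa x * tgap x)) by apply (bigO_mult 0 1 _ _ O_sa O_tgap).
apply (bigO_ext _ (fun x => ka x * ((arclen x - sa x * tgap x) *
  (arclen x * arclen x + arclen x * (sa x * tgap x) + sa x * tgap x * (sa x * tgap x)))));
  [intros; ring |].
apply (bigO_mult 0 4 _ _ O_ka), (bigO_mult 2 2 _ _ O_arclen).
apply bigO_plus; [apply bigO_plus |]; apply (bigO_mult 1 1); auto.
Qed.

Lemma O_excess : Ox 4 (fun x => len (fst x) (tmA x) - len (fst x) (tmB x)
   - ka x / 12 * arclen x ^ 3).
Proof.
apply (bigO_ext _ (fun x => len (fst x) (tmA x) - len (fst x) (tmB x)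
   - / 12 * (ka x * sa x ^ 3 * tgap x ^ 3)
   - / 12 * (ka x * arclen x ^ 3 - ka x * sa x ^ 3 * tgap x ^ 3))); [intros; field |].
apply bigO_minus; [apply O_len |].
apply O_x, O_s, (bigO_mult 0 4 _ _ (bigO_const _) O_cubes).
Qed.

(** The first point in the theorem may be the right end of the arc, so the same estimate is required
    with the curvature at [db]. *)
Lemma O_excess_b : Ox 4 (fun x => len (fst x) (tmA x) - len (fst x) (tmB x)
   - kb x / 12 * arclen x ^ 3).
Proof.
apply (bigO_ext _ (fun x => len (fst x) (tmA x) - len (fst x) (tmB x)
   - ka x / 12 * arclen x ^ 3 - / 12 * ((kb x - ka x) * (arclen x * (arclen x * arclen x)))));
  [intros; field |].
apply bigO_minus; [apply O_excess |].
apply O_x, O_s, (bigO_mult 0 4 _ _ (bigO_const _)), (bigO_mult 1 3 _ _ O_kab).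
assert (O1 : O 1 arclen).
  apply (bigO_ext _ (fun x => (arclen x - sa x * tgap x) + sa x * tgap x)); [intros; ring |].
  apply bigO_plus; [apply (bigO_weaken tgap01 2); [lia | apply O_arclen] |].
  apply (bigO_mult 0 1 _ _ O_sa O_tgap).
apply (bigO_mult 1 2 _ _ O1), (bigO_mult 1 1 _ _ O1 O1).
Qed.

Lemma O_tanAB k : Os 2 (fun x => utan (darc (fst x)) k (tmA x) - utan (darc (fst x)) k (tmB x)).
Proof.
destruct Lip_tan as [C [C0 HC]]; destruct O_ndif as [E HE].
exists (C * E); intros x Px; specialize (HE x Px); destruct Px as [[Pw [HA HB]] _].
apply Rle_trans with (1 := HC _ k _ _ Pw HB HA).
rewrite Rmult_assoc; apply Rmult_le_compat_l; [lra | exact HE].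
Qed.

(** The tangents of the two geodesics at the meeting point differ by about [- sigma W (b - a)]: they
    cross at a nonzero angle. This will show that the geodesics do not have equal tangents there. *)
Lemma O_transversal : Ox 2 (fun x =>
  pair (nu x) (fun k => gtan (dA (fst x)) k (tmA x) - gtan (dB (fst x)) k (tmB x))
  + sa x * ka x * tgap x).
Proof.
assert (lift : forall n f, O n f -> Ox n f).
  intros n f Of; now apply O_x, O_s.
apply (bigO_ext _ (fun x =>
  pair (nu x) (fun k => utan (darc (fst x)) k (tmA x) - utan (darc (fst x)) k (tmB x))
  + pair (nu x) (fun k => U2 k (sgA x)) - pair (nu x) (fun k => U2 k (sgB x))
  + ((sb x - sa x) * ka x + sb x * pair (nu x) (fun k => Wb x k - Wa x k))
     * (tmB x - db (fst x))
  - sa x * ka x * ndif x)).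
  intros x _; unfold ka, sa, sb; rewrite <- nu_acc.
  unfold U2, U, udif, sg0, W0, tau, Wa, Wb, pair, vec, sum2, ndif, tgap, gap, sgA, sgB;
  simpl; unfold tmA, tmB; ring.
assert (Hn : forall n p, (forall k, Ox n (fun x => p x k)) -> Ox n (fun x => pair (nu x) (p x))).
  intros n p Hp; apply (bigO_sum2 n (fun k x => nu x k * p x k)); intros k.
  apply (bigO_mult 0 n _ _ (lift _ _ (O_nu k))); auto.
apply bigO_minus; [apply bigO_plus; [apply bigO_minus; [apply bigO_plus |] |] |].
- apply Hn; intros k; apply O_x, O_tanAB.
- apply Hn; intros k; apply lift, (O_sgA _ _ (O_U2 K k)).
- apply Hn; intros k; apply lift, (O_sgB _ _ (O_U2 K k)).
- apply lift; refine (bigO_mult 1 1 _ _ _ O_tmB); apply bigO_plus.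
  + apply (bigO_mult 1 0 _ _ O_sab O_ka).
  + apply (bigO_mult 0 1 _ _ O_sb).
    apply (O_pair 0 1); auto; intros k; [apply O_nu | apply O_Wab].
- refine (bigO_mult 0 2 _ _ _ _); [| apply O_x, O_ndif].
  apply lift, (bigO_mult 0 0 _ _ O_sa O_ka).
Qed.

(** Used twice: the levels of [pa] increase along both geodesics, and their tangents at the meeting
    point are not opposite. *)
Lemma O_pa_gtanA : O 1 (fun x => pair (pa x) (fun k => gtan (dA (fst x)) k (tmA x)) - 1).
Proof.
apply (bigO_ext _ (fun x => pair (pa x) (fun k => U k (sgA x) +
  (utan (darc (fst x)) k (tmA x) - utan (darc (fst x)) k (da (fst x)))))).
  intros x Px; rewrite <- (pa_tan x Px).
  unfold pair, U, udif, vec, sum2; simpl; ring.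
apply (O_pair 0 1); auto; intros k; [apply O_pa | apply bigO_plus; [| apply O_tan1]].
apply (O_sgA _ _ (O_U1 K k)).
Qed.

Lemma O_pa_gtanB : O 1 (fun x => pair (pa x) (fun k => gtan (dB (fst x)) k (tmB x)) - 1).
Proof.
apply (bigO_ext _ (fun x => pair (pa x) (fun k => U k (sgB x) +
  (utan (darc (fst x)) k (tmB x) - utan (darc (fst x)) k (da (fst x)))))).
  intros x Px; rewrite <- (pa_tan x Px).
  unfold pair, U, udif, vec, sum2; simpl; ring.
apply (O_pair 0 1); auto; intros k; [apply O_pa | apply bigO_plus].
- apply (O_sgB _ _ (O_U1 K k)).
- apply (O_reloc swp 1 _ swp_ok (O_tan1 k)).
Qed.

Lemma O_start : O 2 (fun x =>
  level (pa x) (gpos (dA (fst x))) (tmB x) - level (pa x) (gpos (dB (fst x))) (tmB x)).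
Proof.
apply (bigO_ext _ (fun x => pair (pa x) (fun k => D k (sgA (swp x)) - D k (sgB x)))).
  intros x _; unfold pair, D, dif, level, pair, vec, sum2; simpl; unfold swp, tmA, tmB; simpl; ring.
apply (O_pair 0 2); auto; intros k; [apply O_pa | apply bigO_minus].
- apply (O_reloc swp 2 _ swp_ok (O_sgA _ _ (O_D2 K k))).
- apply (O_sgB _ _ (O_D2 K k)).
Qed.

Lemma IVT_Lipschitz (f : R -> R) (a b L y : R) : a <= b ->
  (forall u v, a <= u <= b -> a <= v <= b -> Rabs (f v - f u) <= L * Rabs (v - u)) ->
  Rmin (f a) (f b) <= y <= Rmax (f a) (f b) -> exists u, a <= u <= b /\ f u = y.
Proof.
intros ab HL Hy.
(* Clamping to the interval makes the function continuous on the whole line, although nothing is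
   known of [f] outside. *)
set (c := fun u => Rmax a (Rmin b u)).
assert (cI : forall u, a <= c u <= b).
  intros u; unfold c, Rmax, Rmin; destruct (Rle_dec b u); destruct Rle_dec; lra.
assert (cL : forall u v, Rabs (c v - c u) <= Rabs (v - u)).
  intros u v; unfold c, Rmax, Rmin;
  destruct (Rle_dec b u); destruct (Rle_dec b v); repeat destruct Rle_dec;
  unfold Rabs; repeat destruct Rcase_abs; lra.
assert (ca : c a = a) by (unfold c, Rmax, Rmin; repeat destruct Rle_dec; lra).
assert (cb : c b = b) by (unfold c, Rmax, Rmin; repeat destruct Rle_dec; lra).
destruct (IVT_gen (fun u => f (c u)) a b y) as [u [_ Hu]].
- intros u; apply continuity_pt_filterlim; intros P [eps HP].
  assert (L1 : 0 < Rabs L + 1) by (generalize (Rabs_pos L); lra).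
  exists (mkposreal (eps / (Rabs L + 1)) (Rdiv_lt_0_compat _ _ (cond_pos eps) L1)).
  intros v Hv; apply HP; change (Rabs (v - u) < eps / (Rabs L + 1)) in Hv.
  change (Rabs (f (c v) - f (c u)) < eps).
  apply Rle_lt_trans with (1 := HL _ _ (cI u) (cI v)).
  apply Rle_lt_trans with ((Rabs L + 1) * Rabs (v - u)).
    apply Rle_trans with ((Rabs L + 1) * Rabs (c v - c u)).
      apply Rmult_le_compat_r; [apply Rabs_pos | generalize (RRle_abs L); lra].
    apply Rmult_le_compat_l; [lra | apply cL].
  replace (eps : R) with ((Rabs L + 1) * (eps / (Rabs L + 1))) by (field; lra).
  now apply Rmult_lt_compat_l.
- now rewrite ca, cb.
- exists (c u); auto.
Qed.

Lemma level_lip w y p lo hi : duo_ok w -> (forall t, lo <= t <= hi -> inI w t) ->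
  (forall k t, inI w t -> is_derive (gpos y k) t (spd (darc w) t * gtan y k t)) ->
  (forall k t, inI w t -> Rabs (gtan y k t) <= K) ->
  forall u v, lo <= u <= hi -> lo <= v <= hi ->
  Rabs (level p (gpos y) v - level p (gpos y) u) <= norm1 p * (K * K) * Rabs (v - u).
Proof.
intros Pw I Hd Hb u v Hu Hv.
apply (MVT_Lipschitz _ (fun t => pair p (fun k => spd (darc w) t * gtan y k t)) lo hi); auto.
- intros t Ht; apply level_der; auto.
- intros t Ht; unfold pair, sum2, norm1.
  eapply Rle_trans; [apply Rabs_triang |].
  rewrite Rmult_plus_distr_r; apply Rplus_le_compat; rewrite Rabs_mult;
  (apply Rmult_le_compat_l; [apply Rabs_pos |]); rewrite Rabs_mult;
  apply Rmult_le_compat; auto using Rabs_pos;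
  (eapply spd_bd; [apply (duo_arc w Pw) | apply I; auto]).
Qed.

Lemma level_slope w y p lo hi : duo_ok w -> (forall t, lo <= t <= hi -> inI w t) ->
  (forall k t, inI w t -> is_derive (gpos y k) t (spd (darc w) t * gtan y k t)) ->
  (forall t, inI w t -> / 2 <= pair p (fun k => gtan y k t)) ->
  forall u v, lo <= u <= v -> v <= hi ->
  / K * / 2 * (v - u) <= level p (gpos y) v - level p (gpos y) u.
Proof.
intros Pw I Hd Hb u v Hu Hv.
destruct (MVT_is_derive (level p (gpos y)) (fun t => pair p (fun k => spd (darc w) t * gtan y k t)) u v)
  as [c [Hc ->]].
  intros t; rewrite Rmin_left, Rmax_right by lra; intros Ht.
  apply level_der; intros k; apply Hd, I; lra.
revert Hc; rewrite Rmin_left, Rmax_right by lra; intros Hc.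
apply Rmult_le_compat_r; [lra |].
replace (pair p (fun k => spd (darc w) c * gtan y k c)) with
  (spd (darc w) c * pair p (fun k => gtan y k c)) by (unfold pair, sum2; ring).
apply Rmult_le_compat; [left; now apply Rinv_0_lt_compat | lra | |].
- eapply spd_pos; [apply (duo_arc w Pw) | apply I; lra].
- apply Hb, I; lra.
Qed.

(* Two applications of the intermediate value theorem: the levels of [pa] match the
   parameters of the two geodesics, then [theta] changes sign along the matching. *)
Lemma meeting_exists : exists del, 0 < del /\ forall w, duo_ok w -> gap w <= del ->
  exists x, fst x = w /\ tmx_ok x /\
  / 2 <= pair (pa x) (fun k => gtan (dA w) k (tmA x)) /\
  / 2 <= pair (pa x) (fun k => gtan (dB w) k (tmB x)).
Proof.
destruct (bigO_bound tgap01 _ _ O_pa_gtanA) as [C1 [C10 H1]].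
destruct (bigO_bound tgap01 _ _ O_pa_gtanB) as [C2 [C20 H2]].
destruct (bigO_bound tgap01 _ _ O_start) as [C3 [C30 H3]].
destruct (bigO_bound tgap01s _ _ O_theta) as [C4 [C40 H4]].
(* For a gap at most [/ M]: the summands with [C1] and [C2] keep the slopes of both levels at least
   half a unit; the one with [C3] makes the mismatch at equal parameters smaller than what the level
   gains over one gap; the one with [C4] keeps the error of [theta] below its main term at the
   ends. *)
set (M := 2 * C1 + 2 * C2 + 2 * K * C3 + 2 * (K * K * K) * C4).
assert (M1 : 0 < 2 * K * C3) by (repeat apply Rmult_lt_0_compat; lra).
assert (M2 : 0 < 2 * (K * K * K) * C4) by (repeat apply Rmult_lt_0_compat; lra).
assert (M0 : 0 < M) by (unfold M; lra).
exists (/ M); split; [now apply Rinv_0_lt_compat |]; intros w Pw Gw.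
assert (G : 0 < gap w) by apply (duo_gap w Pw).
assert (GM : M * gap w <= 1).
  replace 1 with (M * / M) by (field; lra); apply Rmult_le_compat_l; lra.
assert (P1 : 0 <= C1 * gap w) by (apply Rmult_le_pos; lra).
assert (P2 : 0 <= C2 * gap w) by (apply Rmult_le_pos; lra).
assert (P3 : 0 <= 2 * K * C3 * gap w) by (apply Rmult_le_pos; lra).
assert (P4 : 0 <= 2 * (K * K * K) * C4 * gap w) by (apply Rmult_le_pos; lra).
assert (PM : 2 * (C1 * gap w) + 2 * (C2 * gap w) + 2 * K * C3 * gap w
   + 2 * (K * K * K) * C4 * gap w <= 1) by (unfold M in GM; lra).
set (p := pa (w, (0, 0))).
assert (HA : forall t, inI w t -> / 2 <= pair p (fun k => gtan (dA w) k t)).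
  intros t It; generalize (H1 (w, (t, t)) (conj Pw (conj It It))).
  change (pa (w, (t, t))) with p; unfold tgap; simpl fst.
  change (tmA (w, (t, t))) with t; simpl; intros B.
  apply Rabs_le_between in B; lra.
assert (HB : forall t, inI w t -> / 2 <= pair p (fun k => gtan (dB w) k t)).
  intros t It; generalize (H2 (w, (t, t)) (conj Pw (conj It It))).
  change (pa (w, (t, t))) with p; unfold tgap; simpl fst.
  change (tmB (w, (t, t))) with t; simpl; intros B.
  apply Rabs_le_between in B; lra.
assert (dAd : forall k t, inI w t -> is_derive (gpos (dA w) k) t (spd (darc w) t * gtan (dA w) k t)).
  intros k t; apply (gpos_der _ _ _ _ _ _ (duo_A w Pw)).
assert (dBd : forall k t, inI w t -> is_derive (gpos (dB w) k) t (spd (darc w) t * gtan (dB w) k t)).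
  intros k t; apply (gpos_der _ _ _ _ _ _ (duo_B w Pw)).
assert (dAb : forall k t, inI w t -> Rabs (gtan (dA w) k t) <= K).
  intros k t; apply (gtan_bd _ _ _ _ _ _ (duo_A w Pw)).
assert (dBb : forall k t, inI w t -> Rabs (gtan (dB w) k t) <= K).
  intros k t; apply (gtan_bd _ _ _ _ _ _ (duo_B w Pw)).
set (fA := level p (gpos (dA w))); set (fB := level p (gpos (dB w))).
assert (Iw : forall t, da w <= t <= db w -> inI w t).
  intros t Ht; unfold inI, dlo, dhi; lra.
assert (ex : forall t, da w <= t <= db w -> exists m, inI w m /\ fA m = fB t).
  intros t Ht; assert (It := Iw t Ht).
  generalize (H3 (w, (t, t)) (conj Pw (conj It It))).
  change (pa (w, (t, t))) with p; unfold tgap; simpl fst.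
  change (tmB (w, (t, t))) with t; fold fA fB; intros B.
  assert (II : forall u, t - gap w <= u <= t + gap w -> inI w u).
    intros u Hu; unfold inI, dlo, dhi, gap in *; lra.
  generalize (level_slope w (dA w) p (t - gap w) (t + gap w) Pw II dAd HA); fold fA; intros SL.
  assert (B' : C3 * gap w ^ 2 <= / K * / 2 * gap w).
    apply Rmult_le_reg_l with (2 * K); [lra |].
    replace (2 * K * (/ K * / 2 * gap w)) with (1 * gap w) by (field; lra).
    replace (2 * K * (C3 * gap w ^ 2)) with (2 * K * C3 * gap w * gap w) by ring.
    apply Rmult_le_compat_r; lra.
  generalize (SL (t - gap w) t ltac:(lra) ltac:(lra)) (SL t (t + gap w) ltac:(lra) ltac:(lra)).
  intros S1 S2; apply Rabs_le_between in B.
  destruct (IVT_Lipschitz fA (t - gap w) (t + gap w) (norm1 p * (K * K)) (fB t)) as [m [Hm Em]].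
  - lra.
  - apply (level_lip w); auto.
  - replace (t - (t - gap w)) with (gap w) in S1 by ring.
    replace (t + gap w - t) with (gap w) in S2 by ring.
    rewrite Rmin_left, Rmax_right by lra; lra.
  - exists m; auto.
set (mm := fun t => epsilon (inhabits 0) (fun m => inI w m /\ fA m = fB t)).
assert (Hmm : forall t, da w <= t <= db w -> inI w (mm t) /\ fA (mm t) = fB t).
  intros t Ht; apply (epsilon_spec (inhabits 0) (fun m => inI w m /\ fA m = fB t)); auto.
clearbody mm.
(* [mm] is chosen pointwise, but it solves [fA (mm t) = fB t]; the lower slope bound of [fA] and the
   Lipschitz bound of [fB] make it Lipschitz. *)
assert (Lmm : forall u v, da w <= u <= db w -> da w <= v <= db w ->
    Rabs (mm v - mm u) <= 2 * K * (norm1 p * (K * K)) * Rabs (v - u)).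
  assert (LB := level_lip w (dB w) p (dlo w) (dhi w) Pw (fun t Ht => Ht) dBd dBb).
  assert (SA := level_slope w (dA w) p (dlo w) (dhi w) Pw (fun t Ht => Ht) dAd HA).
  fold fB in LB; fold fA in SA.
  assert (Q : forall u v, da w <= u <= db w -> da w <= v <= db w -> mm u <= mm v ->
      Rabs (mm v - mm u) <= 2 * K * (norm1 p * (K * K)) * Rabs (v - u)).
    intros u v Hu Hv le; destruct (Hmm u Hu) as [I1 E1]; destruct (Hmm v Hv) as [I2 E2].
    generalize (LB u v (Iw u Hu) (Iw v Hv)) (SA (mm u) (mm v) (conj (proj1 I1) le) (proj2 I2)).
    rewrite E1, E2; intros B1 B2.
    assert (B3 := Rle_trans _ _ _ B2 (Rle_trans _ _ _ (RRle_abs _) B1)).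
    rewrite Rabs_pos_eq by lra.
    apply Rmult_le_reg_l with (/ K * / 2).
      apply Rmult_lt_0_compat; [now apply Rinv_0_lt_compat | lra].
    apply Rle_trans with (1 := B3); right; field; lra.
  intros u v Hu Hv; destruct (Rle_dec (mm u) (mm v)); [now apply Q |].
  rewrite (Rabs_minus_sym (mm v)), (Rabs_minus_sym v); apply Q; auto; lra.
set (q := nu (w, (0, 0))).
set (th := fun t => theta (w, (mm t, t))).
assert (Eth : forall t, th t = level q (gpos (dA w)) (mm t) - level q (gpos (dB w)) t).
  intros t; unfold th, theta, level, q, nu, pair, vec, sum2; simpl; unfold tmA, tmB; simpl; ring.
assert (Sy : forall t, da w <= t <= db w -> tms_ok (w, (mm t, t))).
  intros t Ht; destruct (Hmm t Ht) as [I1 E1]; split; [split; [auto | split; simpl; auto] | exact E1].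
assert (B4 : C4 * gap w ^ 3 <= / 2 * (/ K * / K * / K) * gap w ^ 2).
  apply Rmult_le_reg_l with (2 * (K * K * K)); [repeat apply Rmult_lt_0_compat; lra |].
  replace (2 * (K * K * K) * (/ 2 * (/ K * / K * / K) * gap w ^ 2)) with (1 * gap w ^ 2) by (field; lra).
  replace (2 * (K * K * K) * (C4 * gap w ^ 3)) with (2 * (K * K * K) * C4 * gap w * gap w ^ 2) by ring.
  apply Rmult_le_compat_r; [apply pow_le; lra | lra].
assert (TG : / K * / K * / K * gap w ^ 2 <= sa (w, (0, 0)) * sa (w, (0, 0)) * ka (w, (0, 0)) * gap w ^ 2).
  apply Rmult_le_compat_r; [apply pow_le; lra |].
  assert (Ia : inI w (da w)) by now apply inI_da.
  apply (turn_ge (w, (da w, da w)) (conj Pw (conj Ia Ia))).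
assert (ab : da w <= db w) by (unfold gap in G; lra).
destruct (IVT_Lipschitz th (da w) (db w)
   (norm1 q * (K * K) * (2 * K * (norm1 p * (K * K))) + norm1 q * (K * K)) 0) as [t [Ht Et]]; auto.
- intros u v Hu Hv; rewrite !Eth.
  destruct (Hmm u Hu) as [I1 _]; destruct (Hmm v Hv) as [I2 _].
  generalize (level_lip w (dA w) q (dlo w) (dhi w) Pw (fun t Ht => Ht) dAd dAb _ _ I1 I2)
   (level_lip w (dB w) q (dlo w) (dhi w) Pw (fun t Ht => Ht) dBd dBb _ _ (Iw u Hu) (Iw v Hv))
   (Lmm u v Hu Hv).
  intros A1 A2 A3.
  assert (N : 0 <= norm1 q * (K * K)).
    apply Rmult_le_pos; [| apply Rmult_le_pos; lra].
    unfold norm1; generalize (Rabs_pos (q false)) (Rabs_pos (q true)); lra.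
  assert (A4 := Rmult_le_compat_l _ _ _ N A3).
  match goal with |- Rabs (?a - ?b - (?c - ?d)) <= _ =>
    replace (a - b - (c - d)) with ((a - c) - (b - d)) by ring;
    generalize (Rabs_triang (a - c) (- (b - d))); rewrite Rabs_Ropp; fold (a - c - (b - d)) end.
  intros A5; unfold Rminus in *; lra.
- generalize (H4 _ (Sy (da w) ltac:(lra))) (H4 _ (Sy (db w) ltac:(lra))).
  fold (th (da w)) (th (db w)).
  unfold mid, tgap; simpl fst; unfold tmB; simpl snd.
  change (sa (w, (mm (da w), da w))) with (sa (w, (0, 0))).
  change (sa (w, (mm (db w), db w))) with (sa (w, (0, 0))).
  change (ka (w, (mm (da w), da w))) with (ka (w, (0, 0))).
  change (ka (w, (mm (db w), db w))) with (ka (w, (0, 0))).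
  (* At the two ends [mid] is minus and plus the gap, so [theta] has opposite main terms there, of
     order 2 against an error of order 3. *)
  replace (2 * da w - da w - db w) with (- gap w) by (unfold gap; ring).
  replace (2 * db w - da w - db w) with (gap w) by (unfold gap; ring).
  set (S := sa (w, (0, 0)) * sa (w, (0, 0)) * ka (w, (0, 0))) in *.
  intros A1 A2; apply Rabs_le_between in A1; apply Rabs_le_between in A2.
  assert (0 <= th (da w)) by (simpl in *; lra).
  assert (th (db w) <= 0) by (simpl in *; lra).
  rewrite Rmin_right, Rmax_left by lra; lra.
- exists (w, (mm t, t)); split; [auto |]; split; [split; [now apply Sy | exact Et] |].
  destruct (Hmm t Ht) as [I1 _].
  split; [apply HA | apply HB]; auto.
Qed.

(** All that the geometry needs. The inequalities on [m] and [m'] fix the signs of the geodesic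
    parameters, hence turn lengths into differences of [len]; the two negations feed the uniqueness
    of the meeting point. *)
Lemma two_geodesics : exists C del, 0 < C /\ 0 < del /\
  forall w, duo_ok w -> gap w <= del -> exists m m', inI w m /\ inI w m' /\
  da w < m /\ m' < db w /\ (forall k, gpos (dA w) k m = gpos (dB w) k m') /\
  ~ (forall k, gtan (dA w) k m = gtan (dB w) k m') /\
  ~ (forall k, gtan (dA w) k m = - gtan (dB w) k m') /\
  (forall t, t = da w \/ t = db w ->
   Rabs (len w m - len w m' - curv2 (darc w) t / 12 * (len w (db w) - len w (da w)) ^ 3)
     <= C * (len w (db w) - len w (da w)) ^ 4).
Proof.
destruct meeting_exists as [del [del0 Hdel]].
destruct (bigO_bound tgap01x _ _ O_excess) as [C1 [C10 H1]].
destruct (bigO_bound tgap01x _ _ O_excess_b) as [C2 [C20 H2]].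
destruct (bigO_bound tgap01x _ _ O_midA) as [C3 [C30 H3]].
destruct (bigO_bound tgap01x _ _ O_midB) as [C4 [C40 H4]].
destruct (bigO_bound tgap01x _ _ O_transversal) as [C5 [C50 H5]].
(* [C3] and [C4] bound the distance from the midpoint, which has to stay below half a gap; the last
   summand keeps the crossing angle, at least [gap / K^2] in the scale of [O_transversal], above its
   error. *)
set (M := 3 * C3 + 3 * C4 + 2 * (K * K) * C5).
assert (M1 : 0 < 2 * (K * K) * C5) by (repeat apply Rmult_lt_0_compat; lra).
assert (M0 : 0 < M) by (unfold M; lra).
(* The errors are in powers of the gap; as the speed is at least [/ K], the gap is at most [K] times
   the arc length. *)
exists ((C1 + C2) * K ^ 4), (Rmin del (/ M)).
split; [apply Rmult_lt_0_compat; [lra | now apply pow_lt] |].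
split; [apply Rmin_glb_lt; auto; now apply Rinv_0_lt_compat |].
intros w Pw Gw.
assert (G : 0 < gap w) by apply (duo_gap w Pw).
destruct (Hdel w Pw) as [x [Ex [Tx [VA VB]]]].
  apply Rle_trans with (1 := Gw), Rmin_l.
assert (GM : M * gap w <= 1).
  replace 1 with (M * / M) by (field; lra); apply Rmult_le_compat_l; [lra |].
  apply Rle_trans with (1 := Gw), Rmin_r.
assert (P3 : 0 <= C3 * gap w) by (apply Rmult_le_pos; lra).
assert (P4 : 0 <= C4 * gap w) by (apply Rmult_le_pos; lra).
assert (P5 : 0 <= 2 * (K * K) * C5 * gap w) by (apply Rmult_le_pos; lra).
unfold M in GM.
generalize (H1 x Tx) (H2 x Tx) (H3 x Tx) (H4 x Tx) (H5 x Tx) (tmx_meet x Tx).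
destruct Tx as [[Px Sx] Tx]; generalize (sa_ge x Px) (duo_curv _ (proj1 Px)).
destruct Px as [_ [I1 I2]].
destruct x as [w' [m m']]; simpl in Ex; subst w'.
unfold tgap, tmA, tmB in *; simpl fst in *; simpl snd in *.
intros Hs Hk E1 E2 E3 E4 E5 Em.
assert (L3 : C3 * gap w ^ 2 < / 2 * gap w).
  simpl; rewrite Rmult_1_r, <- Rmult_assoc; apply Rmult_lt_compat_r; lra.
assert (L4 : C4 * gap w ^ 2 < / 2 * gap w).
  simpl; rewrite Rmult_1_r, <- Rmult_assoc; apply Rmult_lt_compat_r; lra.
apply Rabs_le_between in E3; apply Rabs_le_between in E4.
exists m, m'; split; [auto |]; split; [auto |]; split; [lra |]; split; [lra |].
split; [auto |]; split; [| split].
- intros Eq.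
  assert (Z : pair (nu (w, (m, m'))) (fun k => gtan (dA w) k m - gtan (dB w) k m') = 0).
    unfold pair, sum2; rewrite !Eq; ring.
  rewrite Z, Rplus_0_l in E5.
  assert (K' := Rinv_0_lt_compat _ K0).
  assert (L5 : / K * / K * gap w <= sa (w, (m, m')) * ka (w, (m, m')) * gap w).
    apply Rmult_le_compat_r; [lra |]; apply Rmult_le_compat; auto; lra.
  rewrite Rabs_pos_eq in E5.
    2: { apply Rle_trans with (2 := L5); repeat apply Rmult_le_pos; lra. }
  assert (L6 := Rle_trans _ _ _ L5 E5).
  assert (L7 : K * K * (/ K * / K * gap w) <= K * K * (C5 * gap w ^ 2)).
    apply Rmult_le_compat_l; [apply Rmult_le_pos; lra | auto].
  replace (K * K * (/ K * / K * gap w)) with (gap w) in L7 by (field; lra).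
  assert (L8 : 2 * (K * K) * C5 * gap w * gap w <= 1 * gap w).
    apply Rmult_le_compat_r; lra.
  simpl in L7; lra.
- intros Eq.
  assert (Z : pair (pa (w, (m, m'))) (fun k => gtan (dA w) k m) =
     - pair (pa (w, (m, m'))) (fun k => gtan (dB w) k m')).
    unfold pair, sum2; rewrite !Eq; ring.
  lra.
- assert (GL : gap w <= K * (len w (db w) - len w (da w))).
    destruct (MVT_is_derive (len w) (spd (darc w)) (da w) (db w)) as [c [Hc ->]].
      intros t Ht; apply duo_len; auto; apply (between_in _ _ (da w) (db w)); auto;
      [now apply inI_da | now apply inI_db].
    assert (Ic : inI w c).
      apply (between_in _ _ (da w) (db w)); auto; [now apply inI_da | now apply inI_db].
    generalize (spd_pos _ _ _ _ (duo_arc w Pw) c Ic); intros Sc.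
    fold (gap w); rewrite <- Rmult_assoc.
    rewrite <- (Rmult_1_l (gap w)) at 1; apply Rmult_le_compat_r; [lra |].
    replace 1 with (K * / K) by (field; lra); apply Rmult_le_compat_l; lra.
  set (s := len w (db w) - len w (da w)) in *.
  assert (s0 : 0 <= s) by (apply Rmult_le_reg_l with K; lra).
  assert (G4 : gap w ^ 4 <= K ^ 4 * s ^ 4).
    rewrite <- Rpow_mult_distr; apply pow_incr; lra.
  assert (G40 : 0 <= gap w ^ 4) by (apply pow_le; lra).
  assert (CG1 := Rmult_le_compat_l C1 _ _ (Rlt_le _ _ C10) G4).
  assert (CG2 := Rmult_le_compat_l C2 _ _ (Rlt_le _ _ C20) G4).
  assert (CG3 := Rmult_le_pos C1 _ (Rlt_le _ _ C10) (Rle_trans _ _ _ G40 G4)).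
  assert (CG4 := Rmult_le_pos C2 _ (Rlt_le _ _ C20) (Rle_trans _ _ _ G40 G4)).
  intros t [-> | ->].
  + apply Rle_trans with (1 := E1); lra.
  + apply Rle_trans with (1 := E2); lra.
Qed.

End TwoGeodesics.

(** * Changes of charts *)

Lemma ex_diff_differentiable f x y : locally_2d (fun u v => ex_diff_n f 1 u v) x y ->
  differentiable_pt_lim f x y (partial false f x y) (partial true f x y).
Proof.
intros H; generalize (locally_2d_singleton _ _ _ H); intros [_ [_ [Hy [[Hc _] _]]]].
apply filterdiff_differentiable_pt_lim.
apply filterdiff_ext_lin with (1 := is_derive_filterdiff f x y (partial false f) (partial true f x y)
  (proj1 (locally_2d_locally (fun u v => is_derive (fun z => f z v) u (partial false f u v)) x y)
     (locally_2d_impl _ _ _ _ (locally_2d_forall _ _ _ (fun u v P => Derive_correct _ _ (proj1 (proj2 P)))) H))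
  (Derive_correct _ _ Hy)
  (proj1 (continuity_2d_pt_filterlim _ _ _) Hc)).
intros u; reflexivity.
Qed.

Lemma is_derive_comp_2d f u v (t u' v' : R) :
  locally_2d (fun x y => ex_diff_n f 1 x y) (u t) (v t) ->
  is_derive u t u' -> is_derive v t v' ->
  is_derive (fun s => f (u s) (v s)) t
    (partial false f (u t) (v t) * u' + partial true f (u t) (v t) * v').
Proof.
intros Hf Hu Hv; apply is_derive_Reals, derivable_pt_lim_comp_2d;
[now apply ex_diff_differentiable | now apply is_derive_Reals ..].
Qed.

Lemma ex_diff_n_le f n m x y : (m <= n)%nat -> ex_diff_n f n x y -> ex_diff_n f m x y.
Proof.
revert f m; induction n as [|n IH]; intros f m le H.
  now replace m with 0%nat by lia.
destruct H as [H0 [H1 [H2 [H3 H4]]]]; destruct m as [|m]; [now split |].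
split; auto; split; auto; split; auto; split; apply IH; auto; lia.
Qed.

Lemma ex_diff_n_partial f n k x y : ex_diff_n f (S n) x y -> ex_diff_n (partial k f) n x y.
Proof. intros [_ [_ [_ [H1 H2]]]]; destruct k; assumption. Qed.

Section Charts.

Context {S : surface}.

Definition overlap (i j : chart S) (x y : R) : Prop :=
  exists p : S, dom i p /\ dom j p /\ coord i p = (x, y).

Lemma locally_overlap i j x y : overlap i j x y -> locally_2d (overlap i j) x y.
Proof.
intros H; apply locally_2d_locally.
generalize (overlap_open S i j (x, y) H); apply filter_imp; intros [u v] [p Hp]; exists p; exact Hp.
Qed.

Lemma locally_in_image (i : chart S) x y : in_image i (x, y) ->
  locally_2d (fun u v => in_image i (u, v)) x y.
Proof.
intros [p [H1 H2]]; apply (locally_2d_impl (overlap i i)).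
  apply locally_2d_forall; intros u v [q [H3 [_ H4]]]; now exists q.
apply locally_overlap; now exists p.
Qed.

Lemma transition_diff i j x y l : overlap i j x y -> ex_diff_n (transition i j l) 4 x y.
Proof.
intros [p [H1 [H2 H3]]]; generalize (transition_C4 S i j p l H1 H2); rewrite H3; auto.
Qed.

Lemma overlap_coord i j (p : S) : dom i p -> dom j p ->
  overlap i j (fst (coord i p)) (snd (coord i p)).
Proof. intros H1 H2; exists p; split; auto; split; auto; now destruct (coord i p). Qed.

Lemma transition_loc i j (p : S) l n : (n <= 4)%nat -> dom i p -> dom j p ->
  locally_2d (fun x y => ex_diff_n (transition i j l) n x y) (fst (coord i p)) (snd (coord i p)).
Proof.
intros le H1 H2; generalize (locally_overlap _ _ _ _ (overlap_coord i j p H1 H2)).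
apply locally_2d_impl, locally_2d_forall; intros u v H.
apply (ex_diff_n_le _ 4); auto; now apply transition_diff.
Qed.

Lemma curve_coord_trans i j (c : R -> S) l t : dom i (c t) ->
  curve_coord j c l t = transition i j l (curve_coord i c false t) (curve_coord i c true t).
Proof.
intros H; unfold curve_coord, transition, proj; rewrite <- surjective_pairing.
now rewrite paramK.
Qed.

Definition jac (i j : chart S) (l k : bool) (p : S) : R :=
  partial k (transition i j l) (fst (coord i p)) (snd (coord i p)).

Definition push (i j : chart S) (p : S) (V : bool -> R) (l : bool) : R :=
  sum2 (fun k => jac i j l k p * V k).

Lemma velocity_trans i j (c : R -> S) t l : dom i (c t) -> dom j (c t) ->
  locally t (fun s => dom i (c s)) -> (forall k, ex_derive (curve_coord i c k) t) ->
  velocity j c l t = push i j (c t) (fun k => velocity i c k t) l.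
Proof.
intros H1 H2 Hl Hd; unfold velocity at 1.
rewrite (Derive_ext_loc _ (fun s => transition i j l (curve_coord i c false s) (curve_coord i c true s))).
- apply is_derive_unique, is_derive_comp_2d; [| apply Derive_correct, Hd ..].
  apply transition_loc; auto.
- revert Hl; apply filter_imp; intros s; apply curve_coord_trans.
Qed.

Lemma Derive_push i j (c : R -> S) t l (V V' : bool -> R -> R) : dom i (c t) -> dom j (c t) ->
  (forall k, ex_derive (curve_coord i c k) t) -> (forall k, ex_derive (V k) t) ->
  locally t (fun s => V' l s = push i j (c s) (fun k => V k s) l) ->
  Derive (V' l) t = push i j (c t) (fun k => Derive (V k) t) l +
    sum2 (fun k => sum2 (fun m =>
      partial m (partial k (transition i j l)) (fst (coord i (c t))) (snd (coord i (c t)))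
       * velocity i c m t * V k t)).
Proof.
intros H1 H2 Hd HV Hl.
rewrite (Derive_ext_loc _ _ _ Hl); apply is_derive_unique; eapply is_derive_eq.
- apply (is_derive_sum2 (fun k s => jac i j l k (c s) * V k s)); intros k.
  apply is_derive_mul; [| now apply Derive_correct].
  apply (is_derive_comp_2d (partial k (transition i j l)) (fun s => fst (coord i (c s)))
      (fun s => snd (coord i (c s)))).
  + generalize (transition_loc i j (c t) l 2 ltac:(lia) H1 H2).
    apply locally_2d_impl, locally_2d_forall; intros u v; apply ex_diff_n_partial.
  + apply Derive_correct, (Hd false).
  + apply Derive_correct, (Hd true).
- unfold push, jac, sum2, velocity, curve_coord, proj; ring.
Qed.

Variable g : metric S.

Lemma chart_norm_push i j (p : S) V : dom i p -> dom j p ->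
  chart_norm g j p (push i j p V) = chart_norm g i p V.
Proof.
intros H1 H2; unfold chart_norm; f_equal; unfold quad at 2, sum2.
rewrite !(gc_compat S g i j p); auto.
unfold quad, push, jac, sum2; ring.
Qed.

Lemma chart_norm_ext i p V V' : (forall k, V k = V' k) -> chart_norm g i p V = chart_norm g i p V'.
Proof. intros H; unfold chart_norm, quad, sum2; now rewrite !H. Qed.

Lemma chart_speed_trans i j (c : R -> S) t : dom i (c t) -> dom j (c t) ->
  locally t (fun s => dom i (c s)) -> (forall k, ex_derive (curve_coord i c k) t) ->
  chart_speed g j c t = chart_speed g i c t.
Proof.
intros H1 H2 Hl Hd; unfold chart_speed; rewrite <- (chart_norm_push i j); auto.
apply chart_norm_ext; intros k; now apply velocity_trans.
Qed.

Definition unit_tan (i : chart S) (c : R -> S) (k : bool) (t : R) : R :=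
  velocity i c k t / chart_speed g i c t.

Definition chart_curv (i : chart S) (c : R -> S) (t : R) : R :=
  chart_norm g i (c t) (fun k => cov_deriv g i c (unit_tan i c) k t) / chart_speed g i c t.

(* A geodesic [c] tangent to [gam] removes the Christoffel symbols from the
   covariant derivative of the unit tangent, which is [T' - speed * c''], so that
   its tensorial behaviour needs no transformation rule for them. *)
Lemma cov_deriv_trans i j (gam c : R -> S) a r l : 0 < r ->
  tangent_geodesic g gam a r c -> dom i (gam a) -> dom j (gam a) ->
  curve_Cn 2 gam a -> locally a (fun s => curve_Cn 1 gam s) ->
  chart_speed g i gam a <> 0 ->
  (forall k, ex_derive (unit_tan i gam k) a) ->
  cov_deriv g j gam (unit_tan j gam) l a =
    push i j (gam a) (fun k => cov_deriv g i gam (unit_tan i gam) k a) l.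
Proof.
intros r0 [Hgeo [Hc0 Hv0]] Hi Hj H2 H1 Hs HT.
assert (R0 : - r < 0 < r) by lra.
destruct (Hgeo 0 R0) as [Cc Gc]; rewrite Hc0 in Gc.
assert (Dg : forall i, dom i (gam a) -> forall k, ex_derive (curve_coord i gam k) a).
  intros i' Hi' k; destruct (H2 i' Hi') as [_ H]; apply (H k 1%nat); lia.
assert (Sp : forall i, dom i (gam a) -> chart_speed g i gam a = speed g gam a).
  intros i' Hi'; unfold speed; symmetry; apply chart_speed_trans; auto using chart_at_dom.
  apply (H2 i' Hi').
assert (E : forall i, dom i (gam a) -> forall k,
   cov_deriv g i gam (unit_tan i gam) k a =
   Derive (unit_tan i gam k) a - chart_speed g i gam a * Derive (velocity i c k) 0).
  intros i' Hi' k; generalize (Gc i' Hi' k); unfold cov_deriv, sum2.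
  rewrite Hc0, !(Hv0 i' Hi').
  set (d := Derive (unit_tan i' gam k) a); unfold unit_tan; rewrite <- (Sp i' Hi').
  set (s := chart_speed g i' gam a).
  assert (s0 : s <> 0) by (unfold s; rewrite (Sp i' Hi'), <- (Sp i Hi); auto).
  intros G.
  match type of G with ?e + ?q = 0 => replace e with (- q) by lra end.
  field; auto.
rewrite (E j Hj).
assert (Eloc : locally a (fun s => unit_tan j gam l s = push i j (gam s) (fun k => unit_tan i gam k s) l)).
  destruct (H2 i Hi) as [Li _]; destruct (H2 j Hj) as [Lj _].
  generalize (filter_and _ _ (filter_and _ _ Li Lj) (filter_and _ _ (locally_locally _ _ Li) H1)).
  apply filter_imp; intros s [[Di Dj] [Dl C1]].
  assert (Dd : forall k, ex_derive (curve_coord i gam k) s).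
    intros k; destruct (C1 i Di) as [_ H]; apply (H k 1%nat); lia.
  unfold unit_tan; rewrite (velocity_trans i j), (chart_speed_trans i j); auto.
  unfold push, sum2, Rdiv; ring.
rewrite (Derive_push i j gam a l (unit_tan i gam) (unit_tan j gam)); auto.
assert (Hci : dom i (c 0)) by now rewrite Hc0.
assert (Hcj : dom j (c 0)) by now rewrite Hc0.
assert (Rl : locally 0 (fun s => - r < s < r)).
  apply (filter_and (fun s => - r < s) (fun s => s < r)); [apply open_gt | apply open_lt]; lra.
assert (Cloc : locally 0 (fun s => velocity j c l s = push i j (c s) (fun k => velocity i c k s) l)).
  destruct (Cc i Hci) as [Li _]; destruct (Cc j Hcj) as [Lj _].
  generalize (filter_and _ _ (filter_and _ _ Li Lj) (filter_and _ _ (locally_locally _ _ Li) Rl)).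
  apply filter_imp; intros s [[Di Dj] [Dl C1]].
  apply velocity_trans; auto.
  intros k; destruct (Hgeo s C1) as [Cs _]; destruct (Cs i Di) as [_ H]; apply (H k 1%nat); lia.
rewrite (Derive_push i j c 0 l (velocity i c) (velocity j c)); auto.
2: { intros k; destruct (Cc i Hci) as [_ H]; apply (H k 1%nat); lia. }
2: { intros k; destruct (Cc i Hci) as [_ H]; apply (H k 2%nat); lia. }
(* The second derivatives of the transition occur for [gam] with coefficients [speed * T * T] and
   for [c] with [T * T] times the same speed, so they cancel. *)
rewrite Hc0, (Sp j Hj), <- (Sp i Hi).
unfold push, sum2; rewrite !(E i Hi), !(Hv0 i Hi), <- (Sp i Hi).
unfold unit_tan, sum2; field; auto.
Qed.

(** [geod_curvature] uses the chart selected at each point, which may jump along the curve. This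
    moves it to one fixed chart wherever a tangent geodesic is given. *)
Lemma geod_curvature_chart i (gam c : R -> S) a r : 0 < r ->
  tangent_geodesic g gam a r c -> dom i (gam a) ->
  curve_Cn 2 gam a -> locally a (fun s => curve_Cn 1 gam s) ->
  chart_speed g i gam a <> 0 ->
  (forall k, ex_derive (unit_tan i gam k) a) ->
  geod_curvature g gam a = chart_curv i gam a.
Proof.
intros r0 HT Hi H2 H1 Hs Hd; set (j := chart_at (gam a)).
assert (Hj : dom j (gam a)) by apply chart_at_dom.
change (geod_curvature g gam a) with (chart_curv j gam a); unfold chart_curv.
apply f_equal2.
- rewrite <- (chart_norm_push i j); auto; apply chart_norm_ext; intros l.
  now apply (cov_deriv_trans i j gam c a r).
- apply chart_speed_trans; auto; [apply (H2 i Hi) |].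
  intros k; destruct (H2 i Hi) as [_ H]; apply (H k 1%nat); lia.
Qed.

End Charts.

Lemma sum2_ext f h : (forall j, f j = h j) -> sum2 f = sum2 h.
Proof. intros H; unfold sum2; now rewrite !H. Qed.

Lemma quad_ext f h v w : (forall j k, f j k = h j k) -> quad f v w = quad h v w.
Proof. intros H; unfold quad, sum2; now rewrite !H. Qed.

(** * Metric and Christoffel symbols along curves *)

Section MetricIdentities.

Context {S : surface} (g : metric S) (i : chart S).

Definition met_at (x y : R) : bool -> bool -> R := fun j k => gc g i j k x y.
Definition dmet_at (l : bool) (x y : R) : bool -> bool -> R :=
  fun j k => partial l (gc g i j k) x y.
Definition chr_at (k : bool) (x y : R) : bool -> bool -> R :=
  fun a b => christoffel g i k a b x y.

Lemma gc_loc n x y j k : (n <= 3)%nat -> in_image i (x, y) ->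
  locally_2d (fun u v => ex_diff_n (gc g i j k) n u v) x y.
Proof.
intros le H; generalize (locally_in_image i x y H).
apply locally_2d_impl, locally_2d_forall; intros u v Huv.
apply (ex_diff_n_le _ 3); auto; now apply gc_C3.
Qed.

Lemma dmet_sym l x y j k : in_image i (x, y) -> dmet_at l x y j k = dmet_at l x y k j.
Proof.
intros H; unfold dmet_at, partial.
destruct (locally_in_image i x y H) as [eps He].
destruct l; apply Derive_ext_loc; exists eps; intros z Hz; apply gc_sym, He; auto;
rewrite Rminus_eq_0, Rabs_R0; apply cond_pos.
Qed.

Lemma gdet_pos x y : in_image i (x, y) -> 0 < gdet g i x y.
Proof.
intros H.
assert (P1 := gc_pos S g i x y (fun j => if j then 0 else 1) H).
(* For the matrix with rows (a, b) and (b, d), the vector (-b, a) has square [a (a d - b^2)]. *)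
assert (P2 := gc_pos S g i x y
  (fun j => if j then gc g i false false x y else - gc g i false true x y) H).
unfold quad, sum2 in P1, P2; simpl in P1, P2.
assert (E1 : 0 < gc g i false false x y).
  enough (0 < 1) as _; [| lra].
  assert (exists j : bool, (if j then 0 else 1) <> 0) by (exists false; simpl; lra).
  specialize (P1 H0); lra.
assert (E2 : exists j : bool,
   (if j then gc g i false false x y else - gc g i false true x y) <> 0) by (exists true; lra).
specialize (P2 E2); revert P2; unfold gdet; rewrite (gc_sym S g i x y true false H).
intros P2; apply Rmult_lt_reg_l with (1 := E1); lra.
Qed.

Lemma lower_christoffel x y l a b : in_image i (x, y) ->
  sum2 (fun k => met_at x y l k * chr_at k x y a b) =
  / 2 * (dmet_at a x y b l + dmet_at b x y a l - dmet_at l x y a b).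
Proof.
intros H; generalize (gdet_pos x y H); unfold met_at, chr_at, christoffel, ginv, sum2.
fold (dmet_at a x y b false) (dmet_at a x y b true).
fold (dmet_at b x y a false) (dmet_at b x y a true).
fold (dmet_at false x y a b) (dmet_at true x y a b).
unfold gdet; rewrite (gc_sym S g i x y true false H); intros D.
destruct l; simpl; rewrite ?(gc_sym S g i x y true false H); field; lra.
Qed.

Variables (x V : bool -> R -> R) (A : bool -> R) (s t : R).
Let px (u : R) := x false u.
Let py (u : R) := x true u.
Hypothesis Him : in_image i (px t, py t).
Hypothesis Hx : forall k, is_derive (x k) t (s * V k t).
Hypothesis HV : forall k, is_derive (V k) t
  (A k - s * quad (chr_at k (px t) (py t)) (vec V t) (vec V t)).

Lemma gc_curve_der j k : is_derive (fun u => met_at (px u) (py u) j k) t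
  (s * pair (fun m => dmet_at m (px t) (py t) j k) (vec V t)).
Proof.
eapply is_derive_eq; [apply (is_derive_comp_2d (gc g i j k) px py); [| apply Hx ..] |].
- apply gc_loc; auto.
- unfold pair, sum2, vec, dmet_at; ring.
Qed.

(** [A] is the covariant derivative of [V] along a curve with velocity [s * V]. Lowering the index
    makes Christoffel symbols of the first kind appear; on the symmetric pair [V], [V] they cancel
    the derivative of the metric along [V] and leave [/ 2] of its derivative in direction [k]. *)
Lemma cotangent_der k :
  is_derive (fun u => sum2 (fun l => met_at (px u) (py u) k l * V l u)) t
   (sum2 (fun l => met_at (px t) (py t) k l * A l)
     + s * (/ 2 * quad (dmet_at k (px t) (py t)) (vec V t) (vec V t))).
Proof.
eapply is_derive_eq.
  apply (is_derive_sum2 (fun l u => _ * V l u)); intros l; apply is_derive_mul; auto.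
  apply gc_curve_der.
assert (L := fun a b => lower_christoffel (px t) (py t) k a b Him).
assert (Y := fun l => dmet_sym l (px t) (py t) true false Him).
assert (Z : quad (fun a b => sum2 (fun l => met_at (px t) (py t) k l * chr_at l (px t) (py t) a b))
     (vec V t) (vec V t) =
   quad (fun a b => / 2 * (dmet_at a (px t) (py t) b k + dmet_at b (px t) (py t) a k
      - dmet_at k (px t) (py t) a b)) (vec V t) (vec V t)).
  apply quad_ext; intros a b; apply L.
assert (Y0 := Y false); assert (Y1 := Y true).
apply Rminus_diag_eq in Z; apply Rminus_diag_uniq.
match type of Z with ?z = 0 => transitivity (- s * z); [| rewrite Z; ring] end.
destruct k; unfold quad, pair, sum2, vec; rewrite ?Y0, ?Y1; field.
Qed.

(** Compatibility of the connection with the metric. With [A = 0] it gives the constant speed of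
    geodesics, and for the unit tangent of [gam] the orthogonality of [acc] and [utan]. *)
Lemma quad_met_der :
  is_derive (fun u => quad (met_at (px u) (py u)) (vec V u) (vec V u)) t
    (2 * quad (met_at (px t) (py t)) A (vec V t)).
Proof.
eapply is_derive_eq.
  apply (is_derive_quad (fun u => met_at (px u) (py u)) V V
    (fun j k => s * pair (fun m => dmet_at m (px t) (py t) j k) (vec V t)) _ _
    t gc_curve_der HV HV).
assert (L := fun k a b => lower_christoffel (px t) (py t) k a b Him).
assert (Y := fun l => dmet_sym l (px t) (py t) true false Him).
assert (Z : sum2 (fun k => V k t *
     quad (fun a b => sum2 (fun l => met_at (px t) (py t) k l * chr_at l (px t) (py t) a b))
     (vec V t) (vec V t)) = sum2 (fun k => V k t *
   quad (fun a b => / 2 * (dmet_at a (px t) (py t) b k + dmet_at b (px t) (py t) a k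
      - dmet_at k (px t) (py t) a b)) (vec V t) (vec V t))).
  apply sum2_ext; intros k; f_equal; apply quad_ext; intros a b; apply L.
assert (Y0 := Y false); assert (Y1 := Y true).
apply Rminus_diag_eq in Z; apply Rminus_diag_uniq.
match type of Z with ?z = 0 => transitivity (- 2 * s * z); [| rewrite Z; ring] end.
assert (E : met_at (px t) (py t) true false = met_at (px t) (py t) false true)
  by now apply gc_sym.
unfold quad, pair, sum2, vec; rewrite ?Y0, ?Y1, ?E; field.
Qed.

End MetricIdentities.

(** * Uniform bounds *)

(** The index runs over the metrics of the family. Being bounded and Lipschitz with a common
    constant is stable under the arithmetic of the formulas for Christoffel symbols, speed and
    curvature, which thus inherit uniform bounds. *)
Definition BL {I X : Type} (P : I -> Prop) (Q : X -> Prop) (dist : X -> X -> R)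
    (f : I -> X -> R) : Prop :=
  exists K, 0 <= K /\ forall i, P i ->
  (forall x, Q x -> Rabs (f i x) <= K) /\
  (forall x y, Q x -> Q y -> Rabs (f i y - f i x) <= K * dist x y).

Section BoundedLipschitz.

Context {I X : Type} {P : I -> Prop} {Q : X -> Prop} {dist : X -> X -> R}.
Hypothesis dist_pos : forall x y, 0 <= dist x y.

Local Notation BL := (BL P Q dist).

Lemma BL_ext f h : (forall i x, P i -> Q x -> f i x = h i x) -> BL f -> BL h.
Proof.
intros E [K [K0 H]]; exists K; split; auto; intros i Pi; destruct (H i Pi) as [H1 H2]; split.
- intros x Qx; rewrite <- E; auto.
- intros x y Qx Qy; rewrite <- !E; auto.
Qed.

Lemma BL_const c : BL (fun _ _ => c).
Proof.
exists (Rabs c); split; [apply Rabs_pos |]; intros i _; split; intros.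
- lra.
- rewrite Rminus_eq_0, Rabs_R0; apply Rmult_le_pos; auto; apply Rabs_pos.
Qed.

Lemma BL_plus f h : BL f -> BL h -> BL (fun i x => f i x + h i x).
Proof.
intros [K [K0 H]] [L [L0 J]]; exists (K + L); split; [lra |]; intros i Pi.
destruct (H i Pi) as [H1 H2]; destruct (J i Pi) as [J1 J2]; split.
- intros x Qx; generalize (H1 x Qx) (J1 x Qx) (Rabs_triang (f i x) (h i x)); lra.
- intros x y Qx Qy; generalize (H2 x y Qx Qy) (J2 x y Qx Qy).
  generalize (Rabs_triang (f i y - f i x) (h i y - h i x)).
  replace (f i y + h i y - (f i x + h i x)) with (f i y - f i x + (h i y - h i x)) by ring.
  lra.
Qed.

Lemma BL_mult f h : BL f -> BL h -> BL (fun i x => f i x * h i x).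
Proof.
intros [K [K0 H]] [L [L0 J]]; exists (K * L + 2 * (K * L)).
assert (KL : 0 <= K * L) by now apply Rmult_le_pos.
split; [lra |]; intros i Pi.
destruct (H i Pi) as [H1 H2]; destruct (J i Pi) as [J1 J2]; split.
- intros x Qx; rewrite Rabs_mult.
  apply Rle_trans with (K * L); [| lra].
  apply Rmult_le_compat; auto using Rabs_pos.
- intros x y Qx Qy.
  replace (f i y * h i y - f i x * h i x) with
    ((f i y - f i x) * h i y + f i x * (h i y - h i x)) by ring.
  eapply Rle_trans; [apply Rabs_triang |]; rewrite !Rabs_mult.
  apply Rle_trans with ((K * dist x y) * L + K * (L * dist x y)).
    apply Rplus_le_compat; apply Rmult_le_compat; auto using Rabs_pos.
  generalize (Rmult_le_pos _ _ KL (dist_pos x y)); lra.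
Qed.

Lemma BL_opp f : BL f -> BL (fun i x => - f i x).
Proof.
intros H; apply (BL_ext (fun i x => -1 * f i x)); [intros; ring |].
apply BL_mult; auto; apply BL_const.
Qed.

Lemma BL_minus f h : BL f -> BL h -> BL (fun i x => f i x - h i x).
Proof. intros Hf Hh; apply BL_plus; auto; now apply BL_opp. Qed.

Lemma BL_inv f c : 0 < c -> (forall i x, P i -> Q x -> c <= f i x) -> BL f ->
  BL (fun i x => / f i x).
Proof.
intros c0 Hc [K [K0 H]]; exists (/ c + K * (/ c * / c)).
assert (c1 := Rinv_0_lt_compat _ c0).
assert (KC : 0 <= K * (/ c * / c)) by (repeat apply Rmult_le_pos; lra).
split; [lra |]; intros i Pi.
assert (B : forall x, Q x -> 0 < / f i x <= / c).
  intros x Qx; generalize (Hc i x Pi Qx); intros Hx; split.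
  - apply Rinv_0_lt_compat; lra.
  - apply Rinv_le_contravar; lra.
destruct (H i Pi) as [_ H2]; split.
- intros x Qx; destruct (B x Qx); rewrite Rabs_pos_eq; lra.
- intros x y Qx Qy; destruct (B x Qx); destruct (B y Qy).
  assert (fx := Hc i x Pi Qx); assert (fy := Hc i y Pi Qy).
  replace (/ f i y - / f i x) with (- (f i y - f i x) * (/ f i x * / f i y)) by (field; lra).
  rewrite Rabs_mult, Rabs_Ropp, (Rabs_pos_eq (/ f i x * / f i y)) by (apply Rmult_le_pos; lra).
  apply Rle_trans with ((K * dist x y) * (/ c * / c)).
    apply Rmult_le_compat; auto using Rabs_pos; [apply Rmult_le_pos; lra |].
    apply Rmult_le_compat; lra.
  generalize (Rmult_le_pos (/ c) _ (Rlt_le _ _ c1) (dist_pos x y)); lra.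
Qed.

Lemma BL_sqrt f c : 0 < c -> (forall i x, P i -> Q x -> c <= f i x) -> BL f ->
  BL (fun i x => sqrt (f i x)).
Proof.
intros c0 Hc [K [K0 H]]; exists (sqrt K + K * / sqrt c).
assert (s0 := sqrt_lt_R0 _ c0); assert (s1 := Rinv_0_lt_compat _ s0).
assert (sK := sqrt_pos K).
assert (KC : 0 <= K * / sqrt c) by (apply Rmult_le_pos; lra).
split; [lra |]; intros i Pi.
destruct (H i Pi) as [H1 H2]; split.
- intros x Qx; rewrite Rabs_pos_eq by apply sqrt_pos.
  apply Rle_trans with (sqrt K); [| lra].
  apply sqrt_le_1_alt; generalize (H1 x Qx) (RRle_abs (f i x)); lra.
- intros x y Qx Qy.
  assert (fx := Hc i x Pi Qx); assert (fy := Hc i y Pi Qy).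
  assert (sx := sqrt_le_1_alt _ _ fx); assert (sy := sqrt_le_1_alt _ _ fy).
  replace (sqrt (f i y) - sqrt (f i x)) with
     ((f i y - f i x) * / (sqrt (f i y) + sqrt (f i x))).
  2: { rewrite <- (sqrt_sqrt (f i y)), <- (sqrt_sqrt (f i x)) at 1 by lra; field; lra. }
  assert (0 < / (sqrt (f i y) + sqrt (f i x))) by (apply Rinv_0_lt_compat; lra).
  rewrite Rabs_mult, (Rabs_pos_eq (/ _)) by lra.
  apply Rle_trans with ((K * dist x y) * (/ sqrt c)).
    apply Rmult_le_compat; auto using Rabs_pos; [lra |].
    apply Rinv_le_contravar; lra.
  generalize (Rmult_le_pos _ _ sK (dist_pos x y)); lra.
Qed.

Lemma BL_sum2 f : (forall j, BL (f j)) -> BL (fun i x => sum2 (fun j => f j i x)).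
Proof. intros H; unfold sum2; apply BL_plus; apply H. Qed.

Lemma BL_quad g v w : (forall j k, BL (fun i x => g i x j k)) ->
  (forall j, BL (fun i x => v i x j)) -> (forall j, BL (fun i x => w i x j)) ->
  BL (fun i x => quad (g i x) (v i x) (w i x)).
Proof.
intros Hg Hv Hw; unfold quad.
apply (BL_sum2 (fun j i x => sum2 (fun k => g i x j k * v i x j * w i x k))); intros j.
apply (BL_sum2 (fun k i x => g i x j k * v i x j * w i x k)); intros k.
apply BL_mult; auto; now apply BL_mult.
Qed.

Lemma BL_bound f : BL f -> exists K0, forall K, K0 <= K ->
  forall i x, P i -> Q x -> Rabs (f i x) <= K.
Proof.
intros [K0 [_ H]]; exists K0; intros K le i x Pi Qx.
apply Rle_trans with (2 := le); now apply (H i Pi).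
Qed.

Lemma BL_lip f : BL f -> exists K0, forall K, K0 <= K ->
  forall i x y, P i -> Q x -> Q y -> Rabs (f i y - f i x) <= K * dist x y.
Proof.
intros [K0 [_ H]]; exists K0; intros K le i x y Pi Qx Qy.
destruct (H i Pi) as [_ H2]; apply Rle_trans with (1 := H2 x y Qx Qy).
apply Rmult_le_compat_r; auto.
Qed.

End BoundedLipschitz.

Lemma BL_comp {I X Y : Type} (P : I -> Prop) (Q : X -> Prop) (dist : X -> X -> R)
    (Q' : Y -> Prop) (dist' : Y -> Y -> R) (h : Y -> X) (L : R) (f : I -> X -> R) :
  (forall y, Q' y -> Q (h y)) -> 0 <= L ->
  (forall y y', 0 <= dist' y y') ->
  (forall y y', Q' y -> Q' y' -> dist (h y) (h y') <= L * dist' y y') ->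
  BL P Q dist f -> BL P Q' dist' (fun i y => f i (h y)).
Proof.
intros Hh L0 d0 HL [K [K0 H]]; exists (K + K * L).
assert (KL : 0 <= K * L) by now apply Rmult_le_pos.
split; [lra |]; intros i Pi; destruct (H i Pi) as [H1 H2]; split.
- intros y Qy; generalize (H1 (h y) (Hh y Qy)); lra.
- intros y y' Qy Qy'; apply Rle_trans with (1 := H2 _ _ (Hh _ Qy) (Hh _ Qy')).
  apply Rle_trans with (K * (L * dist' y y')); [now apply Rmult_le_compat_l; auto |].
  generalize (Rmult_le_pos _ _ K0 (d0 y y')); lra.
Qed.

(** Finitely many bounds of this kind can share one constant, as [arc_ok] and [geo_ok] require. *)
Definition large (Q : R -> Prop) : Prop := exists K0, forall K, K0 <= K -> Q K.

Lemma large_and (Q Q' : R -> Prop) : large Q -> large Q' -> large (fun K => Q K /\ Q' K).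
Proof.
intros [K H] [L J]; exists (Rmax K L); intros N HN; split.
- apply H, Rle_trans with (2 := HN), Rmax_l.
- apply J, Rle_trans with (2 := HN), Rmax_r.
Qed.

Lemma large_bool (Q : bool -> R -> Prop) : (forall b, large (Q b)) ->
  large (fun K => forall b, Q b K).
Proof.
intros H; destruct (large_and _ _ (H false) (H true)) as [K HK].
exists K; intros N HN; destruct (HK N HN); intros [|]; auto.
Qed.

Lemma large_impl (Q Q' : R -> Prop) : (forall K, Q K -> Q' K) -> large Q -> large Q'.
Proof. intros H [K HK]; exists K; auto. Qed.

(** * Bounds for the metrics on a box of a chart *)

Definition near (z : R * R) (rho : R) (p : R * R) : Prop :=
  Rabs (fst p - fst z) <= rho /\ Rabs (snd p - snd z) <= rho.

Definition dist2 (p q : R * R) : R := Rabs (fst q - fst p) + Rabs (snd q - snd p).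

Lemma dist2_pos p q : 0 <= dist2 p q.
Proof.
unfold dist2; generalize (Rabs_pos (fst q - fst p)) (Rabs_pos (snd q - snd p)); lra.
Qed.

Lemma Rabs_between c r x : Rabs (x - c) <= r <-> c - r <= x <= c + r.
Proof. rewrite Rabs_le_between; split; lra. Qed.

Lemma near_between z rho x y u v s t :
  near z rho (x, y) -> near z rho (u, v) ->
  Rmin x u <= s <= Rmax x u -> Rmin y v <= t <= Rmax y v -> near z rho (s, t).
Proof.
unfold near; simpl; rewrite !Rabs_between; intros [H1 H2] [H3 H4] H5 H6; split.
- apply (between_in _ _ x u); auto.
- apply (between_in _ _ y v); auto.
Qed.

Lemma between_l x y : Rmin x y <= x <= Rmax x y.
Proof. split; [apply Rmin_l | apply Rmax_l]. Qed.

Lemma between_r x y : Rmin x y <= y <= Rmax x y.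
Proof. split; [apply Rmin_r | apply Rmax_r]. Qed.

(** The path turns at the corner [(x, v)], so the mean value theorem is applied to one variable at a
    time and its points remain in the box. *)
Lemma MVT_box f z rho x y u v :
  (forall p, near z rho p -> ex_derive (fun s => f s (snd p)) (fst p) /\
     ex_derive (fun t => f (fst p) t) (snd p)) ->
  near z rho (x, y) -> near z rho (u, v) ->
  exists s t, Rabs (s - x) <= Rabs (u - x) /\ Rabs (t - y) <= Rabs (v - y) /\
    near z rho (s, v) /\ near z rho (x, t) /\
    f u v - f x y = partial false f s v * (u - x) + partial true f x t * (v - y).
Proof.
intros Hd N1 N2.
destruct (MVT_is_derive (fun s => f s v) (fun s => partial false f s v) x u) as [s [Hs Es]].
  intros s Hs; assert (Ns : near z rho (s, v)).
    apply (near_between z rho x y u v); auto; apply between_r.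
  apply Derive_correct, (Hd _ Ns).
destruct (MVT_is_derive (fun t => f x t) (fun t => partial true f x t) y v) as [t [Ht Et]].
  intros t Ht; assert (Nt : near z rho (x, t)).
    apply (near_between z rho x y u v); auto; apply between_l.
  apply Derive_correct, (Hd _ Nt).
exists s, t; split; [now apply between_Rabs |]; split; [now apply between_Rabs |].
split; [apply (near_between z rho x y u v); auto; apply between_r |].
split; [apply (near_between z rho x y u v); auto; apply between_l |].
rewrite <- Es, <- Et; ring.
Qed.

Lemma Lipschitz_box f z rho K :
  (forall p, near z rho p -> ex_derive (fun s => f s (snd p)) (fst p) /\
     ex_derive (fun t => f (fst p) t) (snd p)) ->
  (forall p l, near z rho p -> Rabs (partial l f (fst p) (snd p)) <= K) ->
  forall p q, near z rho p -> near z rho q ->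
    Rabs (f (fst q) (snd q) - f (fst p) (snd p)) <= K * dist2 p q.
Proof.
intros Hd HK [x y] [u v] Np Nq; unfold dist2; simpl.
destruct (MVT_box f z rho x y u v Hd Np Nq) as [s [t [_ [_ [N1 [N2 ->]]]]]].
eapply Rle_trans; [apply Rabs_triang |]; rewrite !Rabs_mult, Rmult_plus_distr_l.
apply Rplus_le_compat; (apply Rmult_le_compat_r; [apply Rabs_pos |]).
- apply (HK (s, v) false N1).
- apply (HK (x, t) true N2).
Qed.

Section BoxBounds.

Context {S : surface} (M : metric S -> Prop) (i : chart S) (z : R * R) (rho : R).

Record box_bounds (K c : R) : Prop := {
  bb_c : 0 < c;
  bb_im : forall p, near z rho p -> in_image i p;
  bb_der : forall g p j k m n, M g -> near z rho p -> (m + n <= 2)%nat ->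
    Rabs (partial_derive m n (gc g i j k) (fst p) (snd p)) <= K;
  bb_ell : forall g p v, M g -> near z rho p ->
    c * (v false ^ 2 + v true ^ 2) <= quad (met_at g i (fst p) (snd p)) v v
}.

Variables K c : R.
Hypothesis H : box_bounds K c.

Notation BLbox := (BL M (near z rho) dist2).

Lemma gc_smooth (g : metric S) p j k n : (n <= 3)%nat -> near z rho p ->
  ex_diff_n (gc g i j k) n (fst p) (snd p).
Proof.
intros le N; apply (ex_diff_n_le _ 3); auto; apply gc_C3.
rewrite <- surjective_pairing; now apply (bb_im K c H).
Qed.

Lemma dgc_ex (g : metric S) p j k l : near z rho p ->
  ex_derive (fun s => partial l (gc g i j k) s (snd p)) (fst p) /\
  ex_derive (fun t => partial l (gc g i j k) (fst p) t) (snd p).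
Proof.
intros N; generalize (ex_diff_n_partial _ 1 l _ _ (gc_smooth g p j k 2 ltac:(lia) N)).
intros [_ [H1 [H2 _]]]; auto.
Qed.

Lemma gc_ex (g : metric S) p j k : near z rho p ->
  ex_derive (fun s => gc g i j k s (snd p)) (fst p) /\
  ex_derive (fun t => gc g i j k (fst p) t) (snd p).
Proof.
intros N; generalize (gc_smooth g p j k 1 ltac:(lia) N).
intros [_ [H1 [H2 _]]]; auto.
Qed.

Lemma dgc_bound g p j k l : M g -> near z rho p ->
  Rabs (partial l (gc g i j k) (fst p) (snd p)) <= K.
Proof.
intros Mg N; destruct l.
- apply (bb_der K c H g p j k 0 1); auto.
- apply (bb_der K c H g p j k 1 0); auto.
Qed.

(** [partial_derive] takes the derivatives in one order only; Schwarz's theorem carries the bound on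
    the mixed derivative over to the other order. *)
Lemma partial_comm (g : metric S) p j k : near z rho p ->
  partial true (partial false (gc g i j k)) (fst p) (snd p) =
  partial false (partial true (gc g i j k)) (fst p) (snd p).
Proof.
intros N; symmetry; apply Schwarz.
- assert (N' : in_image i (fst p, snd p)).
    rewrite <- surjective_pairing; now apply (bb_im K c H).
  generalize (gc_loc g i 2 (fst p) (snd p) j k ltac:(lia) N').
  apply locally_2d_impl, locally_2d_forall; intros u v.
  intros [_ [H1 [H2 [[_ [_ [H3 _]]] [_ [H4 _]]]]]]; auto.
- apply (ex_diff_n_partial (partial true (gc g i j k)) 0 false).
  apply (ex_diff_n_partial (gc g i j k) 1 true); apply gc_smooth; [lia | auto].
- apply (ex_diff_n_partial (partial false (gc g i j k)) 0 true).
  apply (ex_diff_n_partial (gc g i j k) 1 false); apply gc_smooth; [lia | auto].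
Qed.

Lemma ddgc_bound g p j k l m : M g -> near z rho p ->
  Rabs (partial m (partial l (gc g i j k)) (fst p) (snd p)) <= K.
Proof.
intros Mg N; destruct l; destruct m.
- apply (bb_der K c H g p j k 0 2); auto.
- apply (bb_der K c H g p j k 1 1); auto.
- rewrite partial_comm; auto; apply (bb_der K c H g p j k 1 1); auto.
- apply (bb_der K c H g p j k 2 0); auto.
Qed.

Lemma BL_of_bounds (f : metric S -> R -> R -> R) :
  (forall g p, M g -> near z rho p -> Rabs (f g (fst p) (snd p)) <= K) ->
  (forall g p, M g -> near z rho p -> ex_derive (fun s => f g s (snd p)) (fst p) /\
     ex_derive (fun t => f g (fst p) t) (snd p)) ->
  (forall g p l, M g -> near z rho p -> Rabs (partial l (f g) (fst p) (snd p)) <= K) ->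
  BLbox (fun g p => f g (fst p) (snd p)).
Proof.
intros H1 H2 H3; exists (Rabs K); split; [apply Rabs_pos |]; intros g Mg; split.
- intros p Np; apply Rle_trans with (1 := H1 g p Mg Np), RRle_abs.
- apply Lipschitz_box; auto.
  intros p l Np; apply Rle_trans with (1 := H3 g p l Mg Np), RRle_abs.
Qed.

Lemma BL_met j k : BLbox (fun g p => met_at g i (fst p) (snd p) j k).
Proof.
apply (BL_of_bounds (fun g => gc g i j k)).
- intros g p Mg Np; apply (bb_der K c H g p j k 0 0); auto.
- intros g p _ Np; now apply gc_ex.
- intros g p l Mg Np; now apply dgc_bound.
Qed.

Lemma BL_dmet l j k : BLbox (fun g p => dmet_at g i l (fst p) (snd p) j k).
Proof.
apply (BL_of_bounds (fun g => partial l (gc g i j k))).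
- intros g p Mg Np; now apply dgc_bound.
- intros g p _ Np; now apply dgc_ex.
- intros g p m Mg Np; now apply ddgc_bound.
Qed.

Lemma gdet_ge g p : M g -> near z rho p -> c * c <= gdet g i (fst p) (snd p).
Proof.
intros Mg Np; destruct H as [c0 Him Hd He].
assert (Np' : in_image i (fst p, snd p)) by (rewrite <- surjective_pairing; auto).
generalize (He g p (fun j => if j then 0 else 1) Mg Np).
(* With the vectors (1, 0) and (-b, a), ellipticity gives [c <= a] and [c a^2 <= a det], hence
   [det >= c a >= c^2]. *)
generalize (He g p (fun j => if j then met_at g i (fst p) (snd p) false false
   else - met_at g i (fst p) (snd p) false true) Mg Np).
unfold quad, sum2, gdet, met_at; rewrite (gc_sym S g i _ _ true false Np').
set (a := gc g i false false (fst p) (snd p)); set (b := gc g i false true (fst p) (snd p)).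
set (d := gc g i true true (fst p) (snd p)); simpl.
intros H1 H2; assert (a0 : c <= a) by lra.
assert (b0 := Rle_0_sqr b); unfold Rsqr in b0.
assert (b1 := Rmult_le_pos _ _ (Rlt_le _ _ c0) b0).
apply Rmult_le_reg_l with a; [lra |].
assert (c * (a * a) <= a * (a * d - b * b)) by lra.
assert (a * (c * c) <= a * (c * a)); [| lra].
apply Rmult_le_compat_l; [lra |]; apply Rmult_le_compat_l; lra.
Qed.

Lemma BL_ginv j k : BLbox (fun g p => ginv g i j k (fst p) (snd p)).
Proof.
unfold ginv, Rdiv; apply (BL_mult dist2_pos).
- destruct (Bool.eqb j k); [apply BL_met | apply (BL_opp dist2_pos), BL_met].
- apply (BL_inv dist2_pos _ (c * c)).
  + generalize (bb_c K c H); intros; now apply Rmult_lt_0_compat.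
  + intros g p; apply gdet_ge.
  + unfold gdet; apply (BL_minus dist2_pos); apply (BL_mult dist2_pos); apply BL_met.
Qed.

Lemma BL_chr k a b : BLbox (fun g p => chr_at g i k (fst p) (snd p) a b).
Proof.
unfold chr_at, christoffel.
apply (BL_mult dist2_pos (fun _ _ => / 2)); [apply (BL_const dist2_pos) |].
apply (BL_sum2 (fun l g p => _)); intros l.
apply (BL_mult dist2_pos); [apply BL_ginv |].
apply (BL_minus dist2_pos); [apply BL_plus |]; apply BL_dmet.
Qed.

Lemma unit_bound : large (fun N => forall g p v, M g -> near z rho p ->
  quad (met_at g i (fst p) (snd p)) v v = 1 -> forall k, Rabs (v k) <= N).
Proof.
exists (1 + / c); intros N HN g p v Mg Np Hv k.
generalize (bb_ell K c H g p v Mg Np) (bb_c K c H); rewrite Hv; intros H1 c0.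
assert (c1 := Rinv_0_lt_compat _ c0).
assert (H2 : v k ^ 2 <= / c).
  apply Rmult_le_reg_l with c; auto; rewrite Rinv_r by lra.
  apply Rle_trans with (2 := H1); apply Rmult_le_compat_l; [lra |].
  generalize (pow2_ge_0 (v false)) (pow2_ge_0 (v true)); destruct k; lra.
apply Rle_trans with (2 := HN); apply Rabs_le.
destruct (Rle_dec (v k) 0); split; nra.
Qed.

(** The increment is given by first derivatives at intermediate points, and these are Lipschitz;
    bounds on second derivatives suffice. *)
Lemma taylor_bound : large (fun N => forall g p q j k, M g -> near z rho p -> near z rho q ->
  Rabs (met_at g i (fst q) (snd q) j k - met_at g i (fst p) (snd p) j k
    - pair (fun l => dmet_at g i l (fst p) (snd p) j k)
        (fun l => proj l q - proj l p)) <= N * dist2 p q ^ 2).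
Proof.
apply (large_impl (fun N => forall l j k g p q, M g -> near z rho p -> near z rho q ->
  Rabs (dmet_at g i l (fst q) (snd q) j k - dmet_at g i l (fst p) (snd p) j k) <= N * dist2 p q)).
- intros N HN g [x y] [u v] j k Mg Np Nq.
  unfold met_at; simpl fst; simpl snd.
  destruct (MVT_box (gc g i j k) z rho x y u v) as [s [t [Hs [Ht [N1 [N2 ->]]]]]]; auto.
    intros p N'; now apply gc_ex.
  unfold pair, sum2, dmet_at, dist2; cbn [fst snd proj].
  generalize (HN false j k g (x, y) (s, v) Mg Np N1) (HN true j k g (x, y) (x, t) Mg Np N2).
  unfold dmet_at, dist2; cbn [fst snd]; rewrite Rminus_eq_0, Rabs_R0.
  set (A := partial false (gc g i j k)); set (B := partial true (gc g i j k)).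
  intros H1 H2.
  replace (A s v * (u - x) + B x t * (v - y) - (A x y * (u - x) + B x y * (v - y)))
    with ((A s v - A x y) * (u - x) + (B x t - B x y) * (v - y)) by ring.
  eapply Rle_trans; [apply Rabs_triang |]; rewrite !Rabs_mult.
  assert (X0 := Rabs_pos (u - x)); assert (Y0 := Rabs_pos (v - y)).
  assert (S0 := Rabs_pos (s - x)); assert (T0 := Rabs_pos (t - y)).
  assert (N0 : 0 <= N \/ N < 0) by lra.
  destruct N0 as [N0 | N0].
  + assert (H3 : Rabs (A s v - A x y) <= N * (Rabs (u - x) + Rabs (v - y))).
      apply Rle_trans with (1 := H1), Rmult_le_compat_l; lra.
    assert (H4 : Rabs (B x t - B x y) <= N * (Rabs (u - x) + Rabs (v - y))).
      apply Rle_trans with (1 := H2), Rmult_le_compat_l; lra.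
    apply Rle_trans with (N * (Rabs (u - x) + Rabs (v - y)) * Rabs (u - x)
        + N * (Rabs (u - x) + Rabs (v - y)) * Rabs (v - y)); [| right; ring].
    apply Rplus_le_compat; apply Rmult_le_compat_r; auto.
  (* A negative [N] can only satisfy the Lipschitz bounds between equal points, where the claim is
     trivial. *)
  + assert (H5 := HN false j k g (x, y) (u, v) Mg Np Nq).
    assert (H6 := Rle_trans _ _ _ (Rabs_pos _) H5).
    unfold dist2 in H6; simpl in H6.
    assert (Z : Rabs (u - x) + Rabs (v - y) <= 0) by nra.
    assert (Z1 : Rabs (u - x) = 0) by lra; assert (Z2 : Rabs (v - y) = 0) by lra.
    rewrite Z1, Z2; lra.
- apply large_bool; intros l; apply large_bool; intros j; apply large_bool; intros k.
  destruct (BL_lip dist2_pos _ (BL_dmet l j k)) as [K0 HK0].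
  exists K0; intros N HN g p q; now apply HK0.
Qed.

End BoxBounds.

(** * Short geodesics *)

Section Confinement.

Context {S : surface}.

Lemma coord_inj (i : chart S) (p q : S) : dom i p -> dom i q -> coord i p = coord i q -> p = q.
Proof. intros H1 H2 E; rewrite <- (paramK S i p), <- (paramK S i q), E; auto. Qed.

Lemma lim_seq_open (D : R * R -> Prop) (z : R * R) (u v : nat -> R) :
  open D -> D z -> is_lim_seq u (fst z) -> is_lim_seq v (snd z) ->
  eventually (fun n => D (u n, v n)).
Proof.
intros HD Dz Hu Hv; destruct (HD z Dz) as [eps He].
apply (filter_imp (fun n => ball (fst z) eps (u n) /\ ball (snd z) eps (v n))).
- intros n [H1 H2]; apply He; split; auto.
- apply filter_and; [apply Hu | apply Hv]; apply locally_ball.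
Qed.

(** The place where the surface must be Hausdorff: otherwise the points [c (s n)] could converge
    both to [c e] and to another point with coordinates [z]. *)
Lemma chart_limit (i : chart S) (c : R -> S) (e : R) (s : nat -> R) (z : R * R) :
  curve_Cn 0 c e -> is_lim_seq s e -> (forall n, dom i (c (s n))) ->
  is_lim_seq (fun n => fst (coord i (c (s n)))) (fst z) ->
  is_lim_seq (fun n => snd (coord i (c (s n)))) (snd z) -> in_image i z ->
  dom i (c e) /\ coord i (c e) = z.
Proof.
intros Hc Hs Hd H1 H2 [p [Dp Ep]].
enough (c e = p) as -> by auto.
destruct (classic (c e = p)) as [E | NE]; auto; exfalso.
destruct (hausdorff S (c e) p NE) as [U [V [HU [HV [Ue [Vp Dis]]]]]].
assert (EV : eventually (fun n => V (c (s n)))).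
  assert (J := lim_seq_open _ z _ _ (HV i) (ex_intro _ p (conj Dp (conj Vp Ep))) H1 H2).
  revert J; apply filter_imp; intros n [q [Dq [Vq Eq]]].
  rewrite <- surjective_pairing in Eq; now rewrite <- (coord_inj i q (c (s n))).
set (j := chart_at (c e)).
destruct (Hc j (chart_at_dom S (c e))) as [Lj Cj].
assert (L1 : eventually (fun n => dom j (c (s n)))) by apply (Hs _ Lj).
assert (Cl : forall k, is_lim_seq (fun n => curve_coord j c k (s n)) (curve_coord j c k e)).
  intros k; destruct (Cj k 0%nat ltac:(lia)) as [_ Ck]; intros P HP; apply (Hs _ (Ck P HP)).
assert (J := lim_seq_open _ (coord j (c e)) _ _ (HU j)
   (ex_intro _ (c e) (conj (chart_at_dom S (c e)) (conj Ue eq_refl))) (Cl false) (Cl true)).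
destruct (filter_ex _ (filter_and _ _ EV (filter_and _ _ L1 J))) as [n [Vn [Dn [q [Dq [Uq Eq]]]]]].
apply (Dis (c (s n))); split; auto.
unfold curve_coord, proj in Eq; rewrite <- surjective_pairing in Eq.
now rewrite <- (coord_inj j q (c (s n))).
Qed.

Lemma curve_Cn_le n m (c : R -> S) t : (m <= n)%nat -> curve_Cn n c t -> curve_Cn m c t.
Proof.
intros le H j Dj; destruct (H j Dj) as [H1 H2]; split; auto.
intros l k Hk; apply H2; lia.
Qed.

Variables (M : metric S -> Prop) (i : chart S) (z : R * R) (rho K c : R).
Hypothesis HB : box_bounds M i z rho K c.
Variables (g : metric S) (c0 : R -> S) (r V : R).
Hypothesis r0 : 0 < r.
Hypothesis Hgeo : geodesic g c0 r.
Hypothesis HV : forall p v, near z rho p ->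
  quad (met_at g i (fst p) (snd p)) v v = 1 -> forall k, Rabs (v k) <= V.

Definition inside (t : R) : Prop := dom i (c0 t) /\ near z rho (coord i (c0 t)).

Definition gvel (k : bool) (t : R) : R := velocity i c0 k t.
Definition gnorm (t : R) : R :=
  quad (met_at g i (fst (coord i (c0 t))) (snd (coord i (c0 t)))) (vec gvel t) (vec gvel t).

Hypothesis Hin0 : dom i (c0 0) /\ near z (rho / 2) (coord i (c0 0)).
Hypothesis Hunit0 : gnorm 0 = 1.
Hypothesis HVr : V * r <= rho / 4.

Lemma gpos_vel t k : - r < t < r -> inside t ->
  is_derive (curve_coord i c0 k) t (gvel k t).
Proof.
intros Ht [Dt _]; destruct (Hgeo t Ht) as [C _]; destruct (C i Dt) as [_ J].
apply Derive_correct, (J k 1%nat); lia.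
Qed.

Lemma gvel_der t k : - r < t < r -> inside t -> is_derive (gvel k) t
  (- quad (chr_at g i k (fst (coord i (c0 t))) (snd (coord i (c0 t)))) (vec gvel t) (vec gvel t)).
Proof.
intros Ht [Dt _]; destruct (Hgeo t Ht) as [C G]; destruct (C i Dt) as [_ J].
replace (- _) with (Derive (gvel k) t).
- apply Derive_correct, (J k 2%nat); lia.
- generalize (G i Dt k); unfold cov_deriv.
  change (Derive (velocity i c0 k) t) with (Derive (gvel k) t).
  unfold quad, sum2, vec, chr_at, gvel; lra.
Qed.

Lemma inside_image t : inside t -> in_image i (curve_coord i c0 false t, curve_coord i c0 true t).
Proof.
intros [Dt _]; exists (c0 t); split; auto.
unfold curve_coord, proj; now destruct (coord i (c0 t)).
Qed.

Lemma gnorm_der t : - r < t < r -> inside t -> is_derive gnorm t 0.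
Proof.
intros Ht It.
assert (J := quad_met_der g i (curve_coord i c0) gvel (fun _ => 0) 1 t (inside_image t It)).
replace 0 with (2 * quad (met_at g i (curve_coord i c0 false t) (curve_coord i c0 true t))
   (fun _ => 0) (vec gvel t)) by (unfold quad, sum2; ring).
apply J.
- intros k; rewrite Rmult_1_l; now apply gpos_vel.
- intros k; rewrite Rmult_1_l, Rminus_0_l; now apply gvel_der.
Qed.

Lemma inside_unit u : 0 <= u < r -> (forall s, Rabs s <= u -> inside s) ->
  forall s, Rabs s <= u -> gnorm s = 1.
Proof.
intros Hu Hin s Hs.
destruct (MVT_is_derive gnorm (fun _ => 0) 0 s) as [x [_ Hx]]; [| lra].
intros x Hx; apply between_Rabs in Hx; rewrite !Rminus_0_r in Hx.
assert (Hx' : Rabs x <= u) by lra.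
apply gnorm_der; auto; apply Rabs_le_between in Hx'; lra.
Qed.

Lemma inside_lip u : 0 <= u < r -> (forall s, Rabs s <= u -> inside s) ->
  forall k s t, Rabs s <= u -> Rabs t <= u ->
  Rabs (curve_coord i c0 k t - curve_coord i c0 k s) <= V * Rabs (t - s).
Proof.
intros Hu Hin k s t Hs Ht; apply Rabs_le_between in Hs; apply Rabs_le_between in Ht.
apply (MVT_Lipschitz _ (gvel k) (- u) u); auto.
- intros x Hx; apply gpos_vel; [lra | now apply Hin, Rabs_le].
- intros x Hx; assert (Ix : inside x) by now apply Hin, Rabs_le.
  apply (HV _ (vec gvel x) (proj2 Ix)), (inside_unit u); auto; now apply Rabs_le.
Qed.

Lemma V_pos : 0 <= V.
Proof.
assert (N0 : near z rho (coord i (c0 0))).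
  destruct Hin0 as [_ [H1 H2]]; generalize (Rabs_pos (fst (coord i (c0 0)) - fst z)).
  unfold near; lra.
exact (Rle_trans _ _ _ (Rabs_pos _) (HV _ (vec gvel 0) N0 Hunit0 false)).
Qed.

Lemma rho_nonneg : 0 <= rho.
Proof.
destruct Hin0 as [_ [H1 _]]; generalize (Rabs_pos (fst (coord i (c0 0)) - fst z)); lra.
Qed.

(** The start is within [rho / 2] of the centre, and unit speed moves each coordinate by at most
    [V * r <= rho / 4]. The last quarter of the box is the margin for continuing. *)
Lemma inside_near u : 0 <= u < r -> (forall s, Rabs s <= u -> inside s) ->
  forall s, Rabs s <= u -> near z (3 * rho / 4) (coord i (c0 s)).
Proof.
intros Hu Hin s Hs.
assert (J : forall k, Rabs (curve_coord i c0 k s - curve_coord i c0 k 0) <= rho / 4).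
  intros k; eapply Rle_trans; [apply (inside_lip u Hu Hin k 0 s) |].
  - rewrite Rabs_R0; lra.
  - auto.
  - apply Rle_trans with (2 := HVr), Rmult_le_compat_l; [apply V_pos |].
    rewrite Rminus_0_r; lra.
generalize (J false) (J true); destruct Hin0 as [_ [H1 H2]]; unfold curve_coord, proj, near.
intros J1 J2; rewrite !Rabs_between in *; lra.
Qed.

Lemma locally_inside t : - r < t < r -> 0 < rho -> dom i (c0 t) ->
  near z (3 * rho / 4) (coord i (c0 t)) -> locally t inside.
Proof.
intros Ht rp Dt Nt; destruct (Hgeo t Ht) as [C _]; destruct (C i Dt) as [L J].
assert (q : 0 < rho / 4) by lra.
assert (L0 : locally t (fun s => Rabs (fst (coord i (c0 s)) - fst (coord i (c0 t))) < rho / 4))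
  by exact (proj2 (J false 0%nat ltac:(lia)) _ (locally_ball _ (mkposreal _ q))).
assert (L1 : locally t (fun s => Rabs (snd (coord i (c0 s)) - snd (coord i (c0 t))) < rho / 4))
  by exact (proj2 (J true 0%nat ltac:(lia)) _ (locally_ball _ (mkposreal _ q))).
generalize (filter_and _ _ L (filter_and _ _ L0 L1)); apply filter_imp.
intros s [Ds [B0 B1]]; split; auto.
destruct Nt as [N1 N2]; unfold near.
apply Rlt_le in B0; apply Rlt_le in B1; rewrite !Rabs_between in *; lra.
Qed.

(** At the end parameter the geodesic is not yet known to be in the chart. Its coordinates before it
    are Lipschitz, hence Cauchy; their limit stays in the closed box and [chart_limit] identifies
    the point. *)
Lemma inside_closed m : 0 < m < r -> (forall s, Rabs s < m -> inside s) ->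
  forall e, Rabs e = m -> inside e.
Proof.
intros Hm Hin e He.
set (s := fun n : nat => e * (1 - / (INR n + 2))).
assert (P : forall n, 0 < / (INR n + 2) < 1).
  intros n; generalize (pos_INR n); intros Hn; split.
  - apply Rinv_0_lt_compat; lra.
  - rewrite <- Rinv_1; apply Rinv_lt_contravar; lra.
assert (As : forall n, Rabs (s n) < m).
  intros n; destruct (P n); unfold s; rewrite Rabs_mult, He, (Rabs_pos_eq (1 - _)) by lra.
  rewrite <- (Rmult_1_r m) at 2; apply Rmult_lt_compat_l; lra.
assert (Ls : is_lim_seq s e).
  replace (Finite e) with (Rbar_mult e (Finite (1 - 0))) by (simpl; f_equal; ring).
  apply is_lim_seq_mult'; [apply is_lim_seq_const |].
  apply is_lim_seq_minus'; [apply is_lim_seq_const |].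
  apply (is_lim_seq_inv _ p_infty); [| discriminate].
  apply (is_lim_seq_plus _ _ p_infty 2); [apply is_lim_seq_INR | apply is_lim_seq_const | reflexivity].
assert (Cs : ex_lim_seq_cauchy s) by (apply ex_lim_seq_cauchy_corr; now exists e).
assert (Lip : forall k n n', Rabs (curve_coord i c0 k (s n) - curve_coord i c0 k (s n'))
    <= V * Rabs (s n - s n')).
  intros k n n'; set (u := Rmax (Rabs (s n)) (Rabs (s n'))).
  assert (Hu : u < m) by (apply Rmax_lub_lt; apply As).
  apply (inside_lip u).
  - split; [apply Rle_trans with (2 := Rmax_l _ _), Rabs_pos | lra].
  - intros x Hx; apply Hin; lra.
  - apply Rmax_r.
  - apply Rmax_l.
assert (Lim : forall k, exists l, is_lim_seq (fun n => curve_coord i c0 k (s n)) (Finite l)).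
  intros k; apply ex_lim_seq_cauchy_corr; intros eps.
  assert (V1 : 0 < V + 1) by (generalize V_pos; lra).
  destruct (Cs (mkposreal _ (Rdiv_lt_0_compat _ _ (cond_pos eps) V1))) as [N HN].
  exists N; intros n n' Hn Hn'.
  apply Rle_lt_trans with (1 := Lip k n n').
  apply Rle_lt_trans with ((V + 1) * Rabs (s n - s n')).
    apply Rmult_le_compat_r; [apply Rabs_pos | lra].
  specialize (HN n n' Hn Hn'); simpl in HN.
  replace (eps : R) with ((V + 1) * (eps / (V + 1))) by (field; lra).
  now apply Rmult_lt_compat_l.
destruct (Lim false) as [l0 L0]; destruct (Lim true) as [l1 L1].
assert (Ne : near z (3 * rho / 4) (l0, l1)).
  assert (Nn : forall n, near z (3 * rho / 4) (coord i (c0 (s n)))).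
    intros n; apply (inside_near (Rabs (s n))); [| | lra].
    - split; [apply Rabs_pos | generalize (As n); lra].
    - intros x Hx; apply Hin; generalize (As n); lra.
  split; simpl; apply Rabs_between; split.
  - apply (is_lim_seq_le (fun _ => fst z - 3 * rho / 4) (fun n => curve_coord i c0 false (s n)) (fst z - 3 * rho / 4) l0);
      auto using is_lim_seq_const; intros n; destruct (Nn n) as [X _]; apply Rabs_between in X; apply X.
  - apply (is_lim_seq_le (fun n => curve_coord i c0 false (s n)) (fun _ => fst z + 3 * rho / 4) l0 (fst z + 3 * rho / 4));
      auto using is_lim_seq_const; intros n; destruct (Nn n) as [X _]; apply Rabs_between in X; apply X.
  - apply (is_lim_seq_le (fun _ => snd z - 3 * rho / 4) (fun n => curve_coord i c0 true (s n)) (snd z - 3 * rho / 4) l1);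
      auto using is_lim_seq_const; intros n; destruct (Nn n) as [_ X]; apply Rabs_between in X; apply X.
  - apply (is_lim_seq_le (fun n => curve_coord i c0 true (s n)) (fun _ => snd z + 3 * rho / 4) l1 (snd z + 3 * rho / 4));
      auto using is_lim_seq_const; intros n; destruct (Nn n) as [_ X]; apply Rabs_between in X; apply X.
assert (Nr : near z rho (l0, l1)) by (generalize rho_nonneg; destruct Ne; split; lra).
assert (Hr : - r < e < r).
  assert (X : Rabs e <= m) by lra; apply Rabs_le_between in X; lra.
destruct (chart_limit i c0 e s (l0, l1)) as [De Ee]; auto.
- apply (curve_Cn_le 2); [lia | apply (Hgeo e Hr)].
- intros n; apply (Hin (s n) (As n)).
- apply (bb_im _ _ _ _ _ _ HB); auto.
- split; auto; now rewrite Ee.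
Qed.

(** Continuation: if the supremum of the good parameters were less than [r], it would be good by
    [inside_closed], and the margin of [inside_near] would allow a larger one. *)
Lemma geodesic_inside : 0 < rho -> forall t, - r < t < r -> inside t /\ gnorm t = 1.
Proof.
intros rp.
set (E := fun u => 0 <= u < r /\ forall s, Rabs s <= u -> inside s).
assert (I0 : inside 0) by (destruct Hin0 as [D [N1 N2]]; split; auto; split; lra).
assert (E0 : E 0).
  split; [lra |]; intros s Hs; generalize (Rabs_pos s); intros Hs'.
  replace s with 0; auto; symmetry; apply Rabs_eq_0; lra.
destruct (completeness E) as [m [Hub Hlub]].
- exists r; intros u [Hu _]; lra.
- now exists 0.
assert (m0 : 0 <= m) by now apply Hub.
assert (Em : forall u, 0 <= u < m -> E u).
  intros u Hu; destruct (classic (exists u', E u' /\ u < u')) as [[u' [[Hu' Eu'] lt]] | NE].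
  - split; [lra |]; intros s Hs; apply Eu'; lra.
  - exfalso; apply (Rlt_not_le m u); [lra |]; apply Hlub; intros u' Eu'.
    destruct (Rle_dec u' u); auto; exfalso; apply NE; exists u'; split; auto; lra.
assert (mr : r <= m).
  destruct (Rle_dec r m) as [| mr]; auto; exfalso.
  assert (Im : forall s, Rabs s <= m -> inside s).
    intros s Hs; destruct (Rle_lt_or_eq_dec _ _ Hs) as [lt | eq].
    - apply (Em (Rabs s)); [split; [apply Rabs_pos | auto] | lra].
    - destruct (Rle_lt_or_eq_dec _ _ m0) as [m1 | m1].
      + apply (inside_closed m); [lra | | auto].
        intros x Hx; apply (Em (Rabs x)); [split; [apply Rabs_pos | auto] | lra].
      + replace s with 0; auto; symmetry; apply Rabs_eq_0; lra.
  assert (Lm : forall e, Rabs e <= m -> locally e inside).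
    intros e He; apply locally_inside; auto.
    - apply Rabs_le_between in He; lra.
    - apply Im; auto.
    - apply (inside_near m); auto; lra.
  assert (A1 : Rabs m <= m) by (rewrite Rabs_pos_eq; lra).
  assert (A2 : Rabs (- m) <= m) by (rewrite Rabs_Ropp, Rabs_pos_eq; lra).
  destruct (Lm _ A1) as [e1 H1]; destruct (Lm _ A2) as [e2 H2].
  set (d := Rmin (Rmin e1 e2) (r - m) / 2).
  assert (D : 0 < d /\ d < e1 /\ d < e2 /\ d < r - m).
    generalize (cond_pos e1) (cond_pos e2) (Rmin_l (Rmin e1 e2) (r - m)) (Rmin_r (Rmin e1 e2) (r - m))
     (Rmin_l e1 e2) (Rmin_r e1 e2); intros.
    assert (0 < Rmin (Rmin e1 e2) (r - m)) by (apply Rmin_glb_lt; [apply Rmin_glb_lt |]; lra).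
    unfold d; lra.
  apply (Rlt_not_le (m + d) m); [lra |]; apply Hub; split; [lra |].
  intros s Hs; destruct (Rle_dec (Rabs s) m) as [le | gt]; [now apply Im |].
  destruct (Rle_dec 0 s) as [s0 | s0].
  + rewrite Rabs_pos_eq in Hs, gt by lra.
    apply H1; change (Rabs (s - m) < e1); rewrite Rabs_pos_eq; lra.
  + rewrite Rabs_left in Hs, gt by lra.
    apply H2; change (Rabs (s - - m) < e2); rewrite Rabs_left; lra.
intros t Ht.
assert (At : Rabs t < r) by (apply Rabs_def1; lra).
destruct (Em (Rabs t)) as [Hr Hi]; [split; [apply Rabs_pos | lra] |].
split; [apply Hi; lra | apply (inside_unit (Rabs t)); auto; lra].
Qed.

End Confinement.

Lemma quad_bound (g : bool -> bool -> R) v w a b d : 0 <= a -> 0 <= b ->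
  (forall j k, Rabs (g j k) <= a) -> (forall k, Rabs (v k) <= b) -> (forall k, Rabs (w k) <= d) ->
  Rabs (quad g v w) <= 4 * (a * b * d).
Proof.
intros a0 b0 Hg Hv Hw.
assert (J : forall j k, Rabs (g j k * v j * w k) <= a * b * d).
  intros j k; rewrite !Rabs_mult; apply Rmult_le_compat; auto using Rabs_pos.
    apply Rmult_le_pos; apply Rabs_pos.
  apply Rmult_le_compat; auto using Rabs_pos.
unfold quad, sum2.
generalize (J false false) (J false true) (J true false) (J true true).
intros J1 J2 J3 J4.
eapply Rle_trans; [apply Rabs_triang |].
generalize (Rabs_triang (g false false * v false * w false) (g false true * v false * w true))
 (Rabs_triang (g true false * v true * w false) (g true true * v true * w true)); lra.
Qed.

(* By Rolle every component of the difference of the velocities vanishes somewhere,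
   so the maximum of that difference is at most a small multiple of itself. *)
Lemma short_geodesics_unique (K h : R) (Y Z Y' Z' : bool -> R -> R)
    (GY GZ : bool -> R -> bool -> bool -> R) :
  0 <= K -> 0 <= h <= 1 -> 40 * K * h < 1 ->
  (forall k t, 0 <= t <= 1 -> is_derive (Y k) t (Y' k t)) ->
  (forall k t, 0 <= t <= 1 -> is_derive (Z k) t (Z' k t)) ->
  (forall k t, 0 <= t <= 1 -> is_derive (Y' k) t (- quad (GY k t) (vec Y' t) (vec Y' t))) ->
  (forall k t, 0 <= t <= 1 -> is_derive (Z' k) t (- quad (GZ k t) (vec Z' t) (vec Z' t))) ->
  (forall k t a b, 0 <= t <= 1 -> Rabs (GZ k t a b) <= K) ->
  (forall k t a b, 0 <= t <= 1 ->
     Rabs (GY k t a b - GZ k t a b) <= K * norm1 (fun k => Y k t - Z k t)) ->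
  (forall k t, 0 <= t <= 1 -> Rabs (Y' k t) <= h) ->
  (forall k t, 0 <= t <= 1 -> Rabs (Z' k t) <= h) ->
  (forall k, Y k 0 = Z k 0) -> (forall k, Y k 1 = Z k 1) ->
  forall k, Y' k 0 = Z' k 0.
Proof.
intros K0 Hh Kh dY dZ dY' dZ' bG lG bY bZ E0 E1.
set (f := fun k t => Y' k t - Z' k t).
set (f' := fun k t => - quad (GY k t) (vec Y' t) (vec Y' t) - - quad (GZ k t) (vec Z' t) (vec Z' t)).
assert (df : forall k t, 0 <= t <= 1 -> is_derive (f k) t (f' k t)).
  intros k t Ht; apply (is_derive_minus (Y' k) (Z' k)); auto.
assert (de : forall k t, 0 <= t <= 1 -> is_derive (fun t => Y k t - Z k t) t (f k t)).
  intros k t Ht; apply (is_derive_minus (Y k) (Z k)); auto.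
destruct (continuity_ab_maj (fun t => norm1 (fun k => f k t)) 0 1) as [tm [Hmax Htm]].
- lra.
- intros t Ht; unfold norm1.
  assert (cf : forall k, continuity_pt (fun t => Rabs (f k t)) t).
    intros k; apply (continuity_pt_comp (f k) Rabs).
    - apply derivable_continuous_pt; exists (f' k t); apply is_derive_Reals; auto.
    - apply Rcontinuity_abs.
  apply (continuity_pt_plus (fun t => Rabs (f false t)) (fun t => Rabs (f true t))); apply cf.
- set (m := norm1 (fun k => f k tm)) in *.
  assert (fm : forall k t, 0 <= t <= 1 -> Rabs (f k t) <= m).
    intros k t Ht; apply Rle_trans with (2 := Hmax t Ht); unfold norm1.
    generalize (Rabs_pos (f false t)) (Rabs_pos (f true t)); destruct k; lra.
  assert (m0 : 0 <= m) by exact (Rle_trans _ _ _ (Rabs_pos _) (fm false 0 ltac:(lra))).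
  assert (em : forall k t, 0 <= t <= 1 -> Rabs (Y k t - Z k t) <= m).
    intros k t Ht.
    destruct (MVT_is_derive (fun t => Y k t - Z k t) (f k) 0 t) as [s [Hs Es]].
      intros s; rewrite Rmin_left, Rmax_right by lra; intros Hs; apply de; lra.
    rewrite Rmin_left, Rmax_right in Hs by lra.
    rewrite E0, Rminus_eq_0, !Rminus_0_r in Es; rewrite Es, Rabs_mult.
    rewrite <- (Rmult_1_r m); apply Rmult_le_compat; auto using Rabs_pos.
    + apply fm; lra.
    + rewrite Rabs_pos_eq; lra.
  (* The factor 16 is 8 from the difference of the Christoffel symbols, using [h <= 1], and 4 from
     each velocity argument. *)
  assert (fm' : forall k t, 0 <= t <= 1 -> Rabs (f' k t) <= 16 * K * h * m).
    intros k t Ht; unfold f'.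
    replace (- quad (GY k t) (vec Y' t) (vec Y' t) - - quad (GZ k t) (vec Z' t) (vec Z' t)) with
      (- (quad (fun a b => GY k t a b - GZ k t a b) (vec Y' t) (vec Y' t))
       - (quad (GZ k t) (fun k => f k t) (vec Y' t)) - quad (GZ k t) (vec Z' t) (fun k => f k t))
      by (unfold f, quad, sum2, vec; ring).
    assert (bY' : forall j, Rabs (vec Y' t j) <= h) by (intros j; now apply bY).
    assert (bZ' : forall j, Rabs (vec Z' t j) <= h) by (intros j; now apply bZ).
    assert (Q1 : Rabs (quad (fun a b => GY k t a b - GZ k t a b) (vec Y' t) (vec Y' t))
       <= 4 * (K * (2 * m) * h * h)).
      apply quad_bound; try (intros; apply bY; auto); [| lra |].
      - apply Rmult_le_pos; lra.
      - intros a b; apply Rle_trans with (1 := lG k t a b Ht), Rmult_le_compat_l; auto.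
        unfold norm1; generalize (em false t Ht) (em true t Ht); lra.
    assert (Q2 : Rabs (quad (GZ k t) (fun k => f k t) (vec Y' t)) <= 4 * (K * m * h)).
      apply quad_bound; intros; auto.
    assert (Q3 : Rabs (quad (GZ k t) (vec Z' t) (fun k => f k t)) <= 4 * (K * h * m)).
      apply quad_bound; intros; auto; lra.
    assert (Q4 : K * (2 * m) * h * h <= 2 * (K * m * h)).
      assert (X := Rmult_le_pos _ _ (Rmult_le_pos _ _ K0 m0) (proj1 Hh)).
      assert (Y0 : K * m * h * h <= K * m * h * 1) by (apply Rmult_le_compat_l; lra).
      lra.
    unfold Rminus; eapply Rle_trans; [apply Rabs_triang |]; rewrite Rabs_Ropp.
    eapply Rle_trans; [apply Rplus_le_compat_r, Rabs_triang |]; rewrite !Rabs_Ropp.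
    unfold Rminus in *; lra.
  assert (fz : forall k t, 0 <= t <= 1 -> Rabs (f k t) <= 16 * K * h * m).
    intros k t Ht.
    destruct (MVT_is_derive (fun t => Y k t - Z k t) (f k) 0 1) as [s [Hs Es]].
      intros s; rewrite Rmin_left, Rmax_right by lra; auto.
    rewrite Rmin_left, Rmax_right in Hs by lra.
    assert (fs : f k s = 0) by (rewrite E0, E1 in Es; lra).
    replace (f k t) with (f k t - f k s) by (rewrite fs; ring).
    apply Rle_trans with (16 * K * h * m * Rabs (t - s)).
      apply (MVT_Lipschitz (f k) (f' k) 0 1); auto.
    rewrite <- (Rmult_1_r (16 * K * h * m)) at 2; apply Rmult_le_compat_l.
    + repeat apply Rmult_le_pos; lra.
    + apply Rabs_le; lra.
  (* Two components, each at most [16 * K * h * m]; as [40 * K * h < 1], this forces [m = 0]. *)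
  assert (mm : m <= 32 * K * h * m).
    unfold m at 1, norm1; generalize (fz false tm Htm) (fz true tm Htm); lra.
  assert (mz : m = 0).
    assert (Kh0 : 0 <= K * h) by (apply Rmult_le_pos; lra).
    apply Rle_antisym; auto; nra.
  intros k; apply Rminus_diag_uniq; fold (f k 0).
  apply Rabs_eq_0, Rle_antisym; [rewrite <- mz; apply fm; lra | apply Rabs_pos].
Qed.


(** * The local estimate *)

Section ArcFamily.

Context {S : surface} (M : metric S -> Prop) (i : chart S) (z : R * R) (rho K c : R).
Hypothesis HB : box_bounds M i z rho K c.
Variables (gam : R -> S) (t0 eta : R).

Definition DI (t : R) : Prop := t0 - eta < t < t0 + eta.
Definition distR (t t' : R) : R := Rabs (t' - t).

Record arc_hyp (B v0 : R) : Prop := {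
  ah_dom : forall t, DI t -> dom i (gam t) /\ near z rho (coord i (gam t));
  ah_C3 : forall t, DI t -> curve_Cn 3 gam t;
  ah_bd : forall t k n, DI t -> (1 <= n <= 3)%nat ->
    Rabs (Derive_n (curve_coord i gam k) n t) <= B;
  ah_v0 : 0 < v0;
  ah_reg : forall t, DI t -> v0 <= velocity i gam false t ^ 2 + velocity i gam true t ^ 2
}.

Variables B v0 : R.
Hypothesis HA : arc_hyp B v0.

Definition arc (g : metric S) : arc_data := {|
  cpos := curve_coord i gam;
  utan := unit_tan g i gam;
  acc := fun k t => cov_deriv g i gam (unit_tan g i gam) k t / chart_speed g i gam t;
  spd := chart_speed g i gam;
  met := fun t => met_at g i (fst (coord i (gam t))) (snd (coord i (gam t)));
  dmet := fun l t => dmet_at g i l (fst (coord i (gam t))) (snd (coord i (gam t)));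
  chr := fun k t => chr_at g i k (fst (coord i (gam t))) (snd (coord i (gam t)))
|}.

Notation BLt := (BL M DI distR).

Lemma distR_pos t t' : 0 <= distR t t'.
Proof. apply Rabs_pos. Qed.

Lemma DI_between t t' s : DI t -> DI t' -> Rmin t t' <= s <= Rmax t t' -> DI s.
Proof. unfold DI, Rmin, Rmax; destruct (Rle_dec t t'); lra. Qed.

Lemma DI_locally t : DI t -> locally t DI.
Proof.
intros [H1 H2]; apply (filter_and (fun s => t0 - eta < s) (fun s => s < t0 + eta));
[now apply open_gt | now apply open_lt].
Qed.

Lemma Derive_n_der t k n : DI t -> (n <= 2)%nat ->
  is_derive (Derive_n (curve_coord i gam k) n) t (Derive_n (curve_coord i gam k) (n + 1) t).
Proof.
intros Ht le; rewrite Nat.add_1_r; apply Derive_correct.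
destruct (ah_C3 _ _ HA t Ht i (proj1 (ah_dom _ _ HA t Ht))) as [_ J].
apply (J k (Datatypes.S n)); lia.
Qed.

Lemma DI_lip (f f' : R -> R) (L : R) : (forall t, DI t -> is_derive f t (f' t)) ->
  (forall t, DI t -> Rabs (f' t) <= L) ->
  forall t t', DI t -> DI t' -> Rabs (f t' - f t) <= L * distR t t'.
Proof.
intros Hd Hb t t' Ht Ht'.
destruct (MVT_is_derive f f' t t') as [s [Hs ->]].
  intros s Hs; apply Hd, (DI_between t t'); auto.
rewrite Rabs_mult; apply Rmult_le_compat_r; [apply Rabs_pos |].
apply Hb, (DI_between t t'); auto.
Qed.

Lemma BL_Derive_n k n : (1 <= n <= 2)%nat -> BLt (fun _ => Derive_n (curve_coord i gam k) n).
Proof.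
intros le; exists (Rabs B); split; [apply Rabs_pos |]; intros g Mg; split.
- intros t Ht; apply Rle_trans with B; [now apply (ah_bd _ _ HA t k n); auto; lia | apply RRle_abs].
- apply DI_lip with (Derive_n (curve_coord i gam k) (n + 1)).
  + intros t Ht; apply Derive_n_der; auto; lia.
  + intros t Ht; apply Rle_trans with B; [apply (ah_bd _ _ HA); auto; lia | apply RRle_abs].
Qed.

Definition vel (k : bool) (t : R) : R := velocity i gam k t.
Definition vel' (k : bool) (t : R) : R := Derive (velocity i gam k) t.

Lemma BL_vel k : BLt (fun _ => vel k).
Proof. apply (BL_Derive_n k 1); lia. Qed.
Lemma BL_vel' k : BLt (fun _ => vel' k).
Proof. apply (BL_Derive_n k 2); lia. Qed.

Lemma pos_vel k t : DI t -> is_derive (curve_coord i gam k) t (vel k t).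
Proof. intros Ht; apply (Derive_n_der t k 0); auto; lia. Qed.
Lemma vel_vel' k t : DI t -> is_derive (velocity i gam k) t (vel' k t).
Proof. intros Ht; apply (Derive_n_der t k 1); auto; lia. Qed.

Lemma BL_along (f : metric S -> R * R -> R) :
  BL M (near z rho) dist2 f -> BLt (fun g t => f g (coord i (gam t))).
Proof.
apply (BL_comp _ _ _ DI distR (fun t => coord i (gam t)) (2 * Rabs B)).
- intros t Ht; apply (ah_dom _ _ HA t Ht).
- generalize (Rabs_pos B); lra.
- apply distR_pos.
- intros t t' Ht Ht'; unfold dist2.
  assert (J : forall k, Rabs (curve_coord i gam k t' - curve_coord i gam k t) <= Rabs B * distR t t').
    intros k; apply DI_lip with (vel k); auto.
    + intros s Hs; now apply pos_vel.
    + intros s Hs; apply Rle_trans with B; [| apply RRle_abs].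
      apply (ah_bd _ _ HA s k 1); auto; lia.
  generalize (J false) (J true); unfold curve_coord, proj; lra.
Qed.

Lemma BL_met_along j k : BLt (fun g t => met (arc g) t j k).
Proof. apply (BL_along (fun g p => met_at g i (fst p) (snd p) j k)), (BL_met _ _ _ _ _ _ HB). Qed.
Lemma BL_dmet_along l j k : BLt (fun g t => dmet (arc g) l t j k).
Proof. apply (BL_along (fun g p => dmet_at g i l (fst p) (snd p) j k)), (BL_dmet _ _ _ _ _ _ HB). Qed.
Lemma BL_chr_along l j k : BLt (fun g t => chr (arc g) l t j k).
Proof. apply (BL_along (fun g p => chr_at g i l (fst p) (snd p) j k)), (BL_chr _ _ _ _ _ _ HB). Qed.

Definition spd2 (g : metric S) (t : R) : R := quad (met (arc g) t) (vec vel t) (vec vel t).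

Lemma spd_spd2 g t : spd (arc g) t = sqrt (spd2 g t).
Proof. reflexivity. Qed.

Lemma cv0 : 0 < c * v0.
Proof. apply Rmult_lt_0_compat; [apply (bb_c _ _ _ _ _ _ HB) | apply (ah_v0 _ _ HA)]. Qed.

Lemma spd2_ge g t : M g -> DI t -> c * v0 <= spd2 g t.
Proof.
intros Mg Ht; refine (Rle_trans _ _ _ _ (bb_ell _ _ _ _ _ _ HB g _ _ Mg (proj2 (ah_dom _ _ HA t Ht)))).
apply Rmult_le_compat_l; [left; apply (bb_c _ _ _ _ _ _ HB) | apply (ah_reg _ _ HA t Ht)].
Qed.

Lemma spd_ge g t : M g -> DI t -> sqrt (c * v0) <= spd (arc g) t.
Proof. intros Mg Ht; rewrite spd_spd2; apply sqrt_le_1_alt; now apply spd2_ge. Qed.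

Lemma spd_gt0 g t : M g -> DI t -> 0 < spd (arc g) t.
Proof.
intros Mg Ht; apply Rlt_le_trans with (2 := spd_ge g t Mg Ht), sqrt_lt_R0, cv0.
Qed.

Lemma BL_spd2 : BLt spd2.
Proof.
apply (BL_quad distR_pos); intros; [apply BL_met_along | apply BL_vel ..].
Qed.

Lemma BL_spd : BLt (fun g t => spd (arc g) t).
Proof. apply (BL_sqrt distR_pos _ _ cv0 spd2_ge BL_spd2). Qed.

Lemma BL_spdV : BLt (fun g t => / spd (arc g) t).
Proof. apply (BL_inv distR_pos _ _ (sqrt_lt_R0 _ cv0) spd_ge BL_spd). Qed.

Definition spd2' (g : metric S) (t : R) : R :=
  quad (fun j k => pair (fun m => dmet (arc g) m t j k) (vec vel t)) (vec vel t) (vec vel t)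
  + quad (met (arc g) t) (vec vel' t) (vec vel t) + quad (met (arc g) t) (vec vel t) (vec vel' t).

Lemma in_im t : DI t -> in_image i (curve_coord i gam false t, curve_coord i gam true t).
Proof.
intros Ht; exists (gam t); split; [apply (ah_dom _ _ HA t Ht) |].
unfold curve_coord, proj; now destruct (coord i (gam t)).
Qed.

Lemma met_der g t j k : DI t -> is_derive (fun u => met (arc g) u j k) t
  (pair (fun m => dmet (arc g) m t j k) (vec vel t)).
Proof.
intros Ht; rewrite <- (Rmult_1_l (pair _ _)).
apply (gc_curve_der g i (curve_coord i gam) vel 1 t (in_im t Ht)).
intros l; rewrite Rmult_1_l; now apply pos_vel.
Qed.

Lemma spd2_der g t : DI t -> is_derive (spd2 g) t (spd2' g t).
Proof.
intros Ht; apply (is_derive_quad (fun u => met (arc g) u) vel vel); intros;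
[now apply met_der | now apply vel_vel' ..].
Qed.

Definition spd' (g : metric S) (t : R) : R := / 2 * (spd2' g t * / spd (arc g) t).

Lemma spd_der g t : M g -> DI t -> is_derive (spd (arc g)) t (spd' g t).
Proof.
intros Mg Ht; generalize (spd_gt0 g t Mg Ht) (spd2_ge g t Mg Ht) cv0; intros H1 H2 H3.
replace (spd' g t) with (spd2' g t / (2 * sqrt (spd2 g t))).
- apply (is_derive_sqrt (spd2 g)); [now apply spd2_der | lra].
- rewrite spd_spd2 in H1; unfold spd'; rewrite spd_spd2; field; lra.
Qed.

Definition utan' (g : metric S) (k : bool) (t : R) : R :=
  vel' k t * / spd (arc g) t - vel k t * spd' g t * (/ spd (arc g) t * / spd (arc g) t).

Lemma tan_tan' g k t : M g -> DI t -> is_derive (unit_tan g i gam k) t (utan' g k t).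
Proof.
intros Mg Ht; generalize (spd_gt0 g t Mg Ht); intros H1.
replace (utan' g k t) with
  ((vel' k t * spd (arc g) t - vel k t * spd' g t) / (spd (arc g) t ^ 2))
  by (unfold utan'; field; lra).
apply (is_derive_div (velocity i gam k) (spd (arc g))); [now apply vel_vel' | now apply spd_der | lra].
Qed.

Lemma BL_tan k : BLt (fun g t => utan (arc g) k t).
Proof. apply (BL_mult distR_pos _ _ (BL_vel k) BL_spdV). Qed.

(** The acceleration is algebraic in first and second derivatives of [gam], the metric and its first
    derivatives. Its Lipschitz bound uses the bound on third derivatives of [gam]. *)
Lemma BL_acc k : BLt (fun g t => acc (arc g) k t).
Proof.
apply (BL_ext (fun g t => (utan' g k t
   + quad (chr (arc g) k t) (vec vel t) (vec (utan (arc g)) t)) * / spd (arc g) t)).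
- intros g t Mg Ht; simpl; unfold cov_deriv.
  now rewrite (is_derive_unique _ _ _ (tan_tan' g k t Mg Ht)).
- apply (BL_mult distR_pos); [| apply BL_spdV].
  apply BL_plus.
  + unfold utan'; apply (BL_minus distR_pos).
    * apply (BL_mult distR_pos _ _ (BL_vel' k) BL_spdV).
    * apply (BL_mult distR_pos); [| apply (BL_mult distR_pos _ _ BL_spdV BL_spdV)].
      apply (BL_mult distR_pos _ _ (BL_vel k)).
      apply (BL_mult distR_pos); [apply (BL_const distR_pos) |].
      apply (BL_mult distR_pos); [| apply BL_spdV].
      unfold spd2'; apply BL_plus; [apply BL_plus |];
      apply (BL_quad distR_pos); intros; try apply BL_vel; try apply BL_vel';
      try apply BL_met_along.
      apply (BL_sum2 (fun m g t => dmet (arc g) m t j k0 * vel m t)); intros m.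
      apply (BL_mult distR_pos _ _ (BL_dmet_along m j k0) (BL_vel m)).
  + apply (BL_quad distR_pos); intros; [apply BL_chr_along | apply BL_vel | apply BL_tan].
Qed.

Lemma arc_tan_unit g t : M g -> DI t ->
  quad (met (arc g) t) (vec (utan (arc g)) t) (vec (utan (arc g)) t) = 1.
Proof.
intros Mg Ht; generalize (spd_gt0 g t Mg Ht); intros H1.
transitivity (spd2 g t / (spd (arc g) t * spd (arc g) t)).
  assert (E : forall k, utan (arc g) k t = vel k t / spd (arc g) t) by reflexivity.
  unfold spd2, quad, sum2, vec; rewrite !E; field; lra.
rewrite spd_spd2 in H1 |- *; rewrite sqrt_sqrt; [field |].
- intros E; rewrite E, sqrt_0 in H1; lra.
- generalize (spd2_ge g t Mg Ht) cv0; lra.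
Qed.

Lemma arc_tan_der g k t : M g -> DI t -> is_derive (utan (arc g) k) t
    (spd (arc g) t * acc (arc g) k t
      - spd (arc g) t * quad (chr (arc g) k t) (vec (utan (arc g)) t) (vec (utan (arc g)) t)).
Proof.
intros Mg Ht; generalize (spd_gt0 g t Mg Ht); intros H1.
assert (J := tan_tan' g k t Mg Ht).
replace (_ - _) with (utan' g k t); [exact J |].
rewrite <- (is_derive_unique _ _ _ J).
simpl; unfold cov_deriv, quad, sum2, chr_at, vec, unit_tan.
change (chart_speed g i gam t) with (spd (arc g) t); field; lra.
Qed.

Lemma arc_pos_der g k t : M g -> DI t ->
  is_derive (curve_coord i gam k) t (spd (arc g) t * utan (arc g) k t).
Proof.
intros Mg Ht; generalize (spd_gt0 g t Mg Ht); intros H1.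
replace (_ * _) with (vel k t); [now apply pos_vel |].
simpl; unfold unit_tan, vel; change (chart_speed g i gam t) with (spd (arc g) t); field; lra.
Qed.

Lemma arc_tan_acc g t : M g -> DI t ->
  quad (met (arc g) t) (vec (utan (arc g)) t) (vec (acc (arc g)) t) = 0.
Proof.
intros Mg Ht; generalize (spd_gt0 g t Mg Ht); intros H1.
assert (J := quad_met_der g i (curve_coord i gam) (utan (arc g))
   (fun k => spd (arc g) t * acc (arc g) k t) (spd (arc g) t) t (in_im t Ht)
   (fun k => arc_pos_der g k t Mg Ht) (fun k => arc_tan_der g k t Mg Ht)).
apply is_derive_unique in J.
rewrite (Derive_ext_loc _ (fun _ => 1)) in J.
- rewrite Derive_const in J.
  assert (E : met (arc g) t true false = met (arc g) t false true) by now apply gc_sym, in_im.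
  apply Rmult_eq_reg_l with (2 * spd (arc g) t); [| lra].
  rewrite Rmult_0_r, J.
  change (met_at g i (curve_coord i gam false t) (curve_coord i gam true t)) with (met (arc g) t).
  unfold quad, sum2, vec; rewrite E; ring.
- generalize (DI_locally t Ht); apply filter_imp; intros s Hs; now apply arc_tan_unit.
Qed.

Lemma arc_family_ok : large (fun N => forall g lo hi, M g -> t0 - eta < lo -> hi < t0 + eta ->
  arc_ok N lo hi (arc g)).
Proof.
assert (bd : forall f, BLt f -> large (fun N => forall g t, M g -> DI t -> Rabs (f g t) <= N)).
  intros f Hf; apply (BL_bound _ Hf).
assert (lp : forall f, BLt f -> large (fun N => forall g t t', M g -> DI t -> DI t' ->
    Rabs (f g t' - f g t) <= N * distR t t')).
  intros f Hf; apply (BL_lip distR_pos _ Hf).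
assert (L1 := bd _ BL_spd); assert (L2 := bd _ BL_spdV).
assert (L3 := large_bool _ (fun k => bd _ (BL_tan k))).
assert (L4 := large_bool _ (fun k => bd _ (BL_acc k))).
assert (L5 := large_bool _ (fun j => large_bool _ (fun k => bd _ (BL_met_along j k)))).
assert (L6 := large_bool _ (fun l => large_bool _ (fun j => large_bool _ (fun k => bd _ (BL_dmet_along l j k))))).
assert (L7 := large_bool _ (fun l => large_bool _ (fun j => large_bool _ (fun k => bd _ (BL_chr_along l j k))))).
assert (L8 := lp _ BL_spd).
assert (L9 := large_bool _ (fun k => lp _ (BL_acc k))).
assert (L10 := large_bool _ (fun j => large_bool _ (fun k => lp _ (BL_met_along j k)))).
assert (L0 : large (fun N => 0 < N)) by (exists 1; intros; lra).
assert (L := large_and _ _ L0 (large_and _ _ L1 (large_and _ _ L2 (large_and _ _ L3 (large_and _ _ L4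
  (large_and _ _ L5 (large_and _ _ L6 (large_and _ _ L7 (large_and _ _ L8 (large_and _ _ L9 L10)))))))))).
revert L; clear bd lp L0 L1 L2 L3 L4 L5 L6 L7 L8 L9 L10; apply large_impl; intros N.
intros [N0 [L1 [L2 [L3 [L4 [L5 [L6 [L7 [L8 [L9 L10]]]]]]]]]] g lo hi Mg Hlo Hhi.
assert (I : forall t, lo <= t <= hi -> DI t) by (intros t; unfold DI; lra).
split; auto.
- intros t Ht; generalize (spd_gt0 g t Mg (I t Ht)) (L2 g t Mg (I t Ht)); intros s0 H2.
  rewrite <- (Rinv_inv (spd (arc g) t)).
  assert (0 < / spd (arc g) t) by now apply Rinv_0_lt_compat.
  rewrite Rabs_pos_eq in H2 by lra.
  apply Rinv_le_contravar; lra.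
- intros k t Ht; apply arc_pos_der; auto.
- intros k t Ht; rewrite Rmult_minus_distr_l; apply arc_tan_der; auto.
- intros k t Ht.
  assert (J := cotangent_der g i (curve_coord i gam) (utan (arc g))
   (fun k => spd (arc g) t * acc (arc g) k t) (spd (arc g) t) t (in_im t (I t Ht))
   (fun k => arc_pos_der g k t Mg (I t Ht)) (fun k => arc_tan_der g k t Mg (I t Ht)) k).
  match type of J with is_derive _ _ ?e => match goal with |- is_derive _ _ ?e' =>
    replace e' with e; [exact J |] end end.
  unfold sum2, met, dmet, arc, curve_coord, proj; ring.
- intros j k t Ht; apply gc_sym, in_im, I, Ht.
- intros t Ht; apply arc_tan_unit; auto.
- intros t Ht; apply arc_tan_acc; auto.
Qed.

Hypothesis Hhalf : forall t, DI t -> near z (rho / 2) (coord i (gam t)).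
Hypothesis rho0 : 0 < rho.
Hypothesis eta0 : 0 < eta.

Definition alen (g : metric S) (t : R) : R := RInt (chart_speed g i gam) t0 t.

Lemma DI_0 : DI t0.
Proof. unfold DI; lra. Qed.

Lemma cont_spd g t : M g -> DI t -> continuous (chart_speed g i gam) t.
Proof.
intros Mg Ht; apply (ex_derive_continuous (chart_speed g i gam) t); exists (spd' g t).
apply (spd_der g t Mg Ht).
Qed.

Lemma ex_RInt_spd g a b : M g -> DI a -> DI b -> ex_RInt (chart_speed g i gam) a b.
Proof.
intros Mg Ha Hb; apply (ex_RInt_continuous (chart_speed g i gam)); intros s Hs; apply cont_spd; auto.
now apply (DI_between a b).
Qed.

Lemma alen_der g t : M g -> DI t -> is_derive (alen g) t (chart_speed g i gam t).
Proof.
intros Mg Ht; apply (is_derive_RInt _ _ t0); [| now apply cont_spd].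
generalize (DI_locally t Ht); apply filter_imp; intros s Hs.
apply (RInt_correct (chart_speed g i gam)), ex_RInt_spd; auto using DI_0.
Qed.

Lemma speed_chart g t : M g -> DI t -> speed g gam t = chart_speed g i gam t.
Proof.
intros Mg Ht; unfold speed; destruct (ah_dom _ _ HA t Ht) as [Dt _].
destruct (ah_C3 _ _ HA t Ht i Dt) as [L J].
apply chart_speed_trans; auto using chart_at_dom.
intros k; apply (J k 1%nat); lia.
Qed.

Lemma arc_length_alen g a b : M g -> DI a -> DI b ->
  arc_length g gam a b = Rabs (alen g b - alen g a).
Proof.
intros Mg Ha Hb; unfold arc_length; f_equal.
rewrite (RInt_ext _ (chart_speed g i gam)).
- assert (J : alen g a + RInt (chart_speed g i gam) a b = alen g b)
    by (apply (RInt_Chasles (chart_speed g i gam)); apply ex_RInt_spd; auto using DI_0).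
  revert J; generalize (alen g a) (alen g b) (RInt (chart_speed g i gam) a b : R).
  intros x y w J; change (w = y - x); lra.
- intros s Hs; apply speed_chart; auto; apply (DI_between a b); auto; lra.
Qed.

Lemma curv2_chart g t : M g -> DI t ->
  curv2 (arc g) t = chart_curv g i gam t ^ 2.
Proof.
intros Mg Ht.
assert (s0 := spd_gt0 g t Mg Ht).
simpl in s0; unfold chart_curv, chart_norm, Rdiv.
rewrite Rpow_mult_distr, <- Rsqr_pow2, Rsqr_sqrt.
- unfold curv2, quad, sum2, vec, arc, met, acc, met_at; field; lra.
- refine (Rle_trans _ _ _ _ (bb_ell _ _ _ _ _ _ HB g _ _ Mg (proj2 (ah_dom _ _ HA t Ht)))).
  apply Rmult_le_pos; [left; apply (bb_c _ _ _ _ _ _ HB) |].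
  apply Rplus_le_le_0_compat; apply pow2_ge_0.
Qed.

Lemma BL_curv2 : BL M (DI) distR (fun g t => curv2 (arc g) t).
Proof.
apply (BL_quad (distR_pos)); intros.
- apply (BL_met_along).
- apply (BL_acc).
- apply (BL_acc).
Qed.

(** The unit-speed geodesic composed with the signed length of [gam] measured from [a]: this gives
    it the speed of [gam] and the tangency at parameter [a]. *)
Definition geo_of (g : metric S) (cc : R -> S) (a : R) : geo_data := {|
  gpos := fun k t => curve_coord i cc k (alen g t - alen g a);
  gtan := fun k t => velocity i cc k (alen g t - alen g a);
  gmet := fun t => met_at g i (fst (coord i (cc (alen g t - alen g a))))
                            (snd (coord i (cc (alen g t - alen g a))));
  gchr := fun k t => chr_at g i k (fst (coord i (cc (alen g t - alen g a))))
                            (snd (coord i (cc (alen g t - alen g a))))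
|}.

Record good_const (N : R) : Prop := {
  gc_1 : 1 <= N;
  gc_arc : forall g lo hi, M g -> t0 - eta < lo -> hi < t0 + eta -> arc_ok N lo hi (arc g);
  gc_unit : forall g p v, M g -> near z rho p ->
    quad (met_at g i (fst p) (snd p)) v v = 1 -> forall k, Rabs (v k) <= N;
  gc_taylor : forall g p q j k, M g -> near z rho p -> near z rho q ->
    Rabs (met_at g i (fst q) (snd q) j k - met_at g i (fst p) (snd p) j k
    - pair (fun l => dmet_at g i l (fst p) (snd p) j k)
        (fun l => proj l q - proj l p)) <= N * dist2 p q ^ 2;
  gc_chr : forall k a b g p, M g -> near z rho p ->
    Rabs (chr_at g i k (fst p) (snd p) a b) <= N;
  gc_chr_lip : forall k a b g p q, M g -> near z rho p -> near z rho q ->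
    Rabs (chr_at g i k (fst q) (snd q) a b - chr_at g i k (fst p) (snd p) a b) <= N * dist2 p q
}.

Lemma large_good_const : large good_const.
Proof.
assert (L1 : large (fun N => 1 <= N)) by (exists 1; auto).
assert (L2 := arc_family_ok).
assert (L3 := unit_bound M i z rho K c HB).
assert (L4 := taylor_bound M i z rho K c HB).
assert (L5 := large_bool _ (fun k => large_bool _ (fun a => large_bool _ (fun b =>
   BL_bound _ (BL_chr M i z rho K c HB k a b))))).
assert (L6 := large_bool _ (fun k => large_bool _ (fun a => large_bool _ (fun b =>
   BL_lip dist2_pos _ (BL_chr M i z rho K c HB k a b))))).
assert (L := large_and _ _ L1 (large_and _ _ L2 (large_and _ _ L3 (large_and _ _ L4 (large_and _ _ L5 L6))))).
revert L; apply large_impl; intros N [H1 [H2 [H3 [H4 [H5 H6]]]]]; split; auto.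
Qed.

Variable N : R.
Hypothesis HN : good_const N.

Section Tangent.

Variables (g : metric S) (Mg : M g) (r : R).
Hypothesis r0 : 0 < r.
Hypothesis Hr : N * r <= rho / 4.
Variables (a : R) (cc : R -> S).
Hypothesis Ha : DI a.
Hypothesis Hcc : tangent_geodesic g gam a r cc.

Lemma tangent_start : dom i (cc 0) /\ near z (rho / 2) (coord i (cc 0)).
Proof.
destruct Hcc as [_ [-> _]]; split; [apply (ah_dom _ _ HA a Ha) | now apply Hhalf].
Qed.

Lemma tangent_vel k : velocity i cc k 0 = unit_tan g i gam k a.
Proof.
destruct Hcc as [_ [_ Hv]]; rewrite (Hv i (proj1 (ah_dom _ _ HA a Ha))).
unfold unit_tan; now rewrite speed_chart.
Qed.

Lemma tangent_unit : gnorm i g cc 0 = 1.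
Proof.
transitivity (quad (met (arc g) a) (vec (utan (arc g)) a) (vec (utan (arc g)) a)).
- unfold gnorm, quad, sum2, vec, gvel; rewrite !tangent_vel.
  destruct Hcc as [_ [-> _]]; reflexivity.
- apply (arc_tan_unit g a Mg Ha).
Qed.

Lemma tangent_inside u : - r < u < r -> inside i z rho cc u /\ gnorm i g cc u = 1.
Proof.
apply (geodesic_inside M i z rho K c HB g cc r N r0 (proj1 Hcc)
  (fun p v => gc_unit N HN g p v Mg) tangent_start tangent_unit Hr rho0).
Qed.

Lemma tangent_pos_der k u : - r < u < r ->
  is_derive (curve_coord i cc k) u (velocity i cc k u).
Proof.
intros Hu; apply (gpos_vel i z rho g cc r (proj1 Hcc) u k Hu); now apply tangent_inside.
Qed.

Lemma tangent_vel_der k u : - r < u < r -> is_derive (velocity i cc k) u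
  (- quad (chr_at g i k (fst (coord i (cc u))) (snd (coord i (cc u))))
     (vec (velocity i cc) u) (vec (velocity i cc) u)).
Proof.
intros Hu; apply (gvel_der i z rho g cc r (proj1 Hcc) u k Hu); now apply tangent_inside.
Qed.

Lemma tangent_vel_bd k u : - r < u < r -> Rabs (velocity i cc k u) <= N.
Proof.
intros Hu; destruct (tangent_inside u Hu) as [[_ Iu] Nu].
exact (gc_unit N HN g _ (vec (velocity i cc) u) Mg Iu Nu k).
Qed.

Lemma tangent_speed u : - r < u < r -> speed g cc u = 1.
Proof.
intros Hu; destruct (tangent_inside u Hu) as [[Du Iu] Nu].
destruct (proj1 Hcc u Hu) as [Cu _]; destruct (Cu i Du) as [L J].
unfold speed; rewrite (chart_speed_trans g i); auto using chart_at_dom.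
- change (chart_speed g i cc u) with (sqrt (gnorm i g cc u)); rewrite Nu; apply sqrt_1.
- intros k; apply (J k 1%nat); lia.
Qed.

Lemma tangent_arc_length u : - r < u < r -> arc_length g cc 0 u = Rabs u.
Proof.
intros Hu; unfold arc_length.
rewrite (RInt_ext _ (fun _ => 1)).
- rewrite RInt_const; unfold scal; simpl; unfold mult; simpl.
  now rewrite Rmult_1_r, Rminus_0_r.
- intros s; unfold Rmin, Rmax; destruct (Rle_dec 0 u); intros Hs; apply tangent_speed; lra.
Qed.

Lemma geo_of_ok lo hi : lo <= a <= hi ->
  (forall t, lo <= t <= hi -> DI t /\ - r < alen g t - alen g a < r) ->
  geo_ok N lo hi a (arc g) (geo_of g cc a).
Proof.
intros Hlh HI.
assert (dl : forall t, lo <= t <= hi ->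
    is_derive (fun t => alen g t - alen g a) t (chart_speed g i gam t)).
  intros t Ht; rewrite <- (Rminus_0_r (chart_speed g i gam t)).
  apply (is_derive_minus (alen g) (fun _ => alen g a)); [apply alen_der; auto; now apply HI |].
  apply (is_derive_const (alen g a) t).
assert (pn : forall t, lo <= t <= hi -> near z rho (coord i (gam t)) /\
     near z rho (coord i (cc (alen g t - alen g a)))).
  intros t Ht; destruct (HI t Ht) as [Dt Rt]; split.
  - apply (ah_dom _ _ HA t Dt).
  - apply (tangent_inside _ Rt).
split.
- intros k t Ht; apply (is_derive_comp (curve_coord i cc k) (fun t => alen g t - alen g a)); auto.
  apply tangent_pos_der, HI, Ht.
- intros k t Ht; apply (is_derive_comp (velocity i cc k) (fun t => alen g t - alen g a)); auto.
  apply tangent_vel_der, HI, Ht.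
- intros k; simpl; rewrite Rminus_eq_0; unfold curve_coord; now destruct Hcc as [_ [-> _]].
- intros k; simpl; rewrite Rminus_eq_0; apply tangent_vel.
- intros k t Ht; apply tangent_vel_bd, HI, Ht.
- intros l j k t Ht; apply (gc_chr N HN); auto; now apply pn.
- intros t Ht; apply (tangent_inside _ (proj2 (HI t Ht))).
- intros l j k t Ht; apply (gc_chr_lip N HN l j k g (coord i (gam t))); auto; now apply pn.
- intros j k t Ht; apply (gc_taylor N HN g (coord i (gam t))); auto; now apply pn.
Qed.

Lemma tangent_curvature : geod_curvature g gam a ^ 2 = curv2 (arc g) a.
Proof.
rewrite (curv2_chart g a Mg Ha); f_equal.
destruct (ah_dom _ _ HA a Ha) as [Da _].
apply (geod_curvature_chart g i gam cc a r); auto.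
- apply (curve_Cn_le 3); [lia | now apply (ah_C3 _ _ HA)].
- generalize (DI_locally a Ha); apply filter_imp; intros s Hs.
  apply (curve_Cn_le 3); [lia | now apply (ah_C3 _ _ HA)].
- generalize (spd_gt0 g a Mg Ha); simpl; lra.
- intros k; exists (utan' g k a); now apply (tan_tan').
Qed.

End Tangent.

(** Between two common points both geodesics are rescaled to the unit interval, where their initial
    velocities must agree: [(u' - u) cA'(u) = (v' - v) cB'(v)]. Unit speeds give
    [|u' - u| = |v' - v|], so unless both vanish the velocities at the first common point are equal
    or opposite. *)
Lemma meeting_unique g r a b cA cB u v u' v' : M g -> 0 < r -> N * r <= rho / 4 ->
  100 * (N * N) * r <= 1 -> DI a -> DI b ->
  tangent_geodesic g gam a r cA -> tangent_geodesic g gam b r cB ->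
  ~ (forall k, velocity i cA k u = velocity i cB k v) ->
  ~ (forall k, velocity i cA k u = - velocity i cB k v) ->
  - r < u < r -> - r < v < r -> - r < u' < r -> - r < v' < r ->
  cA u = cB v -> cA u' = cB v' -> u' = u /\ v' = v.
Proof.
intros Mg r0 Hr1 Hr2 Ha Hb HcA HcB NE1 NE2 Hu Hv Hu' Hv' E E'.
assert (N1 := gc_1 N HN).
assert (cv : forall x x' t, - r < x < r -> - r < x' < r -> 0 <= t <= 1 -> - r < x + t * (x' - x) < r).
  intros x x' t Hx Hx' Ht.
  assert (0 <= (1 - t) * (x + r)) by (apply Rmult_le_pos; lra).
  assert (0 <= (1 - t) * (r - x)) by (apply Rmult_le_pos; lra).
  assert (0 <= t * (x' + r)) by (apply Rmult_le_pos; lra).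
  assert (0 <= t * (r - x')) by (apply Rmult_le_pos; lra).
  destruct (Req_dec t 0) as [-> | t1]; [lra |].
  assert (0 < t * (x' + r)) by (apply Rmult_lt_0_compat; lra).
  assert (0 < t * (r - x')) by (apply Rmult_lt_0_compat; lra).
  lra.
assert (in_A := fun x Hx => tangent_inside g Mg r r0 Hr1 a cA Ha HcA x Hx).
assert (in_B := fun x Hx => tangent_inside g Mg r r0 Hr1 b cB Hb HcB x Hx).
set (p := fun (x x' t : R) => x + t * (x' - x)).
assert (dp : forall x x' t, is_derive (p x x') t (x' - x)).
  intros x x' t; unfold p; auto_derive; auto; ring.
assert (N2 : 0 <= N * N) by (apply Rmult_le_pos; lra).
assert (J : forall k, (u' - u) * velocity i cA k (p u u' 0) = (v' - v) * velocity i cB k (p v v' 0)).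
  (* The rescaled velocities are at most [2 * r * N]; then [40 * N * (2 * r * N)] is
     [80 * (N * N) * r], less than 1. *)
  apply (short_geodesics_unique N (2 * r * N)
    (fun k t => curve_coord i cA k (p u u' t)) (fun k t => curve_coord i cB k (p v v' t))
    (fun k t => (u' - u) * velocity i cA k (p u u' t)) (fun k t => (v' - v) * velocity i cB k (p v v' t))
    (fun k t => chr_at g i k (fst (coord i (cA (p u u' t)))) (snd (coord i (cA (p u u' t)))))
    (fun k t => chr_at g i k (fst (coord i (cB (p v v' t)))) (snd (coord i (cB (p v v' t)))))).
  - lra.
  - split; [repeat apply Rmult_le_pos; lra |].
    assert (N * r <= N * N * r).
      rewrite Rmult_assoc; rewrite <- (Rmult_1_l (N * r)) at 1.
      apply Rmult_le_compat_r; [apply Rmult_le_pos |]; lra.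
    lra.
  - lra.
  - intros k t Ht; apply (is_derive_comp (curve_coord i cA k) (p u u')); auto.
    apply (tangent_pos_der g Mg r r0 Hr1 a cA Ha HcA); now apply cv.
  - intros k t Ht; apply (is_derive_comp (curve_coord i cB k) (p v v')); auto.
    apply (tangent_pos_der g Mg r r0 Hr1 b cB Hb HcB); now apply cv.
  - intros k t Ht.
    match goal with |- is_derive _ _ ?e => replace e with
      ((u' - u) * ((u' - u) * - quad (chr_at g i k (fst (coord i (cA (p u u' t)))) (snd (coord i (cA (p u u' t)))))
       (vec (velocity i cA) (p u u' t)) (vec (velocity i cA) (p u u' t))))
       by (unfold quad, sum2, vec; ring) end.
    apply is_derive_scal, (is_derive_comp (velocity i cA k) (p u u')); auto.
    apply (tangent_vel_der g Mg r r0 Hr1 a cA Ha HcA); now apply cv.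
  - intros k t Ht.
    match goal with |- is_derive _ _ ?e => replace e with
      ((v' - v) * ((v' - v) * - quad (chr_at g i k (fst (coord i (cB (p v v' t)))) (snd (coord i (cB (p v v' t)))))
       (vec (velocity i cB) (p v v' t)) (vec (velocity i cB) (p v v' t))))
       by (unfold quad, sum2, vec; ring) end.
    apply is_derive_scal, (is_derive_comp (velocity i cB k) (p v v')); auto.
    apply (tangent_vel_der g Mg r r0 Hr1 b cB Hb HcB); now apply cv.
  - intros k t x y Ht; apply (gc_chr N HN); auto.
    apply in_B; now apply cv.
  - intros k t x y Ht; apply (gc_chr_lip N HN k x y g (coord i (cB (p v v' t)))); auto.
    + apply in_B; now apply cv.
    + apply in_A; now apply cv.
  - intros k t Ht; rewrite Rabs_mult; apply Rmult_le_compat; auto using Rabs_pos.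
    + apply Rabs_le; lra.
    + apply (tangent_vel_bd g Mg r r0 Hr1 a cA Ha HcA); now apply cv.
  - intros k t Ht; rewrite Rabs_mult; apply Rmult_le_compat; auto using Rabs_pos.
    + apply Rabs_le; lra.
    + apply (tangent_vel_bd g Mg r r0 Hr1 b cB Hb HcB); now apply cv.
  - intros k; unfold p; rewrite !Rmult_0_l, !Rplus_0_r; unfold curve_coord; now rewrite E.
  - intros k; unfold p; rewrite !Rmult_1_l.
    replace (u + (u' - u)) with u' by ring; replace (v + (v' - v)) with v' by ring.
    unfold curve_coord; now rewrite E'.
unfold p in J; rewrite !Rmult_0_l, !Rplus_0_r in J.
destruct (in_A u Hu) as [_ NA]; destruct (in_B v Hv) as [_ NB].
assert (Sq : (u' - u) * (u' - u) = (v' - v) * (v' - v)).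
  transitivity ((u' - u) * (u' - u) * gnorm i g cA u); [rewrite NA; ring |].
  transitivity ((v' - v) * (v' - v) * gnorm i g cB v); [| rewrite NB; ring].
  unfold gnorm; rewrite E.
  assert (Q : forall (m : bool -> bool -> R) w s, s * s * quad m w w = quad m (fun k => s * w k) (fun k => s * w k))
    by (intros; unfold quad, sum2; ring).
  rewrite !Q; unfold quad, sum2, vec, gvel; rewrite !J; reflexivity.
assert (Cs : (u' - u - (v' - v)) * (u' - u + (v' - v)) = 0) by lra.
destruct (Req_dec (u' - u) 0) as [Z | NZ].
- rewrite Z in Sq; assert (v' - v = 0) by nra; lra.
- exfalso; destruct (Rmult_integral _ _ Cs) as [C1 | C1].
  + apply NE1; intros k; apply Rmult_eq_reg_l with (u' - u); auto.
    rewrite J; f_equal; lra.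
  + apply NE2; intros k; apply Rmult_eq_reg_l with (u' - u); auto.
    rewrite J; replace (v' - v) with (- (u' - u)) by lra; ring.
Qed.


(** The estimate is demanded at both ends to be symmetric in the two points; the lower bound [kap]
    later turns the error of order 4 into a relative one. *)
Definition good_pair (g : metric S) (r kap C a b : R) (cA cB : R -> S) : Prop :=
  exists u v, nearby_intersection cA cB r (u, v) /\
    (forall w, nearby_intersection cA cB r w -> w = (u, v)) /\
    forall t, t = a \/ t = b -> kap <= geod_curvature g gam t ^ 2 /\
      Rabs (Lfun g gam cA cB a b u v - geod_curvature g gam t ^ 2 / 12 * arc_length g gam a b ^ 3)
        <= C * arc_length g gam a b ^ 4.

Lemma alen_increasing g s t : M g -> DI s -> DI t -> s < t -> alen g s < alen g t.
Proof.
intros Mg Hs Ht lt.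
destruct (MVT_is_derive (alen g) (chart_speed g i gam) s t) as [x [Hx E]].
  intros x Hx; apply alen_der; auto; now apply (DI_between s t).
assert (Dx : DI x) by now apply (DI_between s t).
assert (X := spd_gt0 g x Mg Dx).
simpl in X; assert (0 < chart_speed g i gam x * (t - s)) by (apply Rmult_lt_0_compat; lra).
lra.
Qed.

Lemma alen_lip g s t : M g -> DI s -> DI t ->
  Rabs (alen g t - alen g s) <= N * Rabs (t - s).
Proof.
intros Mg Hs Ht.
assert (J := gc_arc N HN g (Rmin s t) (Rmax s t) Mg).
unfold DI in Hs, Ht.
assert (H1 : t0 - eta < Rmin s t) by (apply Rmin_glb_lt; lra).
assert (H2 : Rmax s t < t0 + eta) by (apply Rmax_lub_lt; lra).
apply (MVT_Lipschitz (alen g) (chart_speed g i gam) (Rmin s t) (Rmax s t)).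
- intros x Hx; apply alen_der; auto; unfold DI; lra.
- apply (spd_bd _ _ _ _ (J H1 H2)).
- apply between_l.
- apply between_r.
Qed.

Lemma local_increasing kap : 0 < kap -> / N <= kap ->
  forall r, 0 < r -> N * r <= rho / 4 -> 100 * (N * N) * r <= 1 ->
  exists C del, 0 < C /\ 0 < del /\ forall g a b cA cB, M g -> a < b -> b - a < del ->
    Rabs (a - t0) < eta / 2 -> Rabs (b - t0) < eta / 2 ->
    kap <= curv2 (arc g) a -> kap <= curv2 (arc g) b ->
    tangent_geodesic g gam a r cA -> tangent_geodesic g gam b r cB ->
    good_pair g r kap C a b cA cB.
Proof.
intros k0 HNk r r0 Hr1 Hr2.
assert (N1 := gc_1 N HN); assert (N0 : 0 < N) by lra.
destruct (two_geodesics N N0) as [C [del [C0 [del0 Htwo]]]].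
(* [/ 3] is for [duo_gap]; [eta / 8] keeps the interval extended by one gap inside [DI];
   [r / (4 * N)] keeps the geodesic parameters, at most [2 * N * (b - a)], below [r]. *)
set (d := Rmin (Rmin del (/ 3)) (Rmin (eta / 8) (r / (4 * N)))).
assert (rN : 0 < r / (4 * N)) by (apply Rdiv_lt_0_compat; lra).
exists C, d; split; auto; split; [repeat apply Rmin_glb_lt; lra |].
intros g a b cA cB Mg ab Hd Ha Hb Ka Kb HcA HcB.
assert (D1 := Rlt_le_trans _ _ _ Hd (Rle_trans _ _ _ (Rmin_l _ _) (Rmin_l _ _))).
assert (D2 := Rlt_le_trans _ _ _ Hd (Rle_trans _ _ _ (Rmin_l _ _) (Rmin_r _ _))).
assert (D3 := Rlt_le_trans _ _ _ Hd (Rle_trans _ _ _ (Rmin_r _ _) (Rmin_l _ _))).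
assert (D4 := Rlt_le_trans _ _ _ Hd (Rle_trans _ _ _ (Rmin_r _ _) (Rmin_r _ _))).
apply Rabs_def2 in Ha; apply Rabs_def2 in Hb.
assert (D5 : 2 * N * (b - a) < r).
  apply Rlt_le_trans with (2 * N * (r / (4 * N))); [apply Rmult_lt_compat_l; lra |].
  replace (2 * N * (r / (4 * N))) with (r / 2) by (field; lra); lra.
set (w := {| darc := arc g; dA := geo_of g cA a; dB := geo_of g cB b;
             da := a; db := b; len := alen g |}).
assert (DIw : forall t, dlo w <= t <= dhi w -> DI t).
  intros t; unfold dlo, dhi, gap, DI; simpl; lra.
assert (DIa : DI a) by (unfold DI; lra).
assert (DIb : DI b) by (unfold DI; lra).
assert (Rg : forall t x, dlo w <= t <= dhi w -> x = a \/ x = b -> - r < alen g t - alen g x < r).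
  intros t x Ht Hx; assert (Dx : DI x) by (destruct Hx; subst; auto).
  assert (X := alen_lip g x t Mg Dx (DIw t Ht)).
  assert (Y : Rabs (t - x) <= 2 * (b - a)).
    unfold dlo, dhi, gap in Ht; simpl in Ht; apply Rabs_le; destruct Hx; subst; lra.
  assert (Z : N * Rabs (t - x) <= N * (2 * (b - a))) by (apply Rmult_le_compat_l; lra).
  assert (Q : Rabs (alen g t - alen g x) < r) by lra.
  apply Rabs_def2 in Q; lra.
assert (Hw : duo_ok N w).
  split; simpl.
  - unfold gap; simpl; lra.
  - apply (gc_arc N HN); auto; unfold dlo, dhi, gap; simpl; lra.
  - apply (geo_of_ok g Mg r r0 Hr1 a cA DIa HcA).
    + unfold dlo, dhi, gap; simpl; lra.
    + intros t Ht; split; [now apply DIw | apply Rg; auto].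
  - apply (geo_of_ok g Mg r r0 Hr1 b cB DIb HcB).
    + unfold dlo, dhi, gap; simpl; lra.
    + intros t Ht; split; [now apply DIw | apply Rg; auto].
  - lra.
  - intros t Ht; apply alen_der; auto.
destruct (Htwo w Hw) as [m [m' [Im [Im' [Hm [Hm' [Em [NE1 [NE2 Est]]]]]]]]].
  unfold gap; simpl; lra.
simpl in Hm, Hm', Em, NE1, NE2, Est.
set (u := alen g m - alen g a) in *; set (v := alen g m' - alen g b) in *.
assert (Hu : - r < u < r) by (apply Rg; auto).
assert (Hv : - r < v < r) by (apply Rg; auto).
assert (u0 : 0 < u).
  assert (X := alen_increasing g a m Mg DIa (DIw m Im) Hm); unfold u; lra.
assert (v0' : v < 0).
  assert (X := alen_increasing g m' b Mg (DIw m' Im') DIb Hm'); unfold v; lra.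
destruct (tangent_inside g Mg r r0 Hr1 a cA DIa HcA u Hu) as [[Du _] _].
destruct (tangent_inside g Mg r r0 Hr1 b cB DIb HcB v Hv) as [[Dv _] _].
assert (Meet : cA u = cB v).
  apply (coord_inj i); auto.
  rewrite (surjective_pairing (coord i (cA u))), (surjective_pairing (coord i (cB v))).
  f_equal; [apply (Em false) | apply (Em true)].
assert (Al : arc_length g gam a b = alen g b - alen g a).
  rewrite (arc_length_alen g a b Mg DIa DIb); apply Rabs_pos_eq.
  generalize (alen_increasing g a b Mg DIa DIb ab); lra.
exists u, v; split; [| split].
- split; [| split]; simpl; auto; apply Rabs_def1; lra.
- intros [u' v'] [Hu' [Hv' E']]; simpl in Hu', Hv', E'.
  apply Rabs_def2 in Hu'; apply Rabs_def2 in Hv'.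
  destruct (meeting_unique g r a b cA cB u v u' v') as [-> ->]; auto; lra.
- intros t Ht.
  assert (Kt : geod_curvature g gam t ^ 2 = curv2 (arc g) t).
    destruct Ht; subst; [apply (tangent_curvature g Mg r r0 a cA) | apply (tangent_curvature g Mg r r0 b cB)];
    auto.
  rewrite Kt; split; [destruct Ht; subst; auto |].
  unfold Lfun; rewrite Al.
  rewrite (tangent_arc_length g Mg r r0 Hr1 a cA DIa HcA u Hu).
  rewrite (tangent_arc_length g Mg r r0 Hr1 b cB DIb HcB v Hv).
  rewrite (Rabs_pos_eq u), (Rabs_left v) by lra.
  replace (u + - v - (alen g b - alen g a)) with (alen g m - alen g m') by (unfold u, v; ring).
  apply Est; auto.
Qed.

Lemma good_pair_sym g r kap C a b cA cB : M g -> DI a -> DI b ->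
  good_pair g r kap C a b cA cB -> good_pair g r kap C b a cB cA.
Proof.
intros Mg Ha Hb [u [v [[Hu [Hv E]] [Huniq Est]]]].
assert (Al : arc_length g gam b a = arc_length g gam a b).
  rewrite !arc_length_alen by auto; apply Rabs_minus_sym.
exists v, u; split; [| split].
- split; [| split]; simpl in *; auto.
- intros [v' u'] [Hv' [Hu' E']]; simpl in *.
  assert (X : (u', v') = (u, v)) by (apply Huniq; split; [| split]; simpl; auto).
  injection X; intros -> ->; auto.
- intros t Ht; destruct (Est t (proj1 (or_comm _ _) Ht)) as [K1 E1].
  split; auto; unfold Lfun in *; rewrite Al, (Rplus_comm (arc_length g cB 0 v)); exact E1.
Qed.

Lemma speed_ge_cont : exists s0, 0 < s0 /\ forall g t, M g -> DI t ->
  s0 <= speed g gam t /\ continuous (speed g gam) t.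
Proof.
exists (sqrt (c * v0)); split; [apply sqrt_lt_R0; apply (cv0) |].
intros g t Mg Ht; split.
- rewrite speed_chart by auto; apply (spd_ge g t Mg Ht).
- apply (continuous_ext_loc _ (chart_speed g i gam)); [| now apply cont_spd].
  generalize (DI_locally t Ht); apply filter_imp; intros s Hs; now rewrite speed_chart.
Qed.

End ArcFamily.

(** The single number [e] is at once the radius of the neighbourhood, a lower bound for the speed
    and for the squared curvature, and the largest radius [r]. One lower bound on [e] then controls
    all of them in the compactness argument. *)
Definition local_ok {S : surface} (M : metric S -> Prop) (gam : R -> S) (t0 e : R) : Prop :=
  0 < e /\
  (forall g t, M g -> Rabs (t - t0) < e -> e <= speed g gam t /\ continuous (speed g gam) t) /\
  forall r, 0 < r <= e -> exists C del, 0 < C /\ 0 < del /\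
    forall g a b cA cB, M g -> Rabs (a - t0) < e -> Rabs (b - t0) < e -> a <> b ->
      Rabs (b - a) < del -> tangent_geodesic g gam a r cA -> tangent_geodesic g gam b r cB ->
      good_pair gam g r e C a b cA cB.

Lemma local_estimate {S : surface} (M : metric S -> Prop) (i : chart S) (z : R * R) (rho K c : R)
    (gam : R -> S) (t0 eta B v0 kmin : R) :
  box_bounds M i z rho K c -> arc_hyp i z rho gam t0 eta B v0 ->
  (forall t, DI t0 eta t -> near z (rho / 2) (coord i (gam t))) -> 0 < rho -> 0 < eta ->
  0 < kmin -> (forall g, M g -> kmin <= chart_curv g i gam t0) ->
  exists e, local_ok M gam t0 e.
Proof.
intros HB HA Hhalf rho0 eta0 k0 Hk.
destruct (speed_ge_cont M i z rho K c HB gam t0 eta B v0 HA) as [s0 [s00 Hs]].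
(* Curvature is only bounded below at [t0]; its square, uniformly Lipschitz, stays above half of
   that bound nearby. *)
set (kap := kmin ^ 2 / 2).
assert (kap0 : 0 < kap) by (unfold kap; generalize (pow_lt _ 2 k0); lra).
assert (LN : large (fun N => / N <= kap)).
  exists (/ kap); intros N HN; rewrite <- (Rinv_inv kap); apply Rinv_le_contravar; auto.
  now apply Rinv_0_lt_compat.
destruct (large_and _ _ (large_good_const M i z rho K c HB gam t0 eta B v0 HA) LN) as [N HN'].
destruct (HN' N (Rle_refl _)) as [HN HNk]; clear HN' LN.
assert (N1 := gc_1 _ _ _ _ _ _ _ _ HN).
destruct (BL_curv2 M i z rho K c HB gam t0 eta B v0 HA) as [L [L0 HL]].
(* [kap / (L + 1)] limits the variation of the squared curvature to [kap]; the last two entries give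
   the conditions of confinement in the box and of uniqueness for every [r <= e]. *)
set (e := Rmin (Rmin s0 kap) (Rmin (Rmin (eta / 2) (kap / (L + 1)))
   (Rmin (rho / (4 * N)) (/ (100 * (N * N)))))).
assert (N2 : 0 < N * N) by (apply Rmult_lt_0_compat; lra).
assert (p1 : 0 < kap / (L + 1)) by (apply Rdiv_lt_0_compat; lra).
assert (p2 : 0 < rho / (4 * N)) by (apply Rdiv_lt_0_compat; lra).
assert (p3 : 0 < / (100 * (N * N))) by (apply Rinv_0_lt_compat; lra).
assert (e0 : 0 < e) by (repeat apply Rmin_glb_lt; lra).
assert (e1 : e <= s0) by (eapply Rle_trans; [apply Rmin_l | apply Rmin_l]).
assert (e2 : e <= kap) by (eapply Rle_trans; [apply Rmin_l | apply Rmin_r]).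
assert (e3 : e <= eta / 2).
  eapply Rle_trans; [apply Rmin_r | eapply Rle_trans; [apply Rmin_l | apply Rmin_l]].
assert (e4 : e <= kap / (L + 1)).
  eapply Rle_trans; [apply Rmin_r | eapply Rle_trans; [apply Rmin_l | apply Rmin_r]].
assert (e5 : e <= rho / (4 * N)).
  eapply Rle_trans; [apply Rmin_r | eapply Rle_trans; [apply Rmin_r | apply Rmin_l]].
assert (e6 : e <= / (100 * (N * N))).
  eapply Rle_trans; [apply Rmin_r | eapply Rle_trans; [apply Rmin_r | apply Rmin_r]].
clearbody e.
assert (D : forall t, Rabs (t - t0) < e -> DI t0 eta t).
  intros t Ht; apply Rabs_def2 in Ht; unfold DI; lra.
assert (Kc : forall g t, M g -> Rabs (t - t0) < e -> kap <= curv2 (arc i gam g) t).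
  intros g t Mg Ht; destruct (HL g Mg) as [_ Lg].
  assert (D0 : DI t0 eta t0) by (unfold DI; lra).
  assert (X := Lg t0 t D0 (D t Ht)); unfold distR in X.
  assert (Y : L * Rabs (t - t0) <= kap).
    apply Rle_trans with ((L + 1) * (kap / (L + 1))); [| right; field; lra].
    apply Rmult_le_compat; auto using Rabs_pos; lra.
  assert (Z : 2 * kap <= curv2 (arc i gam g) t0).
    rewrite (curv2_chart M i z rho K c HB gam t0 eta B v0 HA g t0 Mg D0).
    unfold kap; apply Rle_trans with (kmin ^ 2); [lra |]; apply pow_incr; split; [lra | auto].
  generalize (Rle_trans _ _ _ X Y); intros W; apply Rabs_le_between in W; lra.
exists e; split; [auto | split].
- intros g t Mg Ht; destruct (Hs g t Mg (D t Ht)); split; auto; lra.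
- intros r Hr.
  assert (R1 : N * r <= rho / 4).
    apply Rle_trans with (N * (rho / (4 * N))); [apply Rmult_le_compat_l; lra | right; field; lra].
  assert (R2 : 100 * (N * N) * r <= 1).
    apply Rle_trans with (100 * (N * N) * / (100 * (N * N))); [apply Rmult_le_compat_l; lra |].
    right; field; lra.
  destruct (local_increasing M i z rho K c HB gam t0 eta B v0 HA Hhalf rho0 eta0 N HN kap kap0 HNk
     r (proj1 Hr) R1 R2) as [C [del [C0 [del0 HC]]]].
  exists C, del; split; auto; split; auto.
  assert (J : forall g a b cA cB, M g -> a < b -> Rabs (a - t0) < e -> Rabs (b - t0) < e ->
      Rabs (b - a) < del -> tangent_geodesic g gam a r cA -> tangent_geodesic g gam b r cB ->
      good_pair gam g r e C a b cA cB).
    intros g a b cA cB Mg ab Ha Hb Hd HcA HcB.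
    destruct (HC g a b cA cB) as [u [v [I1 [I2 I3]]]]; auto; try lra.
    - apply Rle_lt_trans with (2 := Hd), RRle_abs.
    - exists u, v; split; auto; split; auto.
      intros t Ht; destruct (I3 t Ht); split; auto; lra.
  intros g a b cA cB Mg Ha Hb ab Hd HcA HcB.
  destruct (Rlt_dec a b) as [lt | ge]; [now apply J |].
  apply (good_pair_sym M i z rho K c HB gam t0 eta B v0 HA); auto.
  apply J; auto; [lra | now rewrite Rabs_minus_sym].
Qed.

(** * From local to global *)

(** Compactness of the interval: each point is covered by a neighbourhood chosen with radius at
    least a common [d]. The double negation in the covering statement is removed classically. *)
Lemma compact_choice (p q : R) (Q : R -> R -> Prop) :
  (forall t, p <= t <= q -> exists e, 0 < e /\ Q t e) ->
  exists d, 0 < d /\ forall x, p <= x <= q ->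
    exists t e, p <= t <= q /\ 0 < e /\ Q t e /\ Rabs (x - t) < e /\ d <= e.
Proof.
intros H.
assert (H' : forall t, exists e : posreal, p <= t <= q -> Q t e).
  intros t; destruct (classic (p <= t <= q)) as [I | NI].
  - destruct (H t I) as [e [e0 He]]; exists (mkposreal e e0); auto.
  - exists (mkposreal 1 Rlt_0_1); tauto.
set (delta := fun t => epsilon (inhabits (mkposreal 1 Rlt_0_1)) (fun e : posreal => p <= t <= q -> Q t e)).
assert (Hd : forall t, p <= t <= q -> Q t (delta t)).
  intros t; apply (epsilon_spec (inhabits (mkposreal 1 Rlt_0_1)) (fun e : posreal => p <= t <= q -> Q t e)).
  apply H'.
destruct (compactness_value_1d p q delta) as [d Hdd].
exists d; split; [apply cond_pos |]; intros x Hx.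
destruct (NNPP _ (Hdd x Hx)) as [t [It [lt le]]].
exists t, (delta t); split; auto; split; [apply cond_pos | auto].
Qed.

Lemma arc_length_lower {S : surface} (g : metric S) (gam : R -> S) (p q d a b : R) :
  (forall t, p <= t <= q -> d <= speed g gam t /\ continuous (speed g gam) t) -> 0 < d ->
  p <= a <= q -> p <= b <= q -> d * Rabs (b - a) <= arc_length g gam a b.
Proof.
intros H d0.
assert (J : forall a b, p <= a <= q -> p <= b <= q -> a <= b ->
    ex_RInt (speed g gam) a b /\ d * (b - a) <= RInt (speed g gam) a b).
  intros a' b' Ha Hb ab.
  assert (E : ex_RInt (speed g gam) a' b').
    apply (ex_RInt_continuous (speed g gam)); intros s; rewrite Rmin_left, Rmax_right by lra.
    intros Hs; apply H; lra.
  split; auto.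
  replace (d * (b' - a')) with (RInt (fun _ => d) a' b').
  - apply RInt_le; auto; [apply ex_RInt_const |].
    intros x Hx; apply H; lra.
  - rewrite RInt_const; unfold scal; simpl; unfold mult; simpl; ring.
intros Ha Hb; unfold arc_length; destruct (Rle_dec a b) as [ab | ba].
- destruct (J a b Ha Hb ab) as [_ Y]; rewrite (Rabs_pos_eq (b - a)) by lra.
  apply Rle_trans with (1 := Y), RRle_abs.
- destruct (J b a Hb Ha) as [X Y]; [lra |].
  rewrite <- (opp_RInt_swap (speed g gam) b a X), (Rabs_minus_sym b a), (Rabs_pos_eq (a - b)) by lra.
  unfold opp; simpl; rewrite Rabs_Ropp.
  apply Rle_trans with (1 := Y), RRle_abs.
Qed.

Lemma local_to_global {S : surface} (M : metric S -> Prop) (gam : R -> S) (p q : R) :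
  (forall t, p <= t <= q -> exists e, local_ok M gam t e) -> uniform_asymptotics M gam p q.
Proof.
intros H.
destruct (compact_choice p q (local_ok M gam)) as [d [d0 Hd]].
  intros t Ht; destruct (H t Ht) as [e He]; exists e; split; auto; apply He.
assert (Sp : forall g t, M g -> p <= t <= q -> d <= speed g gam t /\ continuous (speed g gam) t).
  intros g t Mg Ht; destruct (Hd t Ht) as [s [e [_ [_ [[_ [X _]] [lt le]]]]]].
  destruct (X g t Mg lt); split; auto; lra.
assert (G : forall r, 0 < r <= d -> exists C del, 0 < C /\ 0 < del /\
    forall g a b cA cB, M g -> p <= a <= q -> p <= b <= q -> 0 < arc_length g gam a b < del ->
     tangent_geodesic g gam a r cA -> tangent_geodesic g gam b r cB ->
     good_pair gam g r d C a b cA cB).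
  intros r Hr.
  (* A second covering for fixed [r], since the constants of [local_ok] depend on the base point.
     The radius [2 * e] leaves room for both points: if [a] is within [e] of a centre and [b] within
     [e] of [a], both are within [2 * e]. *)
  destruct (compact_choice p q (fun x e => forall g a b cA cB, M g ->
      Rabs (a - x) < 2 * e -> Rabs (b - x) < 2 * e -> a <> b ->
      tangent_geodesic g gam a r cA -> tangent_geodesic g gam b r cB ->
      good_pair gam g r d (/ e) a b cA cB)) as [e [e0 He]].
  - intros x Hx; destruct (Hd x Hx) as [t [et [_ [et0 [[_ [_ X]] [lt le]]]]]].
    destruct (X r) as [C [del [C0 [del0 Y]]]]; [lra |].
    (* [del / 4] makes two points within [2 * e] of [x] closer than [del]; the entry [/ C] encodes
       the constant in the radius, as [C <= / e]. *)
    set (e := Rmin (Rmin ((et - Rabs (x - t)) / 2) (del / 4)) (/ C)).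
    assert (C1 := Rinv_0_lt_compat _ C0).
    assert (e0 : 0 < e) by (repeat apply Rmin_glb_lt; lra).
    assert (e1 : e <= (et - Rabs (x - t)) / 2) by (eapply Rle_trans; [apply Rmin_l | apply Rmin_l]).
    assert (e2 : e <= del / 4) by (eapply Rle_trans; [apply Rmin_l | apply Rmin_r]).
    assert (e3 : e <= / C) by apply Rmin_r.
    exists e; split; auto; intros g a b cA cB Mg Ha Hb ab HcA HcB.
    assert (near_t : forall s, Rabs (s - x) < 2 * e -> Rabs (s - t) < et).
      intros s Hs; generalize (Rabs_triang (s - x) (x - t)).
      replace (s - x + (x - t)) with (s - t) by ring; lra.
    destruct (Y g a b cA cB) as [u [v [I1 [I2 I3]]]]; auto.
      generalize (Rabs_triang (b - x) (- (a - x))); rewrite Rabs_Ropp.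
      replace (b - x + - (a - x)) with (b - a) by ring; lra.
    exists u, v; split; auto; split; auto; intros s Hs; destruct (I3 s Hs) as [K1 E1].
    split; [lra |]; apply Rle_trans with (1 := E1), Rmult_le_compat_r.
    + apply pow_le, Rabs_pos.
    + rewrite <- (Rinv_inv C); apply Rinv_le_contravar; auto.
  (* The speed is at least [d], so an arc shorter than [d * e] has parameters closer than [e]. *)
  - exists (/ e), (d * e); split; [now apply Rinv_0_lt_compat |].
    split; [now apply Rmult_lt_0_compat |].
    intros g a b cA cB Mg Ha Hb Hl HcA HcB.
    destruct (He a Ha) as [t [et [_ [et0 [X [lt le]]]]]].
    assert (Y := arc_length_lower g gam p q d a b (fun t => Sp g t Mg) d0 Ha Hb).
    assert (Z : Rabs (b - a) < e) by (apply Rmult_lt_reg_l with d; lra).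
    assert (ab : a <> b).
      intros <-; destruct Hl as [Hl _]; revert Hl; unfold arc_length.
      rewrite RInt_point; unfold zero; simpl; rewrite Rabs_R0; lra.
    destruct (X g a b cA cB) as [u [v [I1 [I2 I3]]]]; auto.
    + lra.
    + generalize (Rabs_triang (b - a) (a - t)); replace (b - a + (a - t)) with (b - t) by ring; lra.
    + exists u, v; split; auto; split; auto; intros s Hs; destruct (I3 s Hs) as [K1 E1].
      split; auto; apply Rle_trans with (1 := E1), Rmult_le_compat_r.
      * apply pow_le, Rabs_pos.
      * now apply Rinv_le_contravar.
exists d; split; auto; intros r Hr.
destruct (G r Hr) as [C [del [C0 [del0 HC]]]]; split.
- exists del; split; auto; intros g Mg a b Ha Hb Hl cA cB HcA HcB.
  destruct (HC g a b cA cB Mg Ha Hb Hl HcA HcB) as [u [v [I1 [I2 _]]]].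
  exists (u, v); split; auto; intros w Hw; symmetry; auto.
- intros eps eps0.
  (* Below this length [C s^4 <= eps d s^3 / 12], and [d] is at most the squared curvature. *)
  assert (Q : 0 < eps * d / (12 * C)) by (apply Rdiv_lt_0_compat; [apply Rmult_lt_0_compat |]; lra).
  exists (Rmin del (eps * d / (12 * C))); split; [now apply Rmin_glb_lt |].
  intros g Mg a b Ha Hb [Hl0 Hl] cA cB HcA HcB u v Huv.
  assert (Hl1 : arc_length g gam a b < del) by (apply Rlt_le_trans with (1 := Hl), Rmin_l).
  assert (Hl2 : arc_length g gam a b < eps * d / (12 * C)) by (apply Rlt_le_trans with (1 := Hl), Rmin_r).
  destruct (HC g a b cA cB Mg Ha Hb (conj Hl0 Hl1) HcA HcB) as [u' [v' [I1 [I2 I3]]]].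
  assert (X := I2 _ Huv); injection X; intros -> ->.
  destruct (I3 a (or_introl eq_refl)) as [K1 E1].
  unfold main_term; apply Rle_trans with (1 := E1).
  set (s := arc_length g gam a b) in *; set (k := geod_curvature g gam a ^ 2) in *.
  replace (C * s ^ 4) with (C * s * s ^ 3) by ring.
  replace (eps * (k / 12 * s ^ 3)) with (eps * k / 12 * s ^ 3) by field.
  apply Rmult_le_compat_r; [apply pow_le; lra |].
  assert (Y : C * s <= C * (eps * d / (12 * C))) by (apply Rmult_le_compat_l; lra).
  replace (C * (eps * d / (12 * C))) with (eps * d / 12) in Y by (field; lra).
  assert (eps * d <= eps * k) by (apply Rmult_le_compat_l; lra); lra.
Qed.

(** * Boxes and arcs around a given point *)

Lemma continuity_2d_partial_derive f m n x y : ex_diff_n f 2 x y -> (m + n <= 2)%nat ->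
  continuity_2d_pt (partial_derive m n f) x y.
Proof.
intros H le.
assert (H1 : forall l, ex_diff_n (partial l f) 1 x y) by (intros l; now apply ex_diff_n_partial).
assert (H2 : forall l k, ex_diff_n (partial k (partial l f)) 0 x y)
  by (intros l k; now apply ex_diff_n_partial).
destruct m as [|[|[|m]]]; destruct n as [|[|[|n]]]; try lia.
- apply H.
- apply (H1 true).
- apply (H2 true true).
- apply (H1 false).
- apply (H2 true false).
- apply (H2 false false).
Qed.

Lemma large_locally_bounded f x y : continuity_2d_pt f x y ->
  large (fun K => locally_2d (fun u v => Rabs (f u v) <= K) x y).
Proof.
intros H; exists (Rabs (f x y) + 1); intros K HK.
generalize (H (mkposreal 1 Rlt_0_1)); apply locally_2d_impl, locally_2d_forall; intros u v; simpl.
intros lt; generalize (Rabs_triang (f u v - f x y) (f x y)).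
replace (f u v - f x y + f x y) with (f u v) by ring; lra.
Qed.

Lemma locally_2d_bool (Q : bool -> R -> R -> Prop) x y :
  (forall b, locally_2d (Q b) x y) -> locally_2d (fun u v => forall b, Q b u v) x y.
Proof.
intros H; generalize (locally_2d_and _ _ _ _ (H false) (H true)).
apply locally_2d_impl, locally_2d_forall; intros u v [H1 H2] [|]; auto.
Qed.

Lemma locally_2d_near (Q : R -> R -> Prop) (z : R * R) : locally_2d Q (fst z) (snd z) ->
  exists rho, 0 < rho /\ forall p, near z rho p -> Q (fst p) (snd p).
Proof.
intros [d Hd]; assert (d0 := cond_pos d); exists (d / 2); split; [lra |].
intros p [H1 H2]; apply Hd; lra.
Qed.

Section Boxes.

Context {S : surface} (i : chart S) (z : R * R).
Hypothesis Hz : in_image i z.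

Lemma image_near : locally_2d (fun u v => in_image i (u, v)) (fst z) (snd z).
Proof. apply locally_in_image; now rewrite <- surjective_pairing. Qed.

Lemma box_of_C3_bounded (M : metric S -> Prop) : C3_bounded M ->
  (forall (i : chart S) x1 x2 y1 y2, rectangle_in i x1 x2 y1 y2 ->
    exists c, 0 < c /\ forall g, M g ->
      forall x y, x1 <= x <= x2 -> y1 <= y <= y2 ->
      forall v : bool -> R,
        c * ((v false) ^ 2 + (v true) ^ 2)
          <= quad (fun j k => gc g i j k x y) v v) ->
  exists rho K c, 0 < rho /\ box_bounds M i z rho K c.
Proof.
intros HK Hc; destruct (locally_2d_near _ z image_near) as [rho [rho0 Hr]].
assert (Rect : rectangle_in i (fst z - rho) (fst z + rho) (snd z - rho) (snd z + rho)).
  intros x y Hx Hy; apply (Hr (x, y)); split; now apply Rabs_between.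
destruct (HK i _ _ _ _ Rect) as [K HK']; destruct (Hc i _ _ _ _ Rect) as [c [c0 Hc']].
exists rho, K, c; split; auto; split; auto.
- intros p Np; rewrite (surjective_pairing p); now apply Hr.
- intros g p j k m n Mg [N1 N2] le; apply (HK' g Mg); [now apply Rabs_between .. | lia].
- intros g p v Mg [N1 N2]; apply (Hc' g Mg); now apply Rabs_between.
Qed.

(** For one metric the bounds follow from continuity at the centre, where positive definiteness is a
    positive determinant together with positive diagonal entries. *)
Lemma box_of_metric (g : metric S) :
  exists rho K c, 0 < rho /\ box_bounds (fun h => h = g) i z rho K c.
Proof.
assert (Hz' : in_image i (fst z, snd z)) by now rewrite <- surjective_pairing.
assert (Sm : forall j k n, (n <= 3)%nat -> ex_diff_n (gc g i j k) n (fst z) (snd z)).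
  intros j k n le; apply (ex_diff_n_le _ 3); auto; now apply gc_C3.
assert (Ct : forall j k, continuity_2d_pt (gc g i j k) (fst z) (snd z)).
  intros j k; apply (Sm j k 0%nat); lia.
assert (L : large (fun K => forall j k, locally_2d (fun u v =>
   (Rabs (partial_derive 0 0 (gc g i j k) u v) <= K /\
    Rabs (partial_derive 0 1 (gc g i j k) u v) <= K) /\
   (Rabs (partial_derive 0 2 (gc g i j k) u v) <= K /\
    Rabs (partial_derive 1 0 (gc g i j k) u v) <= K) /\
    Rabs (partial_derive 1 1 (gc g i j k) u v) <= K /\
    Rabs (partial_derive 2 0 (gc g i j k) u v) <= K) (fst z) (snd z))).
  assert (P : forall j k m n, (m + n <= 2)%nat -> large (fun K =>
      locally_2d (fun u v => Rabs (partial_derive m n (gc g i j k) u v) <= K) (fst z) (snd z))).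
    intros j k m n le; apply large_locally_bounded, continuity_2d_partial_derive; auto; apply Sm; lia.
  apply large_bool; intros j; apply large_bool; intros k.
  generalize (large_and _ _ (large_and _ _ (P j k 0%nat 0%nat ltac:(lia)) (P j k 0%nat 1%nat ltac:(lia)))
    (large_and _ _ (large_and _ _ (P j k 0%nat 2%nat ltac:(lia)) (P j k 1%nat 0%nat ltac:(lia)))
    (large_and _ _ (P j k 1%nat 1%nat ltac:(lia)) (P j k 2%nat 0%nat ltac:(lia))))).
  apply large_impl; intros K [[A1 A2] [[A3 A4] [A5 A6]]]; repeat apply locally_2d_and; auto.
destruct L as [K1 HK1]; set (K := Rmax K1 1).
assert (HK := HK1 K (Rmax_l _ _)); assert (K0 : 1 <= K) by apply Rmax_r; clearbody K; clear HK1 K1.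
set (dt := gdet g i (fst z) (snd z)).
assert (dt0 : 0 < dt) by now apply gdet_pos.
assert (Cd : continuity_2d_pt (gdet g i) (fst z) (snd z)).
  apply continuity_2d_pt_minus; apply continuity_2d_pt_mult; apply Ct.
assert (d2 : 0 < dt / 2) by lra.
assert (Ld := Cd (mkposreal _ d2)).
destruct (locally_2d_near _ z (locally_2d_and _ _ _ _ image_near (locally_2d_and _ _ _ _ Ld
  (locally_2d_bool _ _ _ (fun j => locally_2d_bool _ _ _ (fun k => HK j k)))))) as [rho [rho0 Hr]].
(* The least eigenvalue is at least determinant over trace; near [z] these are at least [dt / 2] and
   at most [2 * K]. *)
exists rho, K, (dt / (4 * K)); split; auto; split.
- apply Rdiv_lt_0_compat; lra.
- intros p Np; rewrite (surjective_pairing p); now apply Hr.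
- intros h p j k m n -> Np le; destruct (Hr p Np) as [_ [_ B]].
  destruct (B j k) as [[B1 B2] [[B3 B4] [B5 B6]]].
  destruct m as [|[|[|m]]]; destruct n as [|[|[|n]]]; auto; lia.
- intros h p v -> Np; destruct (Hr p Np) as [Ip [Bd B]].
  destruct (B false false) as [[B1 _] _]; destruct (B true true) as [[B2 _] _].
  change (Rabs (gc g i false false (fst p) (snd p)) <= K) in B1.
  change (Rabs (gc g i true true (fst p) (snd p)) <= K) in B2.
  assert (Sy := gc_sym S g i (fst p) (snd p) true false Ip).
  simpl in Bd; fold dt in Bd.
  assert (P1 := gc_pos S g i (fst p) (snd p) (fun j => if j then 0 else 1) Ip).
  assert (P2 := gc_pos S g i (fst p) (snd p) (fun j => if j then 1 else 0) Ip).
  assert (Q1 : exists j : bool, (if j then 0 else 1) <> 0) by (exists false; lra).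
  assert (Q2 : exists j : bool, (if j then 1 else 0) <> 0) by (exists true; lra).
  specialize (P1 Q1); specialize (P2 Q2).
  unfold quad, sum2, met_at, gdet in *; rewrite Sy in *.
  set (a := gc g i false false (fst p) (snd p)) in *.
  set (b := gc g i false true (fst p) (snd p)) in *.
  set (d := gc g i true true (fst p) (snd p)) in *.
  apply Rabs_def2 in Bd; apply Rabs_le_between in B1; apply Rabs_le_between in B2.
  assert (D : dt / 2 <= a * d - b * b) by lra.
  set (x := v false); set (y := v true).
  set (q := a * x * x + b * x * y + (b * y * x + d * y * y)).
  (* Cayley-Hamilton: [tr g * g = det g + g^2] *)
  assert (CH : (a + d) * q = (a * d - b * b) * (x ^ 2 + y ^ 2)
      + ((a * x + b * y) ^ 2 + (b * x + d * y) ^ 2)) by (unfold q; ring).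
  assert (S1 := pow2_ge_0 (a * x + b * y)); assert (S2 := pow2_ge_0 (b * x + d * y)).
  assert (n0 : 0 <= x ^ 2 + y ^ 2) by (generalize (pow2_ge_0 x) (pow2_ge_0 y); lra).
  assert (T1 := Rmult_le_compat_r _ _ _ n0 D).
  assert (T2 : dt / 2 * (x ^ 2 + y ^ 2) <= (a + d) * q) by lra.
  assert (q0 : 0 <= q).
    apply Rmult_le_reg_l with (a + d); [lra |].
    rewrite Rmult_0_r; apply Rle_trans with (2 := T2), Rmult_le_pos; lra.
  assert (T3 : (a + d) * q <= 2 * K * q) by (apply Rmult_le_compat_r; lra).
  apply Rmult_le_reg_l with (2 * K); [lra |].
  replace (2 * K * (dt / (4 * K) * (x ^ 2 + y ^ 2))) with (dt / 2 * (x ^ 2 + y ^ 2)) by (field; lra).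
  lra.
Qed.

End Boxes.

Lemma arc_setup {S : surface} (gam : R -> S) (alpha beta : Rbar) (t0 rho : R) :
  (forall t : R, Rbar_lt alpha t -> Rbar_lt t beta -> curve_Cn 3 gam t /\ regular gam t) ->
  Rbar_lt alpha t0 -> Rbar_lt t0 beta -> 0 < rho ->
  exists eta B v0, 0 < eta /\
    arc_hyp (chart_at (gam t0)) (coord (chart_at (gam t0)) (gam t0)) rho gam t0 eta B v0 /\
    forall t, DI t0 eta t ->
      near (coord (chart_at (gam t0)) (gam t0)) (rho / 2) (coord (chart_at (gam t0)) (gam t)).
Proof.
intros H Ha Hb rho0; set (i := chart_at (gam t0)); set (z := coord i (gam t0)).
assert (Di : dom i (gam t0)) by apply chart_at_dom.
destruct (H t0 Ha Hb) as [C3 Rg]; destruct (C3 i Di) as [Ld Cd].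
destruct (Rg i Di) as [j0 Hj0].
set (x := curve_coord i gam).
assert (Lb : forall k n, (n <= 3)%nat -> forall e, 0 < e ->
    locally t0 (fun t => Rabs (Derive_n (x k) n t - Derive_n (x k) n t0) < e)).
  intros k n le e e0; exact (proj2 (Cd k n le) _ (locally_ball _ (mkposreal e e0))).
set (nv := fun t => velocity i gam false t ^ 2 + velocity i gam true t ^ 2).
assert (nv0 : 0 < nv t0).
  generalize (pow2_ge_0 (velocity i gam false t0)) (pow2_ge_0 (velocity i gam true t0)).
  unfold nv; assert (X : 0 < velocity i gam j0 t0 ^ 2) by now apply pow2_gt_0.
  destruct j0; lra.
assert (Lv : locally t0 (fun t => nv t0 / 2 < nv t)).
  assert (cv : forall k, continuous (velocity i gam k) t0) by (intros k; apply (Cd k 1%nat); lia).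
  assert (cn : continuous nv t0).
    unfold nv; simpl.
    apply (continuous_plus (fun t => velocity i gam false t * (velocity i gam false t * 1))
      (fun t => velocity i gam true t * (velocity i gam true t * 1)));
    apply (continuous_mult (fun t => velocity i gam _ t) (fun t => velocity i gam _ t * 1)); auto;
    apply (continuous_mult (fun t => velocity i gam _ t) (fun _ => 1)); auto; apply continuous_const.
  apply cn; apply (open_gt (nv t0 / 2)); lra.
(* The final 1 is the variation allowed to each derivative near [t0]. *)
set (bd := Rabs (Derive_n (x false) 1 t0) + Rabs (Derive_n (x true) 1 t0) +
  (Rabs (Derive_n (x false) 2 t0) + Rabs (Derive_n (x true) 2 t0)) +
  (Rabs (Derive_n (x false) 3 t0) + Rabs (Derive_n (x true) 3 t0)) + 1).
assert (Bb : forall k n, (1 <= n <= 3)%nat -> Rabs (Derive_n (x k) n t0) + 1 <= bd).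
  intros k n le; unfold bd.
  generalize (Rabs_pos (Derive_n (x false) 1 t0)) (Rabs_pos (Derive_n (x true) 1 t0))
   (Rabs_pos (Derive_n (x false) 2 t0)) (Rabs_pos (Derive_n (x true) 2 t0))
   (Rabs_pos (Derive_n (x false) 3 t0)) (Rabs_pos (Derive_n (x true) 3 t0)).
  destruct n as [|[|[|[|n]]]]; try lia; destruct k; lra.
assert (Lab : locally t0 (fun t : R => Rbar_lt alpha t /\ Rbar_lt t beta)).
  apply filter_and; [apply (open_Rbar_gt alpha t0 Ha) | apply (open_Rbar_lt beta t0 Hb)].
assert (Ln : forall k, locally t0 (fun t => Rabs (x k t - x k t0) < rho / 2)).
  intros k; apply (Lb k 0%nat); [lia | lra].
assert (L1 : forall k n, (n <= 3)%nat ->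
    locally t0 (fun t => Rabs (Derive_n (x k) n t - Derive_n (x k) n t0) < 1)).
  intros k n le; apply Lb; auto; lra.
assert (la : forall P Q : R -> Prop, locally t0 P -> locally t0 Q -> locally t0 (fun t => P t /\ Q t))
  by (intros P Q; apply filter_and).
destruct (la _ _ (la _ _ (la _ _ Ld Lv) (la _ _ Lab
     (la _ _ (Ln false) (Ln true))))
  (la _ _ (la _ _ (L1 false 1%nat ltac:(lia)) (L1 true 1%nat ltac:(lia)))
  (la _ _ (la _ _ (L1 false 2%nat ltac:(lia)) (L1 true 2%nat ltac:(lia)))
    (la _ _ (L1 false 3%nat ltac:(lia)) (L1 true 3%nat ltac:(lia)))))) as [eta Heta].
assert (J : forall t, DI t0 eta t -> ball t0 eta t).
  intros t Ht; unfold DI in Ht; apply Rabs_def1; unfold minus, plus, opp; simpl; lra.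
exists eta, bd, (nv t0 / 2); split; [apply cond_pos |].
assert (Hn : forall t, DI t0 eta t -> near z (rho / 2) (coord i (gam t))).
  intros t Ht; destruct (Heta t (J t Ht)) as [[_ [_ [N0 N1]]] _].
  split; left; [exact N0 | exact N1].
split; [split | exact Hn].
- intros t Ht; destruct (Heta t (J t Ht)) as [[[D _] _] _]; split; auto.
  destruct (Hn t Ht); split; lra.
- intros t Ht; destruct (Heta t (J t Ht)) as [[_ [[A1 A2] _]] _]; now apply H.
- intros t k n Ht le.
  destruct (Heta t (J t Ht)) as [_ [[B1 B2] [[B3 B4] [B5 B6]]]].
  assert (X : Rabs (Derive_n (x k) n t - Derive_n (x k) n t0) < 1).
    destruct n as [|[|[|[|n]]]]; try lia; destruct k; auto.
  generalize (Bb k n le) (Rabs_triang (Derive_n (x k) n t - Derive_n (x k) n t0) (Derive_n (x k) n t0)).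
  replace (Derive_n (x k) n t - Derive_n (x k) n t0 + Derive_n (x k) n t0) with (Derive_n (x k) n t) by ring.
  fold x; lra.
- lra.
- intros t Ht; destruct (Heta t (J t Ht)) as [[[_ Lt] _] _]; left; exact Lt.
Qed.

(** Both claims reduce to this: a fixed metric is a family with one element, and only the source of
    the boxes and of the curvature bound differs. *)
Lemma asymptotics_of_boxes {S : surface} (alpha beta : Rbar) (gam : R -> S) (M : metric S -> Prop) :
  (forall t : R, Rbar_lt alpha t -> Rbar_lt t beta -> curve_Cn 3 gam t /\ regular gam t) ->
  (forall (i : chart S) z, in_image i z -> exists rho K c, 0 < rho /\ box_bounds M i z rho K c) ->
  (forall t : R, Rbar_lt alpha t -> Rbar_lt t beta ->
    exists k, 0 < k /\ forall g, M g -> k <= geod_curvature g gam t) ->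
  forall p q : R, Rbar_lt alpha p -> p <= q -> Rbar_lt q beta -> uniform_asymptotics M gam p q.
Proof.
intros Hgam Hbox Hk p q Hp pq Hq; apply local_to_global; intros t Ht.
assert (Ha : Rbar_lt alpha t) by (apply Rbar_lt_le_trans with (1 := Hp); simpl; lra).
assert (Hb : Rbar_lt t beta) by (apply Rbar_le_lt_trans with (2 := Hq); simpl; lra).
destruct (Hbox (chart_at (gam t)) (coord (chart_at (gam t)) (gam t))) as [rho [K [c [rho0 HB]]]].
  exists (gam t); split; auto; apply chart_at_dom.
destruct (arc_setup gam alpha beta t rho Hgam Ha Hb rho0) as [eta [B [v0 [eta0 [HA Hhalf]]]]].
destruct (Hk t Ha Hb) as [k [k0 Hk']].
(* The chart is the one selected at [gam t], so there [geod_curvature] is [chart_curv] by definition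
   and its lower bound can be used before any tangent geodesic is given. *)
exact (local_estimate M _ _ rho K c gam t eta B v0 k HB HA Hhalf rho0 eta0 k0 Hk').
Qed.

Theorem theorem1p16 (S : surface) (alpha beta : Rbar) (gam : R -> S)
  (hgam : forall t : R, Rbar_lt alpha t -> Rbar_lt t beta ->
     curve_Cn 3 gam t /\ regular gam t) :
  (forall g : metric S,
     (forall t : R, Rbar_lt alpha t -> Rbar_lt t beta ->
        0 < geod_curvature g gam t) ->
     forall p q : R, Rbar_lt alpha p -> p <= q -> Rbar_lt q beta ->
       uniform_asymptotics (fun h => h = g) gam p q) /\
  (forall M : metric S -> Prop,
     C3_bounded M -> away_from_boundary M gam alpha beta ->
     forall p q : R, Rbar_lt alpha p -> p <= q -> Rbar_lt q beta ->
       uniform_asymptotics M gam p q).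
Proof.
split.
- intros g Hk; apply asymptotics_of_boxes; auto.
  + intros i z Hz; now apply box_of_metric.
  + intros t Ha Hb; exists (geod_curvature g gam t); split; [now apply Hk |].
    intros h ->; lra.
- intros M HC [Hc Hk]; apply asymptotics_of_boxes; auto.
  + intros i z Hz; now apply box_of_C3_bounded.
  (* The curvature bound is taken on the degenerate interval from [t] to [t]: a bound at the base
     point is enough. *)
  + intros t Ha Hb; destruct (Hk t t Ha (Rle_refl t) Hb) as [k [k0 Hk']].
    exists k; split; auto; intros g Mg; apply Hk'; auto; lra.
Qed.
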